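(* Let $p=p_1+p_2$ with integers $p_1,p_2\ge 1$, let $\Sigma=\begin{pmatrix}\Sigma_{11}&\Sigma_{12}\\ \Sigma_{21}&\Sigma_{22}\end{pmatrix}$ be a non-singular $(p\times p)$ covariance matrix partitioned into blocks with $\Sigma_{ii}$ of size $p_i\times p_i$, and put $\Sigma_0=\Sigma_{11}-\Sigma_{12}\Sigma_{22}^{-1}\Sigma_{21}$. Let $\alpha$ be a real number with $2\alpha>\max(p_1-1,p_2-1)$. Then the function $g_\alpha(x_1,\dots,x_p;\alpha,\Sigma)$ on $(0,\infty)^p$ with Laplace transform $|I_p+\Sigma T|^{-\alpha}$, $T=\mathrm{diag}(t_1,\dots,t_p)$, $t_j\ge 0$, is given by $$g_\alpha(x_1,\dots,x_p;\alpha,\Sigma)=\frac{1}{\Gamma_{p_2}(\alpha)\,|\Sigma_{22}|^{\alpha}}\int_{\mathcal{C}_{p_2}} g_\alpha\bigl(x_1,\dots,x_{p_1};\alpha,\Sigma_0,\Sigma_{12}\Sigma_{22}^{-1}X^{1/2}CX^{1/2}\Sigma_{22}^{-1}\Sigma_{21}\bigr)\,|X|^{\alpha-1}\,|C|^{\alpha-(p_2+1)/2}\,\mathrm{etr}\bigl(-\Sigma_{22}^{-1}X^{1/2}CX^{1/2}\bigr)\,dC,$$ where $X=\mathrm{diag}(x_{p_1+1},\dots,x_p)$, $\mathcal{C}_{p_2}$ is the set of all $(p_2\times p_2)$ correlation matrices, and $g_\alpha(x_1,\dots,x_{p_1};\alpha,\Sigma_0,\Delta)$ denotes the non-central $\Gamma_{p_1}(\alpha,\Sigma_0,\Delta)$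 probability density with non-centrality matrix $\Delta$.
   Context: A non-singular covariance matrix is a real symmetric positive definite matrix. $|A|$ denotes the determinant of $A$, $\mathrm{etr}(A)=\exp(\mathrm{tr}\,A)$, and $I_p$ is the $(p\times p)$ identity matrix. The Laplace transform of a function $f$ on $(0,\infty)^n$ is $\int_{(0,\infty)^n} \exp\bigl(-\sum_{j=1}^n t_jx_j\bigr)f(x_1,\dots,x_n)\,dx_1\cdots dx_n$, $t_j\ge 0$. Functions specified by their Laplace transform are determined up to Lebesgue null sets, and the identity is understood for almost all $(x_1,\dots,x_p)\in(0,\infty)^p$. Non-central density: for a $(p_1\times p_1)$ non-singular covariance matrix $\Sigma_0$, a symmetric positive semi-definite $(p_1\times p_1)$ matrix $\Delta$ (of any rank $k\le p_1$), and $2\alpha>p_1-1$, the non-central $\Gamma_{p_1}(\alpha,\Sigma_0,\Delta)$ distribution is the distribution of the diagonal of a random symmetric matrix $Z$ such that $2Z$ has the non-central Wishart distribution $W_{p_1}(2\alpha,\Sigma_0,\Delta)$ (known to exist for $2\alpha>p_1-1$). It is the probability distribution on $(0,\infty)^{p_1}$ whose density $g_\alpha(x_1,\dots,x_{p_1};\alpha,\Sigma_0,\Delta)$ has the Laplace transform $$|I_{p_1}+\Sigma_0T_1|^{-\alpha}\,\mathrm{etr}\bigl(-T_1(I_{p_1}+\Sigma_0T_1)^{-1}\Delta\bigr),\qquad T_1=\mathrm{diag}(t_1,\dots,t_{p_1}),\ t_j\ge 0.$$ The version of this density that is continuous on the open orthant is used. The multivariate gamma function is $\Gamma_{p_2}(\alpha)=\pi^{p_2(p_2-1)/4}\prod_{j=1}^{p_2}\Gamma\bigl(\alpha-\tfrac{j-1}{2}\bigr)$.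 $\mathcal{C}_{p_2}$ is the set of real symmetric positive semi-definite $(p_2\times p_2)$ matrices with unit diagonal, and $dC=\prod_{i<j}dc_{ij}$ is Lebesgue measure in the off-diagonal entries $c_{ij}$, $i<j$ (the singular correlation matrices form a null set). For $p_2=1$, $\mathcal{C}_1=\{1\}$ and the integral is simply the integrand at $C=1$. *)

(* Defs.v *)
From HB Require Import structures.
From mathcomp Require Import all_boot all_order all_algebra.
From mathcomp Require Import all_classical all_reals all_analysis.

Set Implicit Arguments.
Unset Strict Implicit.
Unset Printing Implicit Defensive.

Import Order.TTheory GRing.Theory Num.Theory.
Import numFieldNormedType.Exports.

Local Open Scope classical_set_scope.
Local Open Scope ring_scope.

(* Lebesgue measure on R^n, carried by [n.-tuple R] with its product
   sigma-algebra. By recursion on n: the unit mass on the one-point space R^0;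
   then the image of the product of the Lebesgue measures on R and R^n under
   (a, s) |-> a :: s. *)
Section lebesgue_step.
Context {R : realType} (n : nat).
Variable mu : {sigma_finite_measure set (n.-tuple R) -> \bar R}.

Definition cons_pair (x : measurableTypeR R * n.-tuple R) : n.+1.-tuple R :=
  [the n.+1.-tuple R of x.1 :: x.2].

Lemma measurable_cons_pair : measurable_fun [set: measurableTypeR R * n.-tuple R] cons_pair.
Proof. exact: measurable_cons. Qed.

Definition lebesgue_step : set (n.+1.-tuple R) -> \bar R :=
  pushforward (@lebesgue_measure R \x mu)%E cons_pair.

Let step0 : lebesgue_step set0 = 0%E.
Proof. by rewrite /lebesgue_step /pushforward preimage_set0 measure0. Qed.

Let step_ge0 A : (0 <= lebesgue_step A)%E.
Proof. exact: (measure_ge0 (@lebesgue_measure R \x mu)%E). Qed.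

Let step_sigma_additive : semi_sigma_additive lebesgue_step.
Proof.
move=> F mF tF mUF; rewrite /lebesgue_step /pushforward preimage_bigcup.
have mpre B : measurable B -> measurable (cons_pair @^-1` B).
  by move=> mB; rewrite -[X in measurable X]setTI; exact: measurable_cons_pair.
apply: measure_semi_sigma_additive.
- by move=> k; exact: mpre.
- apply/trivIsetP => i j _ _ ij; rewrite -preimage_setI.
  by move/trivIsetP : tF => /(_ _ _ _ _ ij) ->//; rewrite preimage_set0.
- by rewrite -preimage_bigcup; exact: mpre.
Qed.

HB.instance Definition _ := isMeasure.Build _ _ _ lebesgue_step
  step0 step_ge0 step_sigma_additive.

Let step_sigma_finite : sigma_finite setT lebesgue_step.
Proof.
have /sigma_finiteP[F [FT ndF Foo]] := sigma_finiteT (@lebesgue_measure R).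
have /sigma_finiteP[G [GT ndG Goo]] := sigma_finiteT mu.
pose uncons (s : n.+1.-tuple R) : measurableTypeR R * n.-tuple R :=
  (tnth s ord0, [tuple of behead s]).
have uncons_cons x : uncons (cons_pair x) = x.
  by case: x => a s; congr (_, _); exact: val_inj.
have muncons : measurable_fun [set: n.+1.-tuple R] uncons.
  apply: measurable_fun_pair; first exact: measurable_tnth.
  exact: measurable_behead.
exists (fun k => uncons @^-1` (F k `*` G k)).
  apply/esym/seteqP; split => // s _; case st: (uncons s) => [a t].
  have [i _ Fa] : (\bigcup_i F i) a by rewrite -FT.
  have [j _ Gt] : (\bigcup_i G i) t by rewrite -GT.
  exists (maxn i j) => //; rewrite /preimage /mkset st; split => /=.
    by move: a Fa {st}; exact/subsetPset/ndF/leq_maxl.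
  by move: t Gt {st}; exact/subsetPset/ndG/leq_maxr.
move=> k; have [mFk Fkoo] := Foo k; have [mGk Gkoo] := Goo k; split.
  by rewrite -[X in measurable X]setTI; apply: muncons => //; exact: measurableX.
rewrite /lebesgue_step /pushforward.
rewrite (_ : _ @^-1` _ = F k `*` G k); last first.
  by apply/funext => x; rewrite /preimage /mkset uncons_cons.
by rewrite product_measure1E// lte_mul_pinfty// ge0_fin_numE.
Qed.

HB.instance Definition _ := Measure_isSigmaFinite.Build _ _ _ lebesgue_step
  step_sigma_finite.

End lebesgue_step.

Fixpoint lebesgue_tuple (R : realType) (n : nat) :
    {sigma_finite_measure set (n.-tuple R) -> \bar R} :=
  match n with
  | 0 => dirac [tuple]
  | m.+1 => lebesgue_step (lebesgue_tuple R m)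
  end.

(* Functions on R^n take row vectors; integration runs over tuples. *)
Definition tuple_row (R : realType) n (s : n.-tuple R) : 'rV[R]_n :=
  \row_i tnth s i.

Definition orthant (R : realType) n : set 'rV[R]_n :=
  [set x | forall i, 0 < x ord0 i].

Definition posdefmx (R : realType) n (A : 'M[R]_n) : Prop :=
  A^T = A /\ forall v : 'rV[R]_n, v != 0 -> 0 < (v *m A *m v^T) ord0 ord0.

Definition possemidefmx (R : realType) n (A : 'M[R]_n) : Prop :=
  A^T = A /\ forall v : 'rV[R]_n, 0 <= (v *m A *m v^T) ord0 ord0.

Definition etr (R : realType) n (A : 'M[R]_n) : R := expR (\tr A).

(* Integrability of f itself is the case t = 0 of the convergence of the
   transform, and gives it for every t >= 0. *)
Definition has_laplace_transform (R : realType) n (f L : 'rV[R]_n -> R) : Prop :=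
  (lebesgue_tuple R n).-integrable (@tuple_row R n @^-1` @orthant R n)
     (fun s => (f (tuple_row s))%:E) /\
  forall t : 'rV[R]_n, (forall i, 0 <= t ord0 i) ->
    (\int[lebesgue_tuple R n]_(s in @tuple_row R n @^-1` @orthant R n)
       (expR (- \sum_j t ord0 j * tuple_row s ord0 j) * f (tuple_row s))%:E
     = (L t)%:E)%E.

Definition gamma_laplace (R : realType) n (alpha : R) (Sigma : 'M[R]_n)
    (t : 'rV[R]_n) : R :=
  \det (1%:M + Sigma *m diag_mx t) `^ (- alpha).

Definition noncentral_gamma_laplace (R : realType) n (alpha : R)
    (Sigma0 Delta : 'M[R]_n) (t : 'rV[R]_n) : R :=
  \det (1%:M + Sigma0 *m diag_mx t) `^ (- alpha) *
  etr (- (diag_mx t *m invmx (1%:M + Sigma0 *m diag_mx t) *m Delta)).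

(* The total mass is the Laplace transform at t = 0, namely 1. Continuity
   selects the representative pointwise on the open orthant. *)
Definition noncentral_gamma_density (R : realType) n (alpha : R)
    (Sigma0 Delta : 'M[R]_n) (f : 'rV[R]_n -> R) : Prop :=
  [/\ forall x, orthant x -> 0 <= f x,
      {within @orthant R n, continuous f} &
      has_laplace_transform f (noncentral_gamma_laplace alpha Sigma0 Delta)].

Definition Gamma (R : realType) (a : R) : R :=
  \int[@lebesgue_measure R]_(x in `]0, +oo[) (x `^ (a - 1) * expR (- x)).

(* The index j runs from 0, whence Gamma (alpha - j / 2). *)
Definition multigamma (R : realType) (n : nat) (alpha : R) : R :=
  pi `^ (n%:R * (n%:R - 1) / 4) * \prod_(j < n) Gamma (alpha - j%:R / 2).

Definition upper_pair (n : nat) := {ij : 'I_n * 'I_n | (ij.1 < ij.2)%N}.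

(* The unit-diagonal symmetric matrix with off-diagonal entries c, indexed by
   the pairs i < j; [insub (i, j)] is [Some] exactly when i < j. *)
Definition corrmx (R : realType) n (c : #|{: upper_pair n}|.-tuple R) :
    'M[R]_n :=
  \matrix_(i, j)
    match insub (i, j) : option (upper_pair n),
          insub (j, i) : option (upper_pair n) with
    | Some u, _ => tnth c (enum_rank u)
    | None, Some u => tnth c (enum_rank u)
    | None, None => 1
    end.

Definition correlation_matrix (R : realType) n (C : 'M[R]_n) : Prop :=
  possemidefmx C /\ forall i, C i i = 1.

(* The integral of F over the correlation matrices with respect to
   dC = prod_(i < j) dc_ij; for n = 1 this is F 1%:M, as R^0 has unit mass. *)
Definition corr_integral (R : realType) n (F : 'M[R]_n -> \bar R) : \bar R :=
  (\int[lebesgue_tuple R #|{: upper_pair n}|]_(c in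
      [set c | correlation_matrix (corrmx c)]) F (corrmx c))%E.

Section block_formula.
Context (R : realType) (p1 p2 : nat).
Variables (alpha : R) (Sigma : 'M[R]_(p1 + p2)).

Local Notation Sigma11 := (ulsubmx Sigma).
Local Notation Sigma12 := (ursubmx Sigma).
Local Notation Sigma21 := (dlsubmx Sigma).
Local Notation Sigma22 := (drsubmx Sigma).

Definition schur_complement : 'M[R]_p1 :=
  Sigma11 - Sigma12 *m invmx Sigma22 *m Sigma21.

(* g Delta plays the role of the non-central density with non-centrality
   matrix Delta. The value is extended real: the integral may be infinite on a
   null set of x. *)
Definition mixture_density (g : 'M[R]_p1 -> 'rV[R]_p1 -> R)
    (x : 'rV[R]_(p1 + p2)) : \bar R :=
  let X := diag_mx (rsubmx x) in
  let sqrtX := diag_mx (map_mx Num.sqrt (rsubmx x)) in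
  (((multigamma p2 alpha * \det Sigma22 `^ alpha)^-1)%:E *
   corr_integral (fun C : 'M[R]_p2 =>
     (g (Sigma12 *m invmx Sigma22 *m (sqrtX *m C *m sqrtX)
           *m invmx Sigma22 *m Sigma21) (lsubmx x)
      * \det X `^ (alpha - 1)
      * \det C `^ (alpha - (p2%:R + 1) / 2)
      * etr (- (invmx Sigma22 *m (sqrtX *m C *m sqrtX))))%:E))%E.

End block_formula.

(* Main.v *)
Require Import Defs.
From mathcomp Require Import all_boot all_order all_algebra.
From mathcomp Require Import all_classical all_reals all_analysis.
From mathcomp Require Import measurable_realfun.
From mathcomp Require Import ring lra.

(** The proof compares Laplace transforms. Write [S22], [S12], [S21], [S0] for
the blocks and the Schur complement of [Sigma], [T1] and [T2] for the two parts
of the diagonal matrix [T], and [W = X^(1/2) C X^(1/2)], which runs over the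
positive semi-definite matrices as [X] and [C] vary. In the transform of the
right-hand side, integrate over the first [p1] variables first. By definition
of the non-central density this gives
  [|1 + S0 T1|^(-alpha) etr (- T1 (1 + S0 T1)^-1 S12 S22^-1 W S22^-1 S21)],
whose exponent is linear in [W]. Together with the factors [etr (- S22^-1 W)]
and [etr (- T2 W)] it becomes [etr (- B W)], where
  [B = S22^-1 + T2 + S22^-1 S21 T1 (1 + S0 T1)^-1 S12 S22^-1]
is positive definite ([mixing_rate], [trace_noncentral]). What remains is the
matrix gamma integral in the coordinates [(X, C)], with value
[Gamma_p2(alpha) |B|^(-alpha)] ([integral_orthant_corr]). A block elimination
gives [|1 + Sigma T| = |1 + S0 T1| |S22| |B|] ([det_mixing_rate]), so that the
transform is [|1 + Sigma T|^(-alpha)] ([laplace_transform_mixture]). At [T = 0]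
this says that the right-hand side has total mass 1; hence it is finite almost
everywhere, and the uniqueness of Laplace transforms ([laplace_unique])
identifies it with every other function that has this transform.

Three ingredients carry analytic content.

- The matrix gamma integral [integral_wishart] goes by induction on the size,
  peeling off the first row and column of [W]. The integral over the corner
  entry is a one-dimensional gamma integral shifted by a quadratic form in the
  rest of the row; the integral over that rest is then Gaussian. The
  substitution [w_ij = sqrt (x_i x_j) c_ij] turns the result into an integral
  over diagonals and correlation matrices.

- Uniqueness rests on explicit functions [step_approx m b] that converge
  boundedly to the indicator of [y > b] and are polynomials in [exp (- c y)].
  By dominated convergence the integrals of [f] over all products of rays are
  determined by its transform, and these products generate the Borel sets.

- Tonelli's theorem requires the non-central density to be jointly measurable
  in the non-centrality matrix and the point, whereas it is given for each
  matrix separately. The same approximation expresses its integrals over boxes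
  as limits of combinations of the transform, which is explicit in the
  non-centrality matrix; continuity on the orthant recovers the value at a
  point from averages over shrinking boxes ([measurable_noncentral]). *)

Set Implicit Arguments.
Unset Strict Implicit.
Unset Printing Implicit Defensive.

Import Order.TTheory GRing.Theory Num.Theory.
Import numFieldNormedType.Exports.

Local Open Scope classical_set_scope.
Local Open Scope ring_scope.

(** * Lebesgue measure on tuples *)
Section box.
Context {R : realType}.

Lemma ge0_integralZl_cst d (T : measurableType d) (mu : {measure set T -> \bar R})
    (c : R) (f : T -> \bar R) : 0 <= c -> measurable_fun setT f ->
  (forall x, 0 <= f x)%E ->
  (\int[mu]_x (c%:E * f x) = c%:E * \int[mu]_x f x)%E.
Proof. by move=> c0 mf f0; rewrite ge0_integralZl. Qed.

Definition tuple_box n (A : 'I_n -> set R) : set (n.-tuple R) :=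
[set s | forall i, A i (tnth s i)].

Lemma measurable_tuple_box n (A : 'I_n -> set R) :
  (forall i, measurable (A i)) -> measurable (tuple_box A).
Proof.
move=> mA; rewrite /tuple_box.
have -> : [set s : n.-tuple R | forall i, A i (tnth s i)] =
    \bigcap_(i in [set: 'I_n]) ((fun s => tnth s i) @^-1` A i).
  by apply/seteqP; split=> s /= h => [i _|i]; apply: h.
apply: (@fin_bigcap_measurable _ _ _ setT) => [|i _]; first exact: finite_finset.
by rewrite -[X in measurable X]setTI; exact: measurable_tnth.
Qed.

Lemma lebesgue_tuple_box n (A : 'I_n -> set R) :
  (forall i, measurable (A i)) -> (forall i, lebesgue_measure (A i) < +oo)%E ->
  lebesgue_tuple R n (tuple_box A) = (\prod_i fine (lebesgue_measure (A i)))%:E.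
Proof.
elim: n A => [|n IH] A mA fA.
  rewrite big_ord0 /= diracE mem_set//; by case.
rewrite big_ord_recl EFinM fineK; last by rewrite ge0_fin_numE.
rewrite -(IH (fun i => A (lift ord0 i))) //=.
rewrite /lebesgue_step /pushforward /=.
have -> : @cons_pair R n @^-1` tuple_box A =
   A ord0 `*` tuple_box (fun i => A (lift ord0 i)).
  apply/seteqP; split => -[a s] /=.
    move=> h; split; first exact: (h ord0).
    move=> i; have := h (lift ord0 i); by rewrite tnthS.
  move=> [h0 h] i; case: (unliftP ord0 i) => [j ->|->] //=.
  by rewrite /cons_pair tnthS; exact: h.
rewrite product_measure1E//; first exact: (mA ord0).
by apply: measurable_tuple_box => i; exact: mA.
Qed.

(** Boxes of finite measure are stable under intersection, generate the product
sigma-algebra and exhaust the space, so they determine a measure. This reduces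
every change of coordinates below to its effect on boxes. *)
Lemma lebesgue_tuple_unique n (mu : {measure set (n.-tuple R) -> \bar R}) :
  (forall A : 'I_n -> set R, (forall i, measurable (A i)) ->
     (forall i, lebesgue_measure (A i) < +oo)%E ->
     mu (tuple_box A) = (\prod_i fine (lebesgue_measure (A i)))%:E) ->
  forall B, measurable B -> mu B = lebesgue_tuple R n B.
Proof.
move=> muE B mB.
have /sigma_finiteP[F [FT ndF Foo]] := sigma_finiteT (@lebesgue_measure R).
have cov (x : R) : exists k, F k x.
  have : (\bigcup_i F i) x by rewrite -FT.
  by case=> k _ ?; exists k.
pose good (A : 'I_n -> set R) := forall i, measurable (A i) /\ (lebesgue_measure (A i) < +oo)%E.
pose G : set (set (n.-tuple R)) := [set B | exists2 A, good A & B = tuple_box A].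
apply: (@measure_unique _ _ _ G (fun k => tuple_box (fun=> F k))) => //.
- apply/seteqP; split; last first.
    apply: smallest_sub; first exact: sigma_algebra_measurable.
    by move=> _ [A gA ->]; apply: measurable_tuple_box => i; have [] := gA i.
  apply: smallest_sub; first exact: smallest_sigma_algebra.
  move=> C; rewrite -bigcup_seq/= => -[i _ [D mD <-]].
  rewrite setTI.
  have -> : (fun x : n.-tuple R => tnth x i) @^-1` D =
      \bigcup_k tuple_box (fun j => if j == i then D `&` F k else F k).
    apply/seteqP; split=> s /=.
      move=> Ds.
      have [k kP] := choice (fun j => cov (tnth s j)).
      exists (\max_j k j) => // j.
      have Fj : F (\max_j k j) (tnth s j).
        by apply: (subsetPset _ _ (ndF _ _ (leq_bigmax j))) (kP j).
      by case: eqP => // ji; split => //; rewrite ji.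
    by move=> [k _ /(_ i)]; rewrite eqxx => -[].
  apply: sigma_algebra_bigcup => k; apply: sub_sigma_algebra.
  exists (fun j => if j == i then D `&` F k else F k) => // j.
  have [mF Fk] := Foo k; case: ifP => _; last by split.
  have mDF : measurable (D `&` F k) by exact: measurableI.
  by split => //; apply: (le_lt_trans _ Fk); apply: le_measure; rewrite ?inE.
- move=> _ _ [A gA ->] [A' gA' ->]; exists (fun i => A i `&` A' i).
    move=> i; have [mA Aoo] := gA i; have [mA' _] := gA' i.
    have mI : measurable (A i `&` A' i) by exact: measurableI.
    by split => //; apply: (le_lt_trans _ Aoo); apply: le_measure; rewrite ?inE.
  apply/seteqP; split=> s /=; first by move=> [h h'] i; split.
  by move=> h; split=> i; have [] := h i.
- by move=> k; exists (fun=> F k) => // i; exact: Foo.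
- apply/seteqP; split => // s _ /=.
  have [k kP] := choice (fun j => cov (tnth s j)).
  exists (\max_j k j) => // j.
  by apply: (subsetPset _ _ (ndF _ _ (leq_bigmax j))) (kP j).
- move=> _ [A gA ->]; rewrite muE; [|by move=> i; have [] := gA i|by move=> i; have [] := gA i].
  by apply/esym/lebesgue_tuple_box => i; have [] := gA i.
- move=> k; rewrite muE ?ltry// => i; have [] := Foo k => //.
Qed.

Lemma ge0_integral_lebesgue_tuple_transfer d (X : measurableType d)
    (mu : {measure set X -> \bar R}) n (phi : X -> n.-tuple R) :
  measurable_fun setT phi ->
  (forall A : 'I_n -> set R, (forall i, measurable (A i)) ->
     (forall i, lebesgue_measure (A i) < +oo)%E ->
     mu (phi @^-1` tuple_box A) = (\prod_i fine (lebesgue_measure (A i)))%:E) ->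
  forall F : n.-tuple R -> \bar R, measurable_fun [set: n.-tuple R] F ->
  (forall s, 0 <= F s)%E ->
  (\int[lebesgue_tuple R n]_s F s = \int[mu]_x F (phi x))%E.
Proof.
move=> mphi muE F mF F0.
rewrite -[RHS](@ge0_integral_pushforward _ _ _ _ _ _ mphi mu setT F)//.
apply: eq_measure_integral => B mB _.
exact/esym/lebesgue_tuple_unique.
Qed.

Lemma ge0_integral_cons n (F : n.+1.-tuple R -> \bar R) :
  measurable_fun [set: n.+1.-tuple R] F -> (forall s, 0 <= F s)%E ->
  (\int[lebesgue_tuple R n.+1]_s F s =
   \int[lebesgue_tuple R n]_s \int[lebesgue_measure]_x F (cons_pair (x, s)))%E.
Proof.
move=> mF F0.
have mFc : measurable_fun setT (F \o @cons_pair R n).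
  by apply: measurableT_comp => //; exact: measurable_cons_pair.
rewrite -(@fubini_tonelli2 _ _ _ _ _ _ _ (F \o @cons_pair R n))//; last by move=> ?; exact: F0.
rewrite -[RHS](@ge0_integral_pushforward _ _ _ _ _ _ (@measurable_cons_pair R n)
  (lebesgue_measure \x lebesgue_tuple R n)%E setT F)//.
Qed.

(** The coordinates of a [k]-tuple are distributed between two shorter tuples
by an arbitrary bijection of the indices, which covers both the splitting of
[p1 + p2] variables and the reordering of matrix entries. *)
Definition glue k m n (h : 'I_k -> 'I_m + 'I_n) (w : m.-tuple R * n.-tuple R) :
    k.-tuple R :=
  [tuple match h i with inl j => tnth w.1 j | inr j => tnth w.2 j end | i < k].

Lemma measurable_glue k m n (h : 'I_k -> 'I_m + 'I_n) :
  measurable_fun setT (glue h).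
Proof.
apply/measurable_fun_tnthP => i /=.
rewrite (_ : _ \o _ = fun w : m.-tuple R * n.-tuple R =>
    match h i with inl j => tnth w.1 j | inr j => tnth w.2 j end); last first.
  by apply/funext => w; rewrite /= tnth_mktuple.
by case: (h i) => j; [apply: (measurableT_comp (measurable_tnth j) measurable_fst)
  |apply: (measurableT_comp (measurable_tnth j) measurable_snd)].
Qed.

Lemma ge0_integral_glue k m n (h : 'I_k -> 'I_m + 'I_n) : bijective h ->
  forall F : k.-tuple R -> \bar R, measurable_fun [set: k.-tuple R] F -> (forall s, 0 <= F s)%E ->
  (\int[lebesgue_tuple R k]_s F s =
   \int[lebesgue_tuple R m]_x \int[lebesgue_tuple R n]_y F (glue h (x, y)))%E.
Proof.
move=> [g hK gK] F mF F0.
have mFg : measurable_fun setT (F \o glue h).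
  by apply: measurableT_comp => //; exact: measurable_glue.
rewrite -(@fubini_tonelli1 _ _ _ _ _ _ _ (F \o glue h))//; last by move=> ?; exact: F0.
apply: ge0_integral_lebesgue_tuple_transfer => //; first exact: measurable_glue.
move=> A mA fA.
have -> : glue h @^-1` tuple_box A =
    tuple_box (fun j => A (g (inl j))) `*` tuple_box (fun j => A (g (inr j))).
  apply/seteqP; split=> -[s t] /=.
    move=> H; split=> j; [have := H (g (inl j))|have := H (g (inr j))];
    by rewrite tnth_mktuple gK.
  move=> [H1 H2] i; rewrite tnth_mktuple -[A i]/(A i) -{1}(hK i).
  by case: (h i) => j; [exact: H1|exact: H2].
rewrite [LHS]product_measure1E//; [|exact: measurable_tuple_box..].
transitivity ((\prod_j fine (lebesgue_measure (A (g (inl j)))))%:E *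
              (\prod_j fine (lebesgue_measure (A (g (inr j)))))%:E)%E.
  by congr (_ * _)%E; exact: lebesgue_tuple_box.
rewrite -[LHS]EFinM; congr EFin.
rewrite [RHS](reindex g); last by exists h => i _; [exact: gK|exact: hK].
by rewrite big_sumType.
Qed.

(** Uniqueness of Lebesgue measure on half-open intervals, applied to the
rescaled image measure. *)
Lemma lebesgue_measure_affine (k b : R) (A : set R) : 0 < k -> measurable A ->
  lebesgue_measure ((fun x : R => k * x + b) @^-1` A) = (k^-1%:E * lebesgue_measure A)%E.
Proof.
move=> k0 mA.
have mphi : measurable_fun setT (fun x : measurableTypeR R => (k * x + b : measurableTypeR R)).
  by apply: measurable_funD => //; exact: measurable_funM.
pose kn : {nonneg R} := NngNum (ltW k0).
pose f := fun x : measurableTypeR R => (k * x + b : measurableTypeR R).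
have -> : lebesgue_measure A = mscale kn (pushforward lebesgue_measure f) A.
  move=> mf; apply: lebesgue_measure_unique => //.
  move=> _ [[a c]] _ <-.
    have E : f @^-1` `]a, c]%classic = `](a - b) / k, (c - b) / k]%classic.
    apply/seteqP; split => x /=; rewrite !in_itv /=;
      by rewrite ltr_pdivrMr// ler_pdivlMr// ltrBlDr lerBrDr mulrC.
  change (lebesgue_measure `]a, c]%classic = k%:E * lebesgue_measure (f @^-1` `]a, c]%classic))%E.
  rewrite E !lebesgue_measure_itv /= !lte_fin ltr_pM2r ?invr_gt0// ltrD2r.
  case: ifP => _; last by rewrite mule0.
  rewrite -EFinB -EFinB -EFinM; congr EFin.
  by field; rewrite gt_eqF.
by rewrite /mscale /= /pushforward muleA -EFinM mulVf ?gt_eqF// mul1e.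
Qed.

Lemma ge0_integral_affine (k b : R) (F : R -> \bar R) : 0 < k ->
  measurable_fun [set: R] F -> (forall x, 0 <= F x)%E ->
  (\int[lebesgue_measure]_x F x =
   k%:E * \int[lebesgue_measure]_x F (k * x + b)%R)%E.
Proof.
move=> k0 mF F0.
pose f := fun x : measurableTypeR R => (k * x + b : measurableTypeR R).
have mf : measurable_fun setT f.
  by apply: measurable_funD => //; exact: measurable_funM.
pose kn : {nonneg R} := NngNum (ltW k0).
rewrite -(@ge0_integral_pushforward _ _ _ _ _ _ mf lebesgue_measure setT F)//.
rewrite -(@ge0_integral_mscale _ _ _ _ setT _ kn)//.
apply: eq_measure_integral => A mA _.
rewrite /= /mscale/= /pushforward lebesgue_measure_affine// muleA -EFinM.
by rewrite divff ?gt_eqF// mul1e.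
Qed.

Lemma ge0_integral_tuple_scale n (k : 'I_n -> R) (F : n.-tuple R -> \bar R) :
  (forall i, 0 < k i) ->
  measurable_fun [set: n.-tuple R] F -> (forall x, 0 <= F x)%E ->
  (\int[lebesgue_tuple R n]_s F s =
   (\prod_i k i)%:E *
   \int[lebesgue_tuple R n]_s F [tuple (k i * tnth s i)%R | i < n])%E.
Proof.
move=> k0 mF F0.
pose f := fun s : n.-tuple R => [tuple k i * tnth s i | i < n].
have mf : measurable_fun [set: n.-tuple R] f.
  apply/measurable_fun_tnthP => i /=.
  rewrite (_ : _ \o _ = fun s : n.-tuple R => k i * tnth s i); last first.
    by apply/funext => s; rewrite /= tnth_mktuple.
  by apply: measurable_funM => //; exact: measurable_tnth.
have K0 : 0 < \prod_i k i by exact: prodr_gt0.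
pose kn : {nonneg R} := NngNum (ltW K0).
rewrite -(@ge0_integral_mscale _ _ _ _ setT _ kn)//; last first.
  exact: measurableT_comp mF mf.
rewrite -(@ge0_integral_lebesgue_tuple_transfer _ _ _ _ f)// => A mA fA.
rewrite /= /mscale/=.
have -> : f @^-1` tuple_box A =
    tuple_box (fun i => (fun x : R => k i * x + 0) @^-1` A i).
  by apply/seteqP; split=> s /= H i; have := H i; rewrite /preimage/= tnth_mktuple addr0.
have E i : lebesgue_measure ((fun x : R => k i * x + 0) @^-1` A i) =
    ((k i)^-1 * fine (lebesgue_measure (A i)))%:E.
  by rewrite lebesgue_measure_affine// EFinM fineK// ge0_fin_numE.
rewrite lebesgue_tuple_box; first last.
- by move=> i; rewrite E ltry.
- move=> i; rewrite -[X in measurable X]setTI.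
  have mki : measurable_fun [set: R] (fun x : R => k i * x + 0).
    by apply: measurable_funD => //; exact: measurable_funM.
  exact: mki.
rewrite -EFinM -big_split /=; congr EFin.
apply: eq_bigr => i _.
by rewrite E/= mulrA divff ?mul1r// gt_eqF.
Qed.

End box.

Lemma fubini_tonelli_rotate d1 d2 d3 (X : measurableType d1) (Y : measurableType d2)
    (Z : measurableType d3) (R : realType)
    (m1 : {sigma_finite_measure set X -> \bar R})
    (m2 : {sigma_finite_measure set Y -> \bar R})
    (m3 : {sigma_finite_measure set Z -> \bar R}) (F : X * (Y * Z) -> \bar R) :
  measurable_fun setT F -> (forall u, 0 <= F u)%E ->
  (\int[m1]_x \int[m2]_y \int[m3]_z F (x, (y, z)) =
   \int[m2]_y \int[m3]_z \int[m1]_x F (x, (y, z)))%E.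
Proof.
move=> mF F0.
pose H (w : X * Y) := (\int[m3]_z F (w.1, (w.2, z)))%E.
have mH : measurable_fun setT H.
  apply: (@measurable_fun_fubini_tonelli_F _ _ _ _ _ _ (fun w => F (w.1.1, (w.1.2, w.2)))) => //.
  apply: (measurableT_comp mF); apply: measurable_fun_pair.
    exact: (measurableT_comp measurable_fst measurable_fst).
  apply: measurable_fun_pair => //.
  exact: (measurableT_comp measurable_snd measurable_fst).
rewrite (@fubini_tonelli _ _ _ _ _ m1 m2 H)//; last by move=> w; exact: integral_ge0.
apply: eq_integral => y _.
rewrite (@fubini_tonelli _ _ _ _ _ m1 m3 (fun w => F (w.1, (y, w.2))))//.
apply: (measurableT_comp mF); apply: measurable_fun_pair => //.
by apply: measurable_fun_pair.
Qed.

(** * Positive definite matrices *)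
Section posdef.
Context {R : realType}.
Implicit Types (m n p q : nat).

Lemma posdefmx_sym n (A : 'M[R]_n) : posdefmx A -> A^T = A.
Proof. by case. Qed.

Lemma posdefmxW n (A : 'M[R]_n) : posdefmx A -> possemidefmx A.
Proof.
move=> [As Ap]; split => // v; have [->|/Ap/ltW//] := eqVneq v 0.
by rewrite !mul0mx mxE.
Qed.

Lemma possemidefmx_congr m n (P : 'M[R]_(m, n)) (A : 'M[R]_n) :
  possemidefmx A -> possemidefmx (P *m A *m P^T).
Proof.
move=> [As Ap]; split; first by rewrite !trmx_mul trmxK As mulmxA.
move=> v; have := Ap (v *m P).
by rewrite trmx_mul !mulmxA.
Qed.

Lemma posdefmx_congr n (P A : 'M[R]_n) : P \in unitmx ->
  posdefmx A -> posdefmx (P *m A *m P^T).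
Proof.
move=> uP [As Ap]; split; first by rewrite !trmx_mul trmxK As mulmxA.
move=> v v0; have := Ap (v *m P).
rewrite trmx_mul !mulmxA; apply; apply: contra_neq v0 => vP.
by rewrite -(mulmxK uP v) vP mul0mx.
Qed.

Lemma posdefmx_congrE n (P A : 'M[R]_n) : P \in unitmx ->
  posdefmx (P *m A *m P^T) <-> posdefmx A.
Proof.
move=> uP; split; last exact: posdefmx_congr.
have uP' : invmx P \in unitmx by rewrite unitmx_inv.
move=> /(posdefmx_congr uP'); congr posdefmx.
rewrite trmx_inv -!mulmxA mulmxV ?unitmx_tr// mulmx1 mulmxA.
by rewrite mulVmx// mul1mx.
Qed.

Lemma posdefmx_unit n (A : 'M[R]_n) : posdefmx A -> A \in unitmx.
Proof.
move=> [_ Ap]; rewrite -row_free_unit -kermx_eq0.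
apply/rowV0P => v /sub_kermxP vA.
apply/eqP; apply: contraT => /Ap; by rewrite vA mul0mx mxE ltxx.
Qed.

Lemma posdefmx_inv n (A : 'M[R]_n) : posdefmx A -> posdefmx (invmx A).
Proof.
move=> pA; have uA := posdefmx_unit pA.
have uA' : invmx A \in unitmx by rewrite unitmx_inv.
have := posdefmx_congr uA' pA.
by rewrite mulVmx// mul1mx trmx_inv (posdefmx_sym pA).
Qed.

Lemma posdefmxD n (A B : 'M[R]_n) :
  posdefmx A -> possemidefmx B -> posdefmx (A + B).
Proof.
move=> [As Ap] [Bs Bp]; split; first by rewrite linearD/= As Bs.
by move=> v v0; rewrite mulmxDr mulmxDl mxE ltr_wpDr ?Bp ?Ap.
Qed.

Lemma possemidefmxD n (A B : 'M[R]_n) :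
  possemidefmx A -> possemidefmx B -> possemidefmx (A + B).
Proof.
move=> [As Ap] [Bs Bp]; split; first by rewrite linearD/= As Bs.
by move=> v; rewrite mulmxDr mulmxDl mxE addr_ge0.
Qed.

Lemma posdefmx_block_diag p q (S : 'M[R]_p) (D : 'M[R]_q) :
  posdefmx (block_mx S 0 0 D) <-> posdefmx S /\ posdefmx D.
Proof.
split=> [[Ws Wp]|[[Ss Sp] [Ds Dp]]].
  move: Ws; rewrite tr_block_mx => /eq_block_mx[Ss _ _ Ds].
  split; split => // v v0.
    have := Wp (row_mx v 0); rewrite tr_row_mx trmx0 mul_row_block !mulmx0 !mul0mx !addr0.
    rewrite mul_row_col mulmx0 addr0; apply; apply: contra_neq v0.
    by rewrite -row_mx0 => /eq_row_mx[].
  have := Wp (row_mx 0 v); rewrite tr_row_mx trmx0 mul_row_block !mulmx0 !mul0mx !add0r.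
  rewrite mul_row_col mulmx0 add0r; apply; apply: contra_neq v0.
  by rewrite -row_mx0 => /eq_row_mx[].
split; first by rewrite tr_block_mx !trmx0 Ss Ds.
move=> v; rewrite -[v]hsubmxK; set x := lsubmx v; set y := rsubmx v => v0.
rewrite tr_row_mx mul_row_block !mulmx0 addr0 add0r mul_row_col mxE.
have [x0|x0] := eqVneq x 0.
  rewrite x0 !mul0mx [X in X + _]mxE add0r Dp//.
  by apply: contra_neq v0 => y0; rewrite x0 y0 row_mx0.
rewrite ltr_wpDr ?Sp//.
by have [_] := posdefmxW (conj Ds Dp); apply.
Qed.

Lemma block_schur_dr p q (A : 'M[R]_p) (B : 'M[R]_(p, q)) (D : 'M[R]_q) :
  D^T = D -> D \in unitmx ->
  block_mx A B B^T D = block_mx 1%:M (B *m invmx D) 0 1%:M *m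
    block_mx (A - B *m invmx D *m B^T) 0 0 D *m
    (block_mx 1%:M (B *m invmx D) 0 1%:M)^T.
Proof.
move=> Ds uD; rewrite tr_block_mx !mulmx_block !trmx0 !trmx1 !trmx_mul trmx_inv Ds.
rewrite !(mulmx0, mul0mx, mul1mx, mulmx1, addr0, add0r) mulmxKV//.
by rewrite mulmxA subrK mulmxA mulmxV// mul1mx.
Qed.

Lemma block_schur_ul p q (A : 'M[R]_p) (B : 'M[R]_(p, q)) (D : 'M[R]_q) :
  A^T = A -> A \in unitmx ->
  block_mx A B B^T D = block_mx 1%:M 0 (B^T *m invmx A) 1%:M *m
    block_mx A 0 0 (D - B^T *m invmx A *m B) *m
    (block_mx 1%:M 0 (B^T *m invmx A) 1%:M)^T.
Proof.
move=> As uA; rewrite tr_block_mx !mulmx_block !trmx0 !trmx1 !trmx_mul trmx_inv As trmxK.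
rewrite !(mulmx0, mul0mx, mul1mx, mulmx1, addr0, add0r) mulmxKV//.
by rewrite !mulmxA mulmxV// mul1mx addrC subrK.
Qed.

Lemma utri1_unit p q (B : 'M[R]_(p, q)) : block_mx 1%:M B 0 1%:M \in unitmx.
Proof. by rewrite unitmxE det_ublock !det1 mulr1 unitr1. Qed.

Lemma ltri1_unit p q (B : 'M[R]_(q, p)) : block_mx 1%:M 0 B 1%:M \in unitmx.
Proof. by rewrite unitmxE det_lblock !det1 mulr1 unitr1. Qed.

Lemma det_schur_dr p q (A : 'M[R]_p) (B : 'M[R]_(p, q)) (D : 'M[R]_q) :
  D^T = D -> D \in unitmx ->
  \det (block_mx A B B^T D) = \det (A - B *m invmx D *m B^T) * \det D.
Proof.
move=> Ds uD; rewrite block_schur_dr// !det_mulmx det_tr det_ublock !det1.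
by rewrite !mul1r mulr1 det_ublock.
Qed.

Lemma det_schur_ul p q (A : 'M[R]_p) (B : 'M[R]_(p, q)) (C : 'M[R]_(q, p))
    (D : 'M[R]_q) : A \in unitmx ->
  \det (block_mx A B C D) = \det A * \det (D - C *m invmx A *m B).
Proof.
move=> uA.
have -> : block_mx A B C D = block_mx 1%:M 0 (C *m invmx A) 1%:M *m
    block_mx A B 0 (D - C *m invmx A *m B).
  rewrite mulmx_block !(mulmx0, mul0mx, mul1mx, mulmx1, addr0, add0r) mulmxKV//.
  by rewrite addrC subrK.
by rewrite det_mulmx det_lblock !det1 !mul1r det_ublock.
Qed.

(** Block elimination writes the matrix as a congruence of the block diagonal
matrix of [D] and the Schur complement of [D]. *)
Lemma posdefmx_schur_dr p q (A : 'M[R]_p) (B : 'M[R]_(p, q)) (D : 'M[R]_q) :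
  posdefmx (block_mx A B B^T D) <->
  posdefmx D /\ posdefmx (A - B *m invmx D *m B^T).
Proof.
split=> [W|[pD pS]]; last first.
  rewrite block_schur_dr ?(posdefmx_sym pD) ?posdefmx_unit//.
  by apply: posdefmx_congr; [exact: utri1_unit|apply/posdefmx_block_diag].
have pD : posdefmx D.
  have [Ws Wp] := W; move: Ws; rewrite tr_block_mx => /eq_block_mx[_ _ _ Ds].
  split => // v v0; have := Wp (row_mx 0 v).
  rewrite tr_row_mx trmx0 mul_row_block !mul0mx !add0r mul_row_col mulmx0 add0r.
  by apply; apply: contra_neq v0; rewrite -row_mx0 => /eq_row_mx[].
split => //; move: W; rewrite block_schur_dr ?(posdefmx_sym pD) ?posdefmx_unit//.
by move=> /posdefmx_congrE => /(_ (utri1_unit _)) /posdefmx_block_diag[].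
Qed.

Lemma posdefmx_schur_ul p q (A : 'M[R]_p) (B : 'M[R]_(p, q)) (D : 'M[R]_q) :
  posdefmx (block_mx A B B^T D) ->
  posdefmx A /\ posdefmx (D - B^T *m invmx A *m B).
Proof.
move=> W.
have pA : posdefmx A.
  have [Ws Wp] := W; move: Ws; rewrite tr_block_mx => /eq_block_mx[As _ _ _].
  split => // v v0; have := Wp (row_mx v 0).
  rewrite tr_row_mx trmx0 mul_row_block !mul0mx !addr0 mul_row_col mulmx0 addr0.
  by apply; apply: contra_neq v0; rewrite -row_mx0 => /eq_row_mx[].
split => //; move: W; rewrite block_schur_ul ?(posdefmx_sym pA) ?posdefmx_unit//.
by move=> /posdefmx_congrE => /(_ (ltri1_unit _)) /posdefmx_block_diag[].
Qed.

Lemma symmx_block p q (W : 'M[R]_(p + q)) : W^T = W ->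
  W = block_mx (ulsubmx W) (ursubmx W) (ursubmx W)^T (drsubmx W).
Proof. by move=> Ws; rewrite trmx_ursub Ws submxK. Qed.

Lemma posdefmx11 (A : 'M[R]_1) : posdefmx A <-> 0 < A 0 0.
Proof.
split=> [[_ Ap]|A0].
  have := Ap 1%:M; rewrite mul1mx trmx1 mulmx1; apply.
  by apply/eqP => /matrixP/(_ 0 0)/eqP; rewrite !mxE oner_eq0.
split; first by apply/matrixP => i j; rewrite mxE !ord1.
move=> v v0; rewrite !mxE big_ord1 !mxE big_ord1.
have v00 : v 0 0 != 0.
  by apply: contra_neq v0 => v00; apply/matrixP => i j; rewrite !ord1 v00 mxE.
by rewrite mulrAC mulr_gt0// -expr2 exprn_even_gt0.
Qed.

Lemma posdefmx_det_gt0 n (A : 'M[R]_n) : posdefmx A -> 0 < \det A.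
Proof.
elim: n A => [|n IH] A pA; first by rewrite det_mx00.
rewrite -[n.+1]/(1 + n)%N in A pA *.
have As := posdefmx_sym pA.
move: pA; rewrite (symmx_block As) => /posdefmx_schur_dr [pD pS].
rewrite det_schur_dr ?(posdefmx_sym pD) ?posdefmx_unit// mulr_gt0 ?IH//.
by rewrite det_mx11; apply/posdefmx11.
Qed.

(** If [v A v^T = 0] then [v] is in the kernel of [A]: otherwise [u = v A] is
non-zero, and the form at [v + t u], which is [2 t |u|^2 + t^2 (u A u^T)], is
negative for small negative [t]. *)
Lemma possemidefmx_posdefmx n (A : 'M[R]_n) :
  possemidefmx A -> \det A != 0 -> posdefmx A.
Proof.
move=> [As Ap] dA; split => // v v0; rewrite lt_neqAle Ap andbT eq_sym.
apply: contra_neq v0 => vAv.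
have uA : A \in unitmx by rewrite unitmxE unitfE.
suff vA : v *m A = 0 by rewrite -(mulmxK uA v) vA mul0mx.
apply/eqP; apply: contraT => vA0.
have [u uE] : exists u, u = v *m A by exists (v *m A).
pose c := (u *m u^T) 0 0; pose d := (u *m A *m u^T) 0 0.
have c0 : 0 < c.
  have /rV0Pn[i ui] : u != 0 by rewrite uE.
  rewrite /c mxE (bigD1 i)//= ltr_pwDl//.
    by rewrite mxE -expr2 exprn_even_gt0.
  by rewrite sumr_ge0// => j _; rewrite mxE -expr2 sqr_ge0.
have d0 : 0 <= d by exact: Ap.
have H t : 0 <= 2 * t * c + t ^+ 2 * d.
  have uAv : (u *m A *m v^T) 0 0 = c.
    by rewrite /c [in u^T]uE trmx_mul As mulmxA.
  have := Ap (v + t *: u).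
  rewrite linearD/= linearZ/= !mulmxDl !mulmxDr -!scalemxAl -!scalemxAr.
  have vAu : (v *m A *m u^T) 0 0 = c by rewrite -uE.
  have addE (X Y : 'M[R]_1) : (X + Y) 0 0 = X 0 0 + Y 0 0 by rewrite mxE.
  have scaleE a (X : 'M[R]_1) : (a *: X) 0 0 = a * X 0 0 by rewrite mxE.
  rewrite !addE !scaleE vAv uAv vAu -/d.
  by congr (0 <= _); ring.
have := H (- (c / (d + 1))).
have d1 : 0 < d + 1 by lra.
have : 0 < c / (d + 1) by rewrite divr_gt0.
set t := c / (d + 1) => t0.
have -> : 2 * - t * c + (- t) ^+ 2 * d = t * (t * d - 2 * c) by ring.
rewrite pmulr_rge0// => h.
have : t * (d + 1) = c by rewrite /t mulfVK// gt_eqF.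
nra.
Qed.

(** Countably many perturbations suffice, so that measurability passes from
positive definite to positive semi-definite matrices. *)
Lemma possemidefmxP n (W : 'M[R]_n) : W^T = W ->
  possemidefmx W <-> forall k : nat, posdefmx (W + k.+1%:R^-1 *: 1%:M).
Proof.
have qI (c : R) (v : 'rV[R]_n) : (v *m (c *: 1%:M) *m v^T) 0 0 = c * (v *m v^T) 0 0.
  by rewrite -scalemxAr mulmx1 -scalemxAl mxE.
have nv (v : 'rV[R]_n) : 0 <= (v *m v^T) 0 0.
  by rewrite mxE sumr_ge0// => i _; rewrite mxE -expr2 sqr_ge0.
move=> Ws; split=> [pW k|H].
  rewrite addrC; apply: posdefmxD => //; split; first by rewrite linearZ/= trmx1.
  move=> v v0; rewrite qI mulr_gt0// lt_neqAle nv andbT eq_sym.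
  have /rV0Pn[i vi] := v0.
  rewrite mxE (bigD1 i)//= gt_eqF// ltr_pwDl//.
    by rewrite mxE -expr2 exprn_even_gt0.
  by rewrite sumr_ge0// => j _; rewrite mxE -expr2 sqr_ge0.
split => // v; rewrite leNgt; apply/negP => h.
set a := (v *m W *m v^T) ord0 ord0 in h.
pose b := (v *m v^T) 0 0.
have b1 : 0 < b + 1 by rewrite ltr_wpDl ?nv.
have /ltr_add_invr[k] : 0 < - a / (b + 1) by rewrite divr_gt0 ?oppr_gt0.
rewrite add0r ltr_pdivlMr// => hk.
have [_ /(_ v)] := posdefmxW (H k).
rewrite mulmxDr mulmxDl mxE qI -/a -/b => hk'.
have : k.+1%:R^-1 * b <= k.+1%:R^-1 * (b + 1) :> R by rewrite ler_wpM2l ?invr_ge0// lerDl.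
by move=> /le_lt_trans/(_ hk); rewrite -subr_gt0 -opprD oppr_gt0 ltNge hk'.
Qed.

(** Trailing rather than leading minors, to follow the recursion that peels off
the first row and column. *)
Fixpoint trailing_minors_gt0 n : 'M[R]_n -> bool :=
  match n with
  | 0 => fun _ => true
  | m.+1 => fun A => trailing_minors_gt0 (@drsubmx R 1 m 1 m A) && (0 < \det A)
  end.

(** Turns a quantification over all vectors into finitely many polynomial
inequalities in the entries, which makes positive definiteness a measurable
condition. *)
Lemma sylvester_criterion n (A : 'M[R]_n) : A^T = A ->
  posdefmx A <-> trailing_minors_gt0 A.
Proof.
elim: n A => [|n IH] A As.
  by split => // _; split=> // v /eqP; rewrite thinmx0.
rewrite -[n.+1]/(1 + n)%N in A As *.
have Ds : (drsubmx A)^T = drsubmx A by rewrite trmx_drsub As.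
have key : posdefmx A <-> posdefmx (drsubmx A) /\ 0 < \det A.
  split=> [pA|[pD dA]].
    split; last exact: posdefmx_det_gt0.
    by move: pA; rewrite {1}(symmx_block As) => /posdefmx_schur_dr[].
  rewrite (symmx_block As); apply/posdefmx_schur_dr; split => //.
  move: dA; rewrite {1}(symmx_block As) det_schur_dr ?posdefmx_unit//.
  rewrite pmulr_lgt0; last exact: posdefmx_det_gt0.
  by rewrite det_mx11 => /posdefmx11.
rewrite key /=; split=> [[/IH-> // ->]//|/andP[t ->]].
by split => //; apply/IH.
Qed.

Definition measurable_mx d (T : measurableType d) (D : set T) m n
    (M : T -> 'M[R]_(m, n)) :=
  forall i j, measurable_fun D (fun s => M s i j).

Section measurable_mx.
Context d (T : measurableType d) (D : set T).

(** The identity [x^-1 = x (x^2)^(-1)], with a real power on the right,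
also holds at [x = 0], where both sides vanish. *)
Lemma measurable_funV (f : T -> R) :
  measurable_fun D f -> measurable_fun D (fun s => (f s)^-1).
Proof.
move=> mf.
have -> : (fun s => (f s)^-1) = (fun s => f s * ((f s) ^+ 2) `^ (-1)).
  apply/funext => s; rewrite powR_inv1 ?sqr_ge0//.
  have [->|f0] := eqVneq (f s) 0; first by rewrite mul0r invr0.
  by rewrite expr2 invfM mulrA divff// mul1r.
apply: measurable_funM => //.
apply: (measurableT_comp (@measurable_powR R (-1))).
exact: measurable_funX.
Qed.

Lemma measurable_mx_cst m n (A : 'M[R]_(m, n)) : measurable_mx D (fun=> A).
Proof. by move=> i j; exact: measurable_cst. Qed.

Lemma measurable_mulmx m n p (M : T -> 'M[R]_(m, n)) (N : T -> 'M[R]_(n, p)) :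
  measurable_mx D M -> measurable_mx D N ->
  measurable_mx D (fun s => M s *m N s).
Proof.
move=> mM mN i j; under eq_fun do rewrite mxE.
by apply: measurable_sum => k; exact: measurable_funM.
Qed.

Lemma measurable_addmx m n (M N : T -> 'M[R]_(m, n)) :
  measurable_mx D M -> measurable_mx D N ->
  measurable_mx D (fun s => M s + N s).
Proof.
by move=> mM mN i j; under eq_fun do rewrite mxE; exact: measurable_funD.
Qed.

Lemma measurable_oppmx m n (M : T -> 'M[R]_(m, n)) :
  measurable_mx D M -> measurable_mx D (fun s => - M s).
Proof.
move=> mM i j; under eq_fun do rewrite mxE; exact: measurableT_comp.
Qed.

Lemma measurable_trmx m n (M : T -> 'M[R]_(m, n)) :
  measurable_mx D M -> measurable_mx D (fun s => (M s)^T).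
Proof. by move=> mM i j; under eq_fun do rewrite mxE; exact: mM. Qed.

Lemma measurable_diag_mx n (M : T -> 'rV[R]_n) :
  measurable_mx D M -> measurable_mx D (fun s => diag_mx (M s)).
Proof.
move=> mM i j; under eq_fun do rewrite mxE.
case: (i == j); under eq_fun do rewrite ?mulr1n ?mulr0n.
  exact: mM.
exact: measurable_cst.
Qed.

Lemma measurable_mxtrace n (M : T -> 'M[R]_n) :
  measurable_mx D M -> measurable_fun D (fun s => \tr (M s)).
Proof. by move=> mM; apply: measurable_sum => i; exact: mM. Qed.

Lemma measurable_det n (M : T -> 'M[R]_n) :
  measurable_mx D M -> measurable_fun D (fun s => \det (M s)).
Proof.
move=> mM; apply: measurable_sum => u.
apply: measurable_funM; first exact: measurable_cst.
by apply: measurable_prod => i _; exact: mM.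
Qed.

Lemma measurable_invmx n (M : T -> 'M[R]_n) :
  (forall s, M s \in unitmx) -> measurable_mx D M ->
  measurable_mx D (fun s => invmx (M s)).
Proof.
move=> uM mM i j; under eq_fun do rewrite /invmx uM !mxE.
apply: measurable_funM; first exact/measurable_funV/measurable_det.
apply: measurable_funM; first exact: measurable_cst.
by apply: measurable_det => k l; under eq_fun do rewrite !mxE; exact: mM.
Qed.

Lemma measurable_trailing_minors n (M : T -> 'M[R]_n) :
  measurable_mx D M -> measurable_fun D (fun s => trailing_minors_gt0 (M s)).
Proof.
elim: n M => [|n IH] M mM /=; first exact: measurable_cst.
apply: measurable_and.
  by apply: IH => i j; under eq_fun do rewrite !mxE; exact: mM.
apply: measurable_fun_ltr; first exact: measurable_cst.
exact: measurable_det.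
Qed.

Lemma measurable_posdefmx n (M : T -> 'M[R]_n) :
  measurable D -> (forall s, (M s)^T = M s) -> measurable_mx D M ->
  measurable (D `&` [set s | posdefmx (M s)]).
Proof.
move=> mD Ms mM.
have -> : [set s | posdefmx (M s)] = (fun s => trailing_minors_gt0 (M s)) @^-1` [set true].
  by apply/seteqP; split => s /= /sylvester_criterion-/(_ (Ms s)).
exact: measurable_trailing_minors.
Qed.

Lemma measurable_possemidefmx n (M : T -> 'M[R]_n) :
  measurable D -> (forall s, (M s)^T = M s) -> measurable_mx D M ->
  measurable (D `&` [set s | possemidefmx (M s)]).
Proof.
move=> mD Ms mM.
have -> : D `&` [set s | possemidefmx (M s)] =
    \bigcap_k (D `&` [set s | posdefmx (M s + k.+1%:R^-1 *: 1%:M)]).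
  apply/seteqP; split => s /=.
    move=> [Ds pM] k _; split => //=.
    by move/(possemidefmxP (Ms s)) : pM.
  move=> H; split; first by have [] := H 0%N.
  by apply/possemidefmxP => // k; have [] := H k.
apply: bigcap_measurableType => k _; apply: measurable_posdefmx => //.
  by move=> s; rewrite linearD/= linearZ/= trmx1 Ms.
by apply: measurable_addmx => //; exact: measurable_mx_cst.
Qed.

End measurable_mx.

(** * The block structure of the Laplace transform *)
Section diag_perturbation.
Context n (S : 'M[R]_n) (t : 'rV[R]_n).
Hypotheses (pS : posdefmx S) (t0 : forall i, 0 <= t 0 i).
Let T := diag_mx t.

Lemma possemidefmx_diag : possemidefmx T.
Proof.
split; first by rewrite tr_diag_mx.
move=> v; rewrite mul_mx_diag mxE sumr_ge0// => i _; rewrite !mxE.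
by rewrite mulrAC mulr_ge0// -expr2 sqr_ge0.
Qed.

(** [1 + S T] is not symmetric, but it is [S] times a positive definite
matrix. *)
Let split1 : 1%:M + S *m T = S *m (invmx S + T).
Proof. by rewrite mulmxDr mulmxV// posdefmx_unit. Qed.

Let pST : posdefmx (invmx S + T).
Proof. exact: posdefmxD (posdefmx_inv pS) possemidefmx_diag. Qed.

Lemma det_1_addmx_gt0 : 0 < \det (1%:M + S *m T).
Proof. by rewrite split1 det_mulmx mulr_gt0// posdefmx_det_gt0. Qed.

Lemma unit_1_addmx : 1%:M + S *m T \in unitmx.
Proof. by rewrite unitmxE unitfE gt_eqF// det_1_addmx_gt0. Qed.

(** The matrix is [(1 + T S)^-1 (T + T S T) (1 + S T)^-1], a congruence of a
positive semi-definite matrix. *)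
Lemma possemidefmx_resolvent : possemidefmx (T *m invmx (1%:M + S *m T)).
Proof.
have Ts : T^T = T by rewrite tr_diag_mx.
set Q := 1%:M + S *m T.
have uQ : Q \in unitmx := unit_1_addmx.
have QT : Q^T = 1%:M + T *m S by rewrite linearD/= trmx1 trmx_mul Ts (posdefmx_sym pS).
have uQT : Q^T \in unitmx by rewrite unitmx_tr.
have -> : T *m invmx Q = invmx Q^T *m (T + T *m S *m T) *m invmx Q.
  have -> : T + T *m S *m T = Q^T *m T by rewrite QT mulmxDl mul1mx.
  by rewrite mulmxA mulVmx// mul1mx.
have -> : invmx Q = (invmx Q^T)^T by rewrite trmx_inv trmxK.
apply/possemidefmx_congr/possemidefmxD; first exact: possemidefmx_diag.
by rewrite -{2}Ts; apply/possemidefmx_congr/posdefmxW.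
Qed.

End diag_perturbation.

Section block_gamma.
Context p1 p2 (Sigma : 'M[R]_(p1 + p2)) (t : 'rV[R]_(p1 + p2)).
Hypotheses (pSigma : posdefmx Sigma) (t0 : forall i, 0 <= t 0 i).
Local Notation S12 := (ursubmx Sigma).
Local Notation S21 := (dlsubmx Sigma).
Local Notation S22 := (drsubmx Sigma).
Local Notation S0 := (schur_complement Sigma).
Local Notation T1 := (diag_mx (lsubmx t)).
Local Notation T2 := (diag_mx (rsubmx t)).

Lemma trmx_S21 : S21 = S12^T.
Proof. by rewrite trmx_ursub (posdefmx_sym pSigma). Qed.

Lemma posdefmx_schur_complement : posdefmx S22 /\ posdefmx S0.
Proof.
move: pSigma; rewrite {1}(symmx_block (posdefmx_sym pSigma)).
by move=> /posdefmx_schur_dr; rewrite /schur_complement trmx_S21.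
Qed.

(** The rate of the matrix gamma density left on the lower block once the first
[p1] variables are integrated out against [exp (- sum t_j x_j)]. *)
Definition mixing_rate : 'M[R]_p2 :=
  invmx S22 + T2 +
  invmx S22 *m S21 *m (T1 *m invmx (1%:M + S0 *m T1)) *m S12 *m invmx S22.

Let t10 i : 0 <= lsubmx t 0 i. Proof. by rewrite mxE. Qed.
Let t20 i : 0 <= rsubmx t 0 i. Proof. by rewrite mxE. Qed.

Lemma posdefmx_mixing_rate : posdefmx mixing_rate.
Proof.
have [pS22 pS0] := posdefmx_schur_complement.
apply: posdefmxD; first apply: posdefmxD.
- exact: posdefmx_inv.
- exact: possemidefmx_diag.
have -> : invmx S22 *m S21 *m (T1 *m invmx (1%:M + S0 *m T1)) *m S12 *m invmx S22 =
   invmx S22 *m S21 *m (T1 *m invmx (1%:M + S0 *m T1)) *m (invmx S22 *m S21)^T.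
  by rewrite trmx_mul trmx_S21 trmxK trmx_inv (posdefmx_sym pS22) !mulmxA.
exact/possemidefmx_congr/possemidefmx_resolvent.
Qed.

(** Subtracting [S12 S22^-1] times the lower block row turns the upper left
block into [1 + S0 T1] and the upper right one into [- S12 S22^-1]. The Schur
complement of the upper left block is then [S22] times the mixing rate. *)
Lemma det_mixing_rate :
  \det (1%:M + Sigma *m diag_mx t) =
  \det (1%:M + S0 *m T1) * (\det S22 * \det mixing_rate).
Proof.
have [pS22 pS0] := posdefmx_schur_complement.
have uS22 := posdefmx_unit pS22.
set B := S12 *m invmx S22.
have -> : 1%:M + Sigma *m diag_mx t =
    block_mx (1%:M + ulsubmx Sigma *m T1) (S12 *m T2) (S21 *m T1) (1%:M + S22 *m T2).
  rewrite -{1}[Sigma]submxK -{1}[t]hsubmxK diag_mx_row mulmx_block !mulmx0 !addr0 !add0r.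
  by rewrite scalar_mx_block add_block_mx !add0r.
have -> : \det (block_mx (1%:M + ulsubmx Sigma *m T1) (S12 *m T2) (S21 *m T1)
      (1%:M + S22 *m T2)) =
    \det (block_mx (1%:M + S0 *m T1) (- B) (S21 *m T1) (1%:M + S22 *m T2)).
  have <- : \det (block_mx 1%:M (- B) 0 1%:M *m
      block_mx (1%:M + ulsubmx Sigma *m T1) (S12 *m T2) (S21 *m T1) (1%:M + S22 *m T2)) =
      \det (block_mx (1%:M + ulsubmx Sigma *m T1) (S12 *m T2) (S21 *m T1) (1%:M + S22 *m T2)).
    by rewrite det_mulmx det_ublock !det1 !mul1r.
  rewrite mulmx_block !mul1mx !mul0mx !add0r; congr (\det (block_mx _ _ _ _)).
    by rewrite /schur_complement -/B mulmxBl -addrA mulNmx !mulmxA.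
  by rewrite mulmxDr mulmx1 !mulNmx mulmxA /B mulmxKV// addrC -addrA addNr addr0.
rewrite det_schur_ul; last exact: unit_1_addmx.
rewrite -det_mulmx; congr (_ * \det _).
rewrite /mixing_rate !mulmxDr mulmxV// !mulmxA mulmxV// mul1mx mulmxN opprK.
by rewrite /B !mulmxA.
Qed.

(** The exponent of the non-central transform is linear in [W]; cyclicity of
the trace gathers its coefficients into one matrix. *)
Lemma trace_noncentral (W : 'M[R]_p2) :
  \tr (T1 *m invmx (1%:M + S0 *m T1) *m
    (S12 *m invmx S22 *m W *m invmx S22 *m S21)) =
  \tr ((mixing_rate - (invmx S22 + T2)) *m W).
Proof.
rewrite /mixing_rate [X in X - _]addrC addrK !mulmxA.
by rewrite mxtrace_mulC !mulmxA mxtrace_mulC !mulmxA.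
Qed.

End block_gamma.

End posdef.

(** * One-dimensional gamma and Gaussian integrals *)
Section gamma1.
Context {R : realType}.
Implicit Types (a b x : R).

Local Notation mu := (@lebesgue_measure R).

Definition gamma_fun b a x : R :=
  if 0 < x then x `^ (b - 1) * expR (- (a * x)) else 0.

Lemma gamma_fun_ge0 b a x : 0 <= gamma_fun b a x.
Proof. by rewrite /gamma_fun; case: ifP => // _; rewrite mulr_ge0 ?powR_ge0 ?expR_ge0. Qed.

Lemma measurable_gamma_fun b a : measurable_fun [set: R] (gamma_fun b a).
Proof.
apply: measurable_fun_ifT => //.
  by apply: measurable_fun_ltr.
apply: measurable_funM; first exact: measurable_powR.
by apply: measurableT_comp => //; apply: measurableT_comp.
Qed.

(** Integrability at 0, by exhausting the interval by [k^-1 <= x <= 1], on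
which the primitive [x^b / b] is differentiable. *)
Lemma integral_powR_itv01 (b : R) : 0 < b ->
  (\int[mu]_(x in `]0%R, 1%R]) (x `^ (b - 1))%:E <= b^-1%:E)%E.
Proof.
move=> b0.
have -> : `]0, 1%R]%classic = \bigcup_k `[k.+2%:R^-1, 1%R]%classic :> set R.
  apply/seteqP; split => x /=; rewrite in_itv/=.
    move=> /andP[/ltr_add_invr[k]]; rewrite add0r => kx x1; exists k => //=.
    rewrite in_itv/= x1 andbT (le_trans _ (ltW kx))// lef_pV2 ?posrE//.
    by rewrite ler_nat.
  move=> [k _ /=]; rewrite in_itv/= => /andP[kx ->]; rewrite andbT.
  by rewrite (lt_le_trans _ kx).
have mf D : measurable_fun D (fun x : R => (x `^ (b - 1))%:E).
  apply/measurable_EFinP/measurable_funTS; exact: measurable_powR.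
pose I (k : nat) : set R := `[k.+2%:R^-1, 1]%classic.
rewrite -/(\bigcup_k I k).
have C : (\int[mu]_(x in I k) (x `^ (b - 1))%:E)%E @[k --> \oo] -->
   (\int[mu]_(x in \bigcup_k I k) (x `^ (b - 1))%:E)%E.
  apply: ge0_nondecreasing_set_cvg_integral; first last.
  - by move=> *; rewrite lee_fin powR_ge0.
  - by move=> k; exact: mf.
  - by move=> k; exact: measurable_itv.
  move=> m n mn; apply/subsetPset => x; rewrite /I /= !in_itv/= => /andP[mx ->].
  by rewrite andbT (le_trans _ mx)// lef_pV2 ?posrE// ler_nat ltnS.
rewrite -(cvg_lim _ C)//; apply: lime_le; first by apply/cvg_ex; eexists; exact: C.
apply: nearW => k.
have k1 : k.+2%:R^-1 < 1 :> R by rewrite invf_lt1// ltr1n.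
have pos x : x \in `[k.+2%:R^-1, 1] -> 0 < x :> R.
  by rewrite in_itv/= => /andP[h _]; exact: lt_le_trans h.
have dF (x : R) : 0 < x -> is_derive x 1 (fun x => b^-1 * x `^ b) (x `^ (b - 1)).
  move=> x0; have := is_derive1_powR b x0 => D.
  have : is_derive x 1 (b^-1 \*: (fun x => x `^ b)) (b^-1 *: (b * x `^ (b - 1))).
    exact: is_deriveZ.
  have -> : b^-1 *: (b * x `^ (b - 1)) = x `^ (b - 1).
    by change (b^-1 * (b * x `^ (b - 1)) = x `^ (b - 1)); rewrite mulrA mulVf ?gt_eqF// mul1r.
  by [].
have cF (x : R) : 0 < x -> {for x, continuous (fun x => b^-1 * x `^ b)}.
  move=> x0; apply: differentiable_continuous; apply/derivable1_diffP.
  by case: (dF _ x0).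
rewrite (@continuous_FTC2 _ _ (fun x => b^-1 * x `^ b))//.
- rewrite powR1 mulr1 -EFinB lee_fin lerBlDr lerDl mulr_ge0 ?powR_ge0// invr_ge0.
  exact: ltW.
- apply: derivable_within_continuous => x /pos x0.
  by apply: derivable_powR; rewrite in_itv/= x0.
- split.
  + by move=> x /andP[/ltW h /ltW h']; have /dF[] : 0 < x by apply: pos; rewrite in_itv/= h.
  + apply: cvg_at_right_filter; exact: cF.
  + apply: cvg_at_left_filter; exact: cF.
- move=> x; rewrite in_itv/= => /andP[/ltW h /ltW h'].
  have x0 : 0 < x by apply: pos; rewrite in_itv/= h.
  by rewrite derive1E; have [_ ->] := dF _ x0.
Qed.

(** Integrability at infinity: half of the exponential decay absorbs the power,
since [x <= 2 a exp (x / (2 a))] for [a > 0]. *)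
Lemma gamma_fun_tail b x : 1 <= x ->
  x `^ (b - 1) * expR (- x) <=
  (2 * Num.max (b - 1) 1) `^ Num.max (b - 1) 1 * expR (- (2^-1 * x)).
Proof.
move=> x1; set a := Num.max (b - 1) 1.
have a1 : 1 <= a by rewrite /a le_max lexx orbT.
have a0 : 0 < a by lra.
have x0 : 0 < x by lra.
have H1 : x `^ (b - 1) <= x `^ a by rewrite ler_powR// /a le_max lexx.
have H2 : x <= 2 * a * expR (x / (2 * a)).
  rewrite -ler_pdivrMl ?mulr_gt0// mulrC.
  by apply: le_trans (expR_ge1Dx _); rewrite lerDr.
have H3 : x `^ a <= (2 * a) `^ a * expR (2^-1 * x).
  have -> : expR (2^-1 * x) = expR (x / (2 * a)) `^ a.
    by rewrite -expRM; congr expR; field; rewrite gt_eqF.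
  have a20 : 0 <= 2 * a by lra.
  rewrite -powRM ?expR_ge0//.
  by apply: ge0_ler_powR => //; rewrite ?nnegrE ?(ltW a0) ?(ltW x0)// mulr_ge0 ?expR_ge0.
have -> : expR (- (2^-1 * x)) = expR (2^-1 * x) * expR (- x).
  by rewrite -expRD; congr expR; field.
rewrite mulrA ler_pM2r ?expR_gt0//.
exact: le_trans H1 H3.
Qed.

(** [Gamma] is a real-valued integral, which would be 0 if the
integral were infinite; finiteness makes it the true value. *)
Lemma integral_gamma_fun_lty b : 0 < b ->
  (\int[mu]_x (gamma_fun b 1 x)%:E < +oo)%E.
Proof.
move=> b0.
pose f1 x : \bar R := (((fun x => (x `^ (b - 1))%:E) \_ `]0%R, 1%R]) x)%E.
(* The leading 2 cancels the rate 1/2 in [exponential_pdf]. *)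
pose C : R := 2 * (2 * Num.max (b - 1) 1) `^ Num.max (b - 1) 1.
have C0 : 0 <= C by rewrite mulr_ge0// powR_ge0.
pose f2 x : \bar R := (C%:E * (exponential_pdf 2^-1 x)%:E)%E.
have mf1 : measurable_fun [set: R] f1.
  apply/(measurable_restrictT _ _).1 => //.
  by apply/measurable_EFinP/measurable_funTS; exact: measurable_powR.
have mf2 : measurable_fun [set: R] f2.
  by apply: measurable_funeM; apply/measurable_EFinP; exact: measurable_exponential_pdf.
have f10 x : (0 <= f1 x)%E.
  by rewrite /f1 patchE; case: ifP => // _; rewrite lee_fin powR_ge0.
have e0 x : 0 <= exponential_pdf 2^-1 x :> R by exact: exponential_pdf_ge0.
have f20 x : (0 <= f2 x)%E by rewrite /f2 mule_ge0// lee_fin.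
apply: (@le_lt_trans _ _ (\int[mu]_x (f1 x + f2 x))%E).
  apply: ge0_le_integral => //.
  - by move=> x _; rewrite lee_fin gamma_fun_ge0.
  - by apply/measurable_EFinP; exact: measurable_gamma_fun.
  - exact: emeasurable_funD.
  move=> x _; rewrite /gamma_fun; case: ifP => x0; last by rewrite adde_ge0.
  rewrite mul1r; have [x1|x1] := leP x 1.
    rewrite -[leLHS]adde0 leeD//.
    rewrite /f1 patchE mem_set/=; last by rewrite in_itv/= x0.
    by rewrite lee_fin ler_piMr ?powR_ge0// -[leRHS]expR0 ler_expR oppr_le0 ltW.
  rewrite -[leLHS]add0e leeD//.
  rewrite /f2 -EFinM lee_fin exponential_pdfE; last exact: ltW.
  apply: (le_trans (gamma_fun_tail _ (ltW x1))).
  by rewrite /C mulNr le_eqVlt; apply/orP; left; apply/eqP; field.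
rewrite ge0_integralD// lte_add_pinfty//.
  rewrite -integral_mkcond.
  by apply: (le_lt_trans (integral_powR_itv01 b0)); rewrite ltry.
rewrite ge0_integralZl//.
- by rewrite integral_exponential_pdf// mule1 ltry.
- by apply/measurable_EFinP; exact: measurable_exponential_pdf.
- by move=> x _; rewrite lee_fin.
Qed.

Lemma GammaE b : 0 < b -> (Gamma b)%:E = (\int[mu]_x (gamma_fun b 1 x)%:E)%E.
Proof.
move=> b0.
have E : (\int[mu]_x (gamma_fun b 1 x)%:E =
    \int[mu]_(x in `]0%R, +oo[) (x `^ (b - 1) * expR (- x))%:E)%E.
  rewrite [RHS]integral_mkcond; apply: eq_integral => x _.
  rewrite patchE /gamma_fun mul1r; case: ifPn => x0.
    by rewrite mem_set//= in_itv/= x0.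
  by rewrite memNset//= in_itv/= andbT; apply/negP.
rewrite /Gamma /Rintegral -E fineK//.
by rewrite ge0_fin_numE ?integral_gamma_fun_lty// integral_ge0// => x _; rewrite lee_fin gamma_fun_ge0.
Qed.

Lemma integral_gamma_fun b a : 0 < b -> 0 < a ->
  (\int[mu]_x (gamma_fun b a x)%:E = (Gamma b * a `^ (- b))%:E)%E.
Proof.
move=> b0 a0.
have a0' : 0 < a^-1 by rewrite invr_gt0.
rewrite (@ge0_integral_affine _ a^-1 0)//; last 2 first.
- by apply/measurable_EFinP; exact: measurable_gamma_fun.
- by move=> x; rewrite lee_fin gamma_fun_ge0.
have E x : gamma_fun b a (a^-1 * x + 0) = a `^ (1 - b) * gamma_fun b 1 x.
  rewrite addr0 /gamma_fun pmulr_rgt0//; case: ifP => x0; last by rewrite mulr0.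
  rewrite powRM ?ltW// mulrA mulrA mul1r mulfV ?gt_eqF// mul1r; congr (_ * _ * _).
  by rewrite -powR_inv1 ?ltW// -powRrM mulN1r opprB.
under eq_integral do rewrite E EFinM.
rewrite ge0_integralZl//; last 3 first.
- by apply/measurable_EFinP; exact: measurable_gamma_fun.
- by move=> x _; rewrite lee_fin gamma_fun_ge0.
- by rewrite lee_fin powR_ge0.
rewrite -GammaE// -!EFinM; congr EFin.
rewrite mulrA mulrC; congr (_ * _).
rewrite -powR_inv1 ?ltW// -powRD; last by rewrite (gt_eqF a0) implybT.
by congr powR; ring.
Qed.

(** The integrand is bounded below by a positive constant on [[1, 2]]. *)
Lemma Gamma_gt0 b : 0 < b -> 0 < Gamma b.
Proof.
move=> b0; rewrite -lte_fin GammaE//.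
pose c : R := 2 `^ (- `|b - 1|) * expR (- 2).
have c0 : 0 < c by rewrite mulr_gt0 ?powR_gt0 ?expR_gt0.
apply: (@lt_le_trans _ _ (\int[mu]_(x in `[1%R, 2%R]) c%:E)%E).
  rewrite integral_cst//= lebesgue_measure_itv/= lte_fin ltr1n -EFinB -EFinM lte_fin.
  by rewrite mulr_gt0//; lra.
rewrite integral_mkcond; apply: ge0_le_integral => //.
- by move=> x _; rewrite patchE; case: ifP => // _; rewrite lee_fin ltW.
- by apply/(measurable_restrictT _ _).1.
- by apply/measurable_EFinP; exact: measurable_gamma_fun.
move=> x _; rewrite patchE; case: ifPn; last by rewrite lee_fin gamma_fun_ge0.
rewrite inE/= in_itv/= => /andP[x1 x2].
have x0 : 0 < x by lra.
rewrite lee_fin /gamma_fun x0 /c mul1r ler_pM ?powR_ge0 ?expR_ge0//; last by rewrite ler_expR lerN2.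
rewrite /powR !gt_eqF// ler_expR mulNr.
have l0 : 0 <= ln x by rewrite ln_ge0.
have l2 : ln x <= ln 2 by rewrite ler_ln ?posrE.
have : - (`|b - 1| * ln x) <= (b - 1) * ln x.
  by rewrite -mulNr ler_wpM2r// lerNl ler_normr lexx orbT.
apply: le_trans; rewrite lerN2 ler_wpM2l//.
Qed.

(** Completes the square. *)
Lemma integral_gauss a u : 0 < a ->
  (\int[mu]_x (expR (- (a * x ^+ 2 + 2 * a * u * x)))%:E =
   (pi `^ 2^-1 * a `^ (- 2^-1) * expR (a * u ^+ 2))%:E)%E.
Proof.
move=> a0; have s0 : 0 < Num.sqrt a by rewrite sqrtr_gt0.
have E x : expR (- (a * x ^+ 2 + 2 * a * u * x)) =
    expR (a * u ^+ 2) * gauss_fun (Num.sqrt a * x + Num.sqrt a * u).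
  rewrite /gauss_fun -expRD; congr expR.
  by rewrite -mulrDr exprMn sqr_sqrtr ?ltW//; ring.
under eq_integral do rewrite E EFinM.
have mg : measurable_fun [set: R] (fun x => gauss_fun (Num.sqrt a * x + Num.sqrt a * u)).
  apply: measurableT_comp; first exact: measurable_gauss_fun.
  by apply: measurable_funD => //; exact: measurable_funM.
rewrite ge0_integralZl//; last 2 first.
- exact/measurable_EFinP.
- by move=> x _; rewrite lee_fin gauss_fun_ge0.
have := @integralT_gauss R.
rewrite (@ge0_integral_affine _ (Num.sqrt a) (Num.sqrt a * u))//; last 2 first.
- by apply/measurable_EFinP; exact: measurable_gauss_fun.
- by move=> x; rewrite lee_fin gauss_fun_ge0.
move=> H.
have -> : (\int[mu]_x (gauss_fun (Num.sqrt a * x + Num.sqrt a * u))%:E =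
    (Num.sqrt pi / Num.sqrt a)%:E)%E.
  set J := (X in X = _); have -> : J = ((Num.sqrt a)^-1%:E * ((Num.sqrt a)%:E * J))%E.
    by rewrite muleA -EFinM mulVf ?gt_eqF// mul1e.
  by rewrite /J H -EFinM mulrC.
rewrite -EFinM; congr EFin; rewrite mulrC; congr (_ * _ * _).
  by rewrite powR12_sqrt// pi_ge0.
by rewrite powRN powR12_sqrt// ltW.
Qed.

End gamma1.

(** * The Gaussian integral in several variables *)
Section gauss_tuple.
Context {R : realType}.

Lemma tuple_row_cons n x (s : n.-tuple R) :
  tuple_row (cons_pair (x, s)) = row_mx x%:M (tuple_row s) :> 'rV_(1 + n).
Proof.
apply/rowP => i; rewrite mxE; case: (splitP i) => j ij.
  rewrite (_ : i = lshift n j); last exact: val_inj.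
  by rewrite row_mxEl mxE !ord1 eqxx mulr1n.
rewrite (_ : i = rshift 1 j); last exact: val_inj.
rewrite row_mxEr mxE (_ : rshift 1 j = lift ord0 j); last exact: val_inj.
by rewrite /cons_pair tnthS.
Qed.

Lemma measurable_tuple_row n : measurable_mx [set: n.-tuple R] (@tuple_row R n).
Proof.
by move=> i j; under eq_fun do rewrite mxE; exact: measurable_tnth.
Qed.

Definition schur_ul q (N : 'M[R]_(1 + q)) : 'M[R]_q :=
  drsubmx N - (ursubmx N)^T *m invmx (ulsubmx N) *m ursubmx N.

Definition schur_shift q (N : 'M[R]_(1 + q)) (y : 'rV[R]_q) : R :=
  (y *m ((ursubmx N)^T *m invmx (ulsubmx N))) 0 0.

Lemma posdefmx_schur_ul1 q (N : 'M[R]_(1 + q)) : posdefmx N ->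
  0 < ulsubmx N 0 0 /\ posdefmx (schur_ul N).
Proof.
move=> pN; move: (pN); rewrite {1}(symmx_block (posdefmx_sym pN)).
by move=> /posdefmx_schur_ul[/posdefmx11].
Qed.

Lemma det_schur_ul1 q (N : 'M[R]_(1 + q)) : posdefmx N ->
  \det N = ulsubmx N 0 0 * \det (schur_ul N).
Proof.
move=> pN; have [n0 _] := posdefmx_schur_ul1 pN.
rewrite {1}(symmx_block (posdefmx_sym pN)) det_schur_ul ?det_mx11//.
by rewrite unitmxE det_mx11 unitfE gt_eqF.
Qed.

(** Completing the square in the first variable only: the bilinear form splits
into one in the shifted first coordinates and the form of the Schur complement
in the others. *)
Lemma schur_bilinear q (N : 'M[R]_(1 + q)) c w x y : posdefmx N ->
  (row_mx c%:M w *m N *m (row_mx x%:M y)^T) 0 0 =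
  ulsubmx N 0 0 * (c + schur_shift N w) * (x + schur_shift N y) +
  (w *m schur_ul N *m y^T) 0 0.
Proof.
move=> pN; have [n0 _] := posdefmx_schur_ul1 pN.
have uA : ulsubmx N \in unitmx by rewrite unitmxE det_mx11 unitfE gt_eqF.
have As : (ulsubmx N)^T = ulsubmx N by rewrite trmx_ulsub (posdefmx_sym pN).
rewrite {1}(symmx_block (posdefmx_sym pN)) block_schur_ul// !mulmxA.
set C := _ *m invmx _; set S := _ - _ *m _.
have row z (t : 'rV[R]_q) : row_mx z%:M t *m block_mx 1%:M 0 C 1%:M =
    row_mx (z + (t *m C) 0 0)%:M t.
  rewrite mul_row_block !mulmx1 mulmx0 add0r; congr row_mx.
  by rewrite raddfD/= -mx11_scalar.
rewrite row -mulmxA -trmx_mul row.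
rewrite tr_row_mx mul_row_block !mulmx0 addr0 add0r mul_row_col mxE tr_scalar_mx.
rewrite -/(schur_shift N w) -/(schur_shift N y); congr (_ + _).
by rewrite mul_mx_scalar mul_scalar_mx scalerA [LHS]mxE; ring.
Qed.

(** Integrate over the first variable, for which [schur_bilinear] provides a
one-dimensional Gaussian integral; the remaining integrand is of the same form,
with the Schur complement as its matrix. Including the linear term [u] in the
statement lets the cross terms reappear in the induction hypothesis. *)
Lemma integral_gauss_tuple q (N : 'M[R]_q) (u : 'rV[R]_q) : posdefmx N ->
  (\int[lebesgue_tuple R q]_s
     (expR (- ((tuple_row s *m N *m (tuple_row s)^T) 0 0 +
               2 * (u *m N *m (tuple_row s)^T) 0 0)))%:E =
   (pi `^ (q%:R / 2) * \det N `^ (- 2^-1) * expR ((u *m N *m u^T) 0 0))%:E)%E.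
Proof.
have mF k (N' : 'M[R]_k) (u' : 'rV[R]_k) : measurable_fun [set: k.-tuple R]
    (fun s => (expR (- ((tuple_row s *m N' *m (tuple_row s)^T) 0 0 +
               2 * (u' *m N' *m (tuple_row s)^T) 0 0)))%:E).
  apply/measurable_EFinP; apply: measurableT_comp => //.
  apply: measurableT_comp => //.
  have mr := @measurable_tuple_row k.
  have mtr := measurable_trmx mr.
  apply: measurable_funD; last apply: measurable_funM => //.
    by apply: measurable_mulmx => //; apply: measurable_mulmx => //; exact: measurable_mx_cst.
  by apply: measurable_mulmx => //; exact: measurable_mx_cst.
elim: q N u => [|q IH] N u pN.
  rewrite /= integral_dirac//; last exact: mF.
  rewrite diracE mem_set// mul1e; congr EFin.
  have z (A : 'M[R]_0) (a b : 'rV[R]_0) : (a *m A *m b^T) 0 0 = 0.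
    by rewrite mxE big_ord0.
  by rewrite !z det_mx00 powR1 mul0r powRr0 mulr0 addr0 oppr0 expR0 !mulr1.
rewrite -[q.+1]/(1 + q)%N in N u pN *.
have [n0 pS] := posdefmx_schur_ul1 pN.
set n := ulsubmx N 0 0 in n0.
rewrite ge0_integral_cons; [|exact: mF|by move=> s; rewrite lee_fin expR_ge0].
have -> : u = row_mx (u 0 0)%:M (rsubmx u).
  rewrite -[LHS]hsubmxK; congr row_mx; rewrite [LHS]mx11_scalar mxE.
  by congr (u _ _)%:M; exact: val_inj.
set c := u 0 0; set w := rsubmx u.
pose k := c + schur_shift N w.
transitivity (\int[lebesgue_tuple R q]_s ((pi `^ 2^-1 * n `^ (- 2^-1) * expR (n * k ^+ 2))%:E *
    (expR (- ((tuple_row s *m schur_ul N *m (tuple_row s)^T) 0 0 +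
               2 * (w *m schur_ul N *m (tuple_row s)^T) 0 0)))%:E))%E.
  apply: eq_integral => s _.
  set y := tuple_row s.
  pose m := schur_shift N y.
  pose e := expR (- (n * m ^+ 2 + 2 * n * k * m) -
     ((y *m schur_ul N *m y^T) 0 0 + 2 * (w *m schur_ul N *m y^T) 0 0)).
  transitivity (\int[lebesgue_measure]_x (e%:E * (expR (- (n * x ^+ 2 + 2 * n * (m + k) * x)))%:E))%E.
    apply: eq_integral => x _; rewrite tuple_row_cons !schur_bilinear// -EFinM -expRD.
    by congr (expR _)%:E; rewrite -/y -/m -/k -/n; ring.
  rewrite ge0_integralZl_cst; first last.
  - by move=> x; rewrite lee_fin expR_ge0.
  - apply/measurable_EFinP; do 2 apply: measurableT_comp => //.
    by apply: measurable_funD; apply: measurable_funM.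
  - exact: expR_ge0.
  rewrite integral_gauss// -!EFinM; congr EFin.
  rewrite mulrC -!mulrA; congr (_ * (_ * _)).
  by rewrite -!expRD; congr expR; ring.
rewrite ge0_integralZl_cst; first last.
- by move=> s; rewrite lee_fin expR_ge0.
- exact: mF.
- by rewrite !mulr_ge0 ?powR_ge0 ?expR_ge0.
rewrite IH// -EFinM; congr EFin.
rewrite schur_bilinear// -/k -/n det_schur_ul1// -/n powRM ?(ltW n0) ?ltW ?posdefmx_det_gt0//.
have -> : (q.+1%:R / 2) = 2^-1 + q%:R / 2 :> R by rewrite -natr1; field.
rewrite powRD; last by rewrite (gt_eqF (pi_gt0 R)) implybT.
have -> : n * k * k = n * k ^+ 2 by ring.
by rewrite expRD; ring.
Qed.

End gauss_tuple.

(** * Coordinates on symmetric matrices *)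
Section covmx.
Context {R : realType}.

Local Notation N n := #|{: upper_pair n}|.

Lemma corrmx_diag n (c : (N n).-tuple R) i : corrmx c i i = 1.
Proof. by rewrite mxE insubF//= ltnn. Qed.

Lemma corrmx_upper n (c : (N n).-tuple R) (u : upper_pair n) :
  corrmx c (val u).1 (val u).2 = tnth c (enum_rank u).
Proof. by rewrite mxE (_ : (_, _) = val u) ?valK//; case: (val u). Qed.

Lemma corrmx_sym n (c : (N n).-tuple R) : (corrmx c)^T = corrmx c.
Proof.
apply/matrixP => i j; rewrite !mxE.
case: insubP => [u ji _|_]; case: insubP => [v ij _|_] //.
by have := ltn_trans ij ji; rewrite /= ltnn.
Qed.

(** The diagonal comes first and the off-diagonal entries follow in the order
used by [corrmx]. Splitting the tuple then separates the variances from the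
rest. *)
Definition covmx n (w : (n + N n).-tuple R) : 'M[R]_n :=
  \matrix_(i, j) if i == j then tnth w (lshift _ i)
                 else corrmx [tuple tnth w (rshift n k) | k < N n] i j.

Lemma covmx_sym n (w : (n + N n).-tuple R) : (covmx w)^T = covmx w.
Proof.
apply/matrixP => i j; rewrite !mxE eq_sym; case: eqP => [->//|_].
by have /matrixP/(_ i j) := corrmx_sym [tuple tnth w (rshift n k) | k < N n]; rewrite !mxE.
Qed.

Lemma covmx_upper n (w : (n + N n).-tuple R) (u : upper_pair n) :
  covmx w (val u).1 (val u).2 = tnth w (rshift n (enum_rank u)).
Proof.
rewrite mxE corrmx_upper tnth_mktuple; case: eqP => // e.
by have := valP u; rewrite /= e ltnn.
Qed.

(** Keeps the partial functions in the definition of [corrmx] out of the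
measurability proofs. *)
Lemma corrmx_entry n (i j : 'I_n) :
  (exists k, forall c : (N n).-tuple R, corrmx c i j = tnth c k) \/
  (forall c : (N n).-tuple R, corrmx c i j = 1).
Proof.
have [ij|ji|/val_inj ->] := ltngtP i j; last by right=> c; exact: corrmx_diag.
  left; pose u : upper_pair n := exist (fun ij : 'I_n * 'I_n => (ij.1 < ij.2)%N) (i, j) ij.
  by exists (enum_rank u) => c; rewrite -corrmx_upper.
left; pose u : upper_pair n := exist (fun ij : 'I_n * 'I_n => (ij.1 < ij.2)%N) (j, i) ji.
by exists (enum_rank u) => c; rewrite -corrmx_upper -[in LHS]corrmx_sym [LHS]mxE.
Qed.

Lemma measurable_corrmx n : measurable_mx [set: (N n).-tuple R] (@corrmx R n).
Proof.
move=> i j; case: (corrmx_entry i j) => [[k E]|E].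
  have -> : (fun c : (N n).-tuple R => corrmx c i j) = fun c => tnth c k by exact/funext.
  exact: measurable_tnth.
have -> : (fun c : (N n).-tuple R => corrmx c i j) = fun=> 1 by exact/funext.
exact: measurable_cst.
Qed.

Lemma measurable_covmx n : measurable_mx [set: (n + N n).-tuple R] (@covmx n).
Proof.
move=> i j; have -> : (fun w : (n + N n).-tuple R => covmx w i j) = fun w =>
    if i == j then tnth w (lshift _ i)
    else corrmx [tuple tnth w (rshift n k) | k < N n] i j.
  by apply/funext => w; rewrite mxE.
case: eqP => _; first exact: measurable_tnth.
apply: (measurableT_comp (measurable_corrmx i j)).
apply/measurable_fun_tnthP => k.
rewrite (_ : _ \o _ = fun w : (n + N n).-tuple R => tnth w (rshift n k)); last first.
  by apply/funext => w; rewrite /= tnth_mktuple.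
exact: measurable_tnth.
Qed.

Definition lift_pair n (u : upper_pair n) : upper_pair n.+1 :=
  exist (fun ij : 'I_n.+1 * 'I_n.+1 => (ij.1 < ij.2)%N)
    (lift ord0 (val u).1, lift ord0 (val u).2) (valP u).

Definition top_pair n (j : 'I_n) : upper_pair n.+1 :=
  exist (fun ij : 'I_n.+1 * 'I_n.+1 => (ij.1 < ij.2)%N) (ord0, lift ord0 j) isT.

(** Where each coordinate of the lower right block (on the left of the sum) and
of the first row (on the right) sits among the coordinates of the full
matrix. *)
Definition cov_index n (k : 'I_(n + N n) + 'I_n.+1) : 'I_(n.+1 + N n.+1) :=
  match k with
  | inl k => match fintype.split k with
             | inl a => lshift _ (lift ord0 a)
             | inr u => rshift n.+1 (enum_rank (lift_pair (enum_val u)))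
             end
  | inr j => if unlift ord0 j is Some b then rshift n.+1 (enum_rank (top_pair b))
             else lshift _ ord0
  end.

Lemma lift_pair_inj n : injective (@lift_pair n).
Proof.
move=> u v /(congr1 val)/= [e1 e2]; apply: val_inj.
rewrite [LHS]surjective_pairing [RHS]surjective_pairing.
by congr (_, _); apply: val_inj; [exact: e1|exact: e2].
Qed.

Lemma lift_pair_top n u (b : 'I_n) : lift_pair u <> top_pair b.
Proof. by move=> /(congr1 val)[]. Qed.

Lemma top_pair_inj n : injective (@top_pair n).
Proof. by move=> a b /(congr1 val)/= [e]; apply: val_inj; exact: e. Qed.

Lemma cov_index_inj n : injective (@cov_index n).
Proof.
have lr (m p : nat) (i : 'I_m) (j : 'I_p) : lshift p i <> rshift m j.
  by move=> /eqP; rewrite eq_lrshift.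
move=> [k|j] [k'|j'] /=.
- case: (fintype.split_ordP k) => [a ->|u ->]; case: (fintype.split_ordP k') => [a' ->|u' ->].
  + by move=> /lshift_inj/lift_inj ->.
  + by move=> /lr.
  + by move=> /esym/lr.
  + by move=> /rshift_inj/enum_rank_inj/lift_pair_inj/enum_val_inj ->.
- case: (fintype.split_ordP k) => [a ->|u ->]; case: unliftP => [b ->|->].
  + by move=> /lr.
  + by move=> /lshift_inj.
  + by move=> /rshift_inj/enum_rank_inj/lift_pair_top.
  + by move=> /esym/lr.
- case: (fintype.split_ordP k') => [a ->|u ->]; case: unliftP => [b ->|->].
  + by move=> /esym/lr.
  + by move=> /lshift_inj.
  + by move=> /rshift_inj/enum_rank_inj/esym/lift_pair_top.
  + by move=> /lr.
- case: unliftP => [b ->|->]; case: unliftP => [b' ->|->] //.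
  by move=> /rshift_inj/enum_rank_inj/top_pair_inj ->.
Qed.

Lemma cov_index_surj n (k : 'I_(n.+1 + N n.+1)) : exists i, cov_index i = k.
Proof.
case: (fintype.split_ordP k) => [a ->|u ->].
  case: (unliftP ord0 a) => [b ->|->].
    by exists (inl (lshift _ b)); rewrite /= (unsplitK (inl b)).
  by exists (inr ord0); rewrite /= unlift_none.
rewrite -(enum_valK u); set v := enum_val u.
have := valP v; case: (unliftP ord0 (val v).2) => [b vb _|->//].
case: (unliftP ord0 (val v).1) => [a va|va].
  have ab : (a < b)%N by have := valP v; rewrite /= va vb.
  exists (inl (rshift n (enum_rank (exist (fun ij : 'I_n * 'I_n => (ij.1 < ij.2)%N) (a, b) ab)))).
  rewrite /= (unsplitK (inr _)) enum_rankK; congr (rshift _ (enum_rank _)).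
  by apply: val_inj => /=; rewrite [RHS]surjective_pairing va vb.
exists (inr (lift ord0 b)); rewrite /= liftK; congr (rshift _ (enum_rank _)).
by apply: val_inj => /=; rewrite [RHS]surjective_pairing va vb.
Qed.

(** The coordinates of a symmetric matrix are those of its lower right block
together with its first row, up to a permutation. Only the existence of the
permutation matters, since Lebesgue measure is invariant under it. *)
Lemma covmx_glue n : exists2 h : 'I_(n.+1 + N n.+1) -> 'I_(n + N n) + 'I_n.+1,
  bijective h &
  forall (w : (n + N n).-tuple R) (x : R) (s : n.-tuple R),
    covmx (glue h (w, cons_pair (x, s))) =
    block_mx x%:M (tuple_row s) (tuple_row s)^T (covmx w) :> 'M[R]_(1 + n).
Proof.
have [h hK] := choice (@cov_index_surj n).
have gK x : h (cov_index x) = x by apply: (@cov_index_inj n); rewrite hK.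
exists h; first by exists (@cov_index n).
move=> w x s; set v := cons_pair (x, s).
have tl k : tnth (glue h (w, v)) (cov_index (inl k)) = tnth w k.
  by rewrite tnth_mktuple gK.
have tr k : tnth (glue h (w, v)) (cov_index (inr k)) = tnth v k.
  by rewrite tnth_mktuple gK.
have top j : covmx (glue h (w, v)) ord0 (lift ord0 j) = tnth s j.
  have -> := covmx_upper (glue h (w, v)) (top_pair j).
  have := tr (lift ord0 j); rewrite /= liftK => ->.
  by rewrite /v/cons_pair tnthS.
have bot i j : covmx (glue h (w, v)) (lift ord0 i) (lift ord0 j) = covmx w i j.
  have lt (i' j' : 'I_n) : (i' < j')%N -> covmx (glue h (w, v)) (lift ord0 i') (lift ord0 j') = covmx w i' j'.
    move=> ij; pose u : upper_pair n := exist (fun ij : 'I_n * 'I_n => (ij.1 < ij.2)%N) (i', j') ij.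
    have -> := covmx_upper (glue h (w, v)) (lift_pair u).
    have -> := covmx_upper w u.
    by have := tl (rshift n (enum_rank u)); rewrite /= (unsplitK (inr _)) enum_rankK.
  case: (ltngtP i j) => [/lt//|ji|ij].
    by rewrite -covmx_sym -[in RHS]covmx_sym mxE [RHS]mxE; exact: lt.
  have -> : i = j by exact: val_inj.
  rewrite !mxE !eqxx; have := tl (lshift _ j).
  by rewrite /= (unsplitK (inl _)).
have diag0 : covmx (glue h (w, v)) ord0 ord0 = x.
  by rewrite mxE eqxx; have := tr ord0; rewrite /= unlift_none.
move: (covmx (glue h (w, v))) (covmx_sym (glue h (w, v))) top bot diag0 => W Ws top bot diag0.
rewrite [LHS](@symmx_block R 1 n W Ws).
have top' : ursubmx (W : 'M[R]_(1 + n)) = tuple_row s.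
  apply/rowP => j; rewrite 2!mxE [RHS]mxE -top.
  by congr (fun_of_matrix W _ _); exact: val_inj.
rewrite top'; congr block_mx.
- apply/matrixP => i j; rewrite !ord1 [RHS]mxE eqxx mulr1n 2!mxE -diag0.
  by congr (fun_of_matrix W _ _); exact: val_inj.
- apply/matrixP => i j; rewrite 2!mxE -bot.
  by congr (fun_of_matrix W _ _); exact: val_inj.
Qed.

Lemma measurable_covmx_glue d (Y : measurableType d) n
    (h : 'I_(n.+1 + N n.+1) -> 'I_(n + N n) + 'I_n.+1)
    (F : 'M[R]_(1 + n) -> Y) :
  measurable_fun [set: (n.+1 + N n.+1).-tuple R] (fun w => F (covmx w)) ->
  measurable_fun setT (fun u => F (covmx (glue h u))).
Proof.
move=> mF; apply: (@measurableT_comp _ _ _ _ _ _ (fun w => F (covmx w))) => //.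
exact: measurable_glue.
Qed.

(** Drives the inductions on the size of the matrix. *)
Lemma ge0_integral_covmx n (F : 'M[R]_(1 + n) -> \bar R) :
  measurable_fun [set: (n.+1 + N n.+1).-tuple R] (fun w => F (covmx w)) ->
  (forall W, 0 <= F W)%E ->
  (\int[lebesgue_tuple R (n.+1 + N n.+1)]_w F (covmx w) =
   \int[lebesgue_tuple R (n + N n)]_w \int[lebesgue_tuple R n]_s
     \int[lebesgue_measure]_x
       F (block_mx x%:M (tuple_row s) (tuple_row s)^T (covmx w)))%E.
Proof.
move=> mF F0; have [h bh hE] := covmx_glue n.
rewrite (@ge0_integral_glue _ _ _ _ h)//.
apply: eq_integral => w _.
rewrite (@ge0_integral_cons _ _ (fun v => F (covmx (glue h (w, v))))); last 2 first.
- exact: (measurableT_comp (measurable_covmx_glue h mF) (measurable_pair1 w)).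
- by move=> v; exact: F0.
by apply: eq_integral => s _; apply: eq_integral => x _; rewrite hE.
Qed.

End covmx.

(** * The matrix gamma integral *)
Section matrix_gamma.
Context {R : realType}.
Local Notation N n := #|{: upper_pair n}|.

(** Extended by 0 outside the positive definite cone, so that all integrals run
over the full Euclidean space of coordinates. *)
Definition wishart_kernel n (a : R) (A W : 'M[R]_n) : R :=
  if `[< posdefmx W >]
  then \det W `^ (a - (n%:R + 1) / 2) * etr (- (A *m W)) else 0.

Lemma wishart_kernel_ge0 n a (A W : 'M[R]_n) : 0 <= wishart_kernel a A W.
Proof.
by rewrite /wishart_kernel; case: ifP => // _; rewrite mulr_ge0 ?powR_ge0 ?expR_ge0.
Qed.

Lemma measurable_asbool_posdefmx d (T : measurableType d) n (M : T -> 'M[R]_n) :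
  (forall s, (M s)^T = M s) -> measurable_mx setT M ->
  measurable_fun setT (fun s => `[< posdefmx (M s) >]).
Proof.
move=> Ms mM; apply: (measurable_fun_bool true).
have -> : (fun s => `[< posdefmx (M s) >]) @^-1` [set true] = [set s | posdefmx (M s)].
  by apply/seteqP; split => s /= /asboolP.
exact: measurable_posdefmx.
Qed.

Lemma measurable_wishart_kernel d (T : measurableType d) n a A (M : T -> 'M[R]_n) :
  (forall s, (M s)^T = M s) -> measurable_mx setT M ->
  measurable_fun setT (fun s => wishart_kernel a A (M s)).
Proof.
move=> Ms mM; apply: measurable_fun_ifT => //.
- exact: measurable_asbool_posdefmx.
- apply: measurable_funM.
    apply: (measurableT_comp (@measurable_powR R (a - (n%:R + 1) / 2))).
    exact: measurable_det.
  apply: measurableT_comp => //; apply: measurable_mxtrace.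
  by apply: measurable_oppmx; apply: measurable_mulmx => //; exact: measurable_mx_cst.
Qed.

Lemma multigammaS n a : multigamma n.+1 a =
  pi `^ (n%:R / 2) * Gamma (a - n%:R / 2) * multigamma n a :> R.
Proof.
rewrite /multigamma big_ord_recr/=.
have -> : n.+1%:R * (n.+1%:R - 1) / 4 = n%:R / 2 + n%:R * (n%:R - 1) / 4 :> R.
  by rewrite -natr1; field.
rewrite powRD; last by rewrite (gt_eqF (pi_gt0 R)) implybT.
by ring.
Qed.

Lemma multigamma_gt0 n a : n%:R - 1 < 2 * a -> 0 < multigamma n a :> R.
Proof.
move=> na; rewrite mulr_gt0 ?powR_gt0 ?pi_gt0//.
apply: prodr_gt0 => j _; apply: Gamma_gt0.
have : j%:R <= n%:R - 1 :> R by rewrite lerBrDr natr1 ler_nat.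
by lra.
Qed.

Lemma card_upper_pair0 : N 0 = 0%N.
Proof. by apply: eq_card0 => -[[[]]]. Qed.

Lemma integral_cst_tuple0 n (c : R) : 0 <= c -> n = 0%N ->
  (\int[lebesgue_tuple R n]_s c%:E = c%:E)%E.
Proof. by move=> c0 -> /=; rewrite integral_dirac// diracE mem_set// mul1e. Qed.

(** With [W] fixed, positive definiteness of the bordered matrix is a lower
bound on its corner, which becomes the half-line of a gamma integral. *)
Lemma posdefmx_block1 n x (y : 'rV[R]_n) (W : 'M[R]_n) : posdefmx W ->
  posdefmx (block_mx x%:M y y^T W) <-> 0 < x - (y *m invmx W *m y^T) 0 0.
Proof.
move=> pW; rewrite posdefmx_schur_dr posdefmx11.
have -> : (x%:M - y *m invmx W *m y^T) 0 0 = x - (y *m invmx W *m y^T) 0 0.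
  by rewrite mxE [X in X + _]mxE eqxx mulr1n [X in _ + X]mxE.
by split=> [[]//|].
Qed.

Lemma det_block1 n x (y : 'rV[R]_n) (W : 'M[R]_n) : W^T = W -> W \in unitmx ->
  \det (block_mx x%:M y y^T W) = (x - (y *m invmx W *m y^T) 0 0) * \det W.
Proof.
move=> Ws uW; rewrite det_schur_dr// det_mx11; congr (_ * _).
by rewrite mxE [X in X + _]mxE eqxx mulr1n [X in _ + X]mxE.
Qed.

Lemma trace_block1 n x (y : 'rV[R]_n) (W : 'M[R]_n) (A : 'M[R]_(1 + n)) : A^T = A ->
  \tr (A *m block_mx x%:M y y^T W) =
  ulsubmx A 0 0 * x + 2 * (ursubmx A *m y^T) 0 0 + \tr (drsubmx A *m W).
Proof.
move=> As; rewrite {1}(symmx_block As) mulmx_block mxtrace_block !mxtraceD.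
have tr1 (M : 'M[R]_1) : \tr M = M 0 0 by rewrite /mxtrace big_ord1.
have -> : \tr ((ursubmx A)^T *m y) = (ursubmx A *m y^T) 0 0.
  by rewrite mxtrace_mulC tr1 -[y in LHS]trmxK -trmx_mul mxE.
have -> : \tr (ulsubmx A *m x%:M) = ulsubmx A 0 0 * x.
  by rewrite tr1 mul_mx_scalar [LHS]mxE mulrC.
by rewrite !tr1; ring.
Qed.

(** With [z] the quadratic form of [W^-1] at the first row [s], the kernel is
proportional to a gamma density in [x - z] times [exp (- (e z + 2 f))], with
[e] the corner of [A] and [f] linear in [s]. Integrating over [x] leaves a
Gaussian in [s] with matrix [e W^-1], whose linear term supplies the correction
that turns the lower right block of [A] into its Schur complement. *)
Lemma integral_wishart_peel n (a : R) (A : 'M[R]_(1 + n)) (W : 'M[R]_n) :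
  n%:R < 2 * a -> posdefmx A ->
  (\int[lebesgue_tuple R n]_s \int[lebesgue_measure]_x
     (wishart_kernel a A (block_mx x%:M (tuple_row s) (tuple_row s)^T W))%:E =
   (pi `^ (n%:R / 2) * Gamma (a - n%:R / 2) * ulsubmx A 0 0 `^ (- a) *
    wishart_kernel a (schur_ul A) W)%:E)%E.
Proof.
move=> na pA; have [a0 pS] := posdefmx_schur_ul1 pA.
have As := posdefmx_sym pA.
pose e : R := ulsubmx A 0 0; rewrite -/e in a0 *.
pose b : R := a - n%:R / 2.
have b0 : 0 < b by rewrite /b; lra.
rewrite [wishart_kernel a (schur_ul A) W]/wishart_kernel.
case: ifPn => [/asboolP pW|/asboolP pW]; last first.
  rewrite mulr0; apply: integral0_eq => s _; apply: integral0_eq => x _.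
  by rewrite /wishart_kernel asboolF// => /posdefmx_schur_dr[].
have Ws := posdefmx_sym pW; have uW := posdefmx_unit pW.
have D0 := posdefmx_det_gt0 pW.
pose f (s : n.-tuple R) : R := (ursubmx A *m (tuple_row s)^T) 0 0.
pose z (s : n.-tuple R) : R := (tuple_row s *m invmx W *m (tuple_row s)^T) 0 0.
pose K (s : n.-tuple R) : R := \det W `^ (b - 1) * expR (- (e * z s + 2 * f s + \tr (drsubmx A *m W))).
have kE s x : wishart_kernel a A (block_mx x%:M (tuple_row s) (tuple_row s)^T W) =
    K s * gamma_fun b e (1 * x + - z s).
  rewrite /wishart_kernel /gamma_fun mul1r.
  case: ifPn => [/asboolP/(posdefmx_block1 _ _ pW)|/asboolP/(posdefmx_block1 _ _ pW)/negP] xz.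
    rewrite xz det_block1// -/(z s) powRM ?(ltW xz) ?(ltW D0)//.
    have -> : a - ((1 + n)%:R + 1) / 2 = b - 1 by rewrite /b natrD; field.
    rewrite /etr raddfN/= trace_block1// -/e -/(f s) /K.
    have -> : expR (- (e * x + 2 * f s + \tr (drsubmx A *m W))) =
        expR (- (e * z s + 2 * f s + \tr (drsubmx A *m W))) * expR (- (e * (x - z s))).
      by rewrite -expRD; congr expR; ring.
    by ring.
  by rewrite (negbTE xz) mulr0.
have K0 s : 0 <= K s by rewrite mulr_ge0 ?powR_ge0 ?expR_ge0.
transitivity (\int[lebesgue_tuple R n]_s (K s * (Gamma b * e `^ (- b)))%:E)%E.
  apply: eq_integral => s _.
  under eq_integral do rewrite kE EFinM.
  rewrite ge0_integralZl_cst//; last 2 first.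
  - apply/measurable_EFinP; apply: measurableT_comp; first exact: measurable_gamma_fun.
    by apply: measurable_funD => //; exact: measurable_funM.
  - by move=> x; rewrite lee_fin gamma_fun_ge0.
  have := integral_gamma_fun b0 a0.
  rewrite (@ge0_integral_affine _ 1 (- z s))// ?mul1e; last 2 first.
  - by apply/measurable_EFinP; exact: measurable_gamma_fun.
  - by move=> x; rewrite lee_fin gamma_fun_ge0.
  by rewrite EFinM => ->.
pose M := e *: invmx W.
(* The vector solving [u M = ursubmx A], so that [f] is the form of [M]
   between [u] and the variable. *)
pose u := e^-1 *: (ursubmx A *m W).
have pM : posdefmx M.
  split; first by rewrite linearZ/= trmx_inv Ws.
  move=> v v0; rewrite -scalemxAr -scalemxAl mxE mulr_gt0//.
  by have [_] := posdefmx_inv pW; apply.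
have uM : u *m M = ursubmx A.
  by rewrite /u /M -scalemxAr -scalemxAl scalerA divff ?gt_eqF// scale1r mulmxK.
have vM v : (v *m M *m v^T) 0 0 = e * (v *m invmx W *m v^T) 0 0.
  by rewrite -scalemxAr -scalemxAl mxE.
pose C := \det W `^ (b - 1) * (Gamma b * e `^ (- b)) * expR (- \tr (drsubmx A *m W)).
have C0 : 0 <= C by rewrite !mulr_ge0 ?powR_ge0 ?expR_ge0// ltW// Gamma_gt0.
transitivity (\int[lebesgue_tuple R n]_s (C%:E * (expR (- ((tuple_row s *m M *m (tuple_row s)^T) 0 0 +
               2 * (u *m M *m (tuple_row s)^T) 0 0)))%:E))%E.
  apply: eq_integral => s _; rewrite -EFinM; congr EFin.
  rewrite uM -/(f s) vM -/(z s) /K /C.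
  have -> : expR (- (e * z s + 2 * f s + \tr (drsubmx A *m W))) =
      expR (- \tr (drsubmx A *m W)) * expR (- (e * z s + 2 * f s)).
    by rewrite -expRD; congr expR; ring.
  by ring.
rewrite ge0_integralZl_cst; [|exact: C0| |by move=> s; rewrite lee_fin expR_ge0]; last first.
  apply/measurable_EFinP; apply: measurableT_comp => //; apply: measurableT_comp => //.
  have mr := @measurable_tuple_row R n; have mtr := measurable_trmx mr.
  apply: measurable_funD; last apply: measurable_funM => //.
    by apply: measurable_mulmx => //; apply: measurable_mulmx => //; exact: measurable_mx_cst.
  by apply: measurable_mulmx => //; exact: measurable_mx_cst.
rewrite integral_gauss_tuple// -EFinM; congr EFin.
have -> : \det M = e ^+ n * (\det W)^-1 by rewrite detZ det_inv.
have -> : (u *m M *m u^T) 0 0 = \tr (drsubmx A *m W) - \tr (schur_ul A *m W).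
  rewrite uM /u linearZ/= -scalemxAr mxE trmx_mul Ws.
  have -> : schur_ul A = drsubmx A - e^-1 *: ((ursubmx A)^T *m ursubmx A).
    rewrite /schur_ul; congr (_ - _); rewrite -mulmxA.
    have -> : invmx (ulsubmx A) = (e^-1)%:M.
      by rewrite [ulsubmx A]mx11_scalar -/e invmx_scalar.
    by rewrite mul_scalar_mx scalemxAr.
  rewrite mulmxBl raddfB/= opprB addrC subrK -scalemxAl mxtraceZ; congr (_ * _).
  by rewrite -mulmxA mxtrace_mulC -mulmxA /mxtrace big_ord1.
have eW : e ^+ n * (\det W)^-1 = e `^ n%:R * \det W `^ (-1).
  by rewrite powR_mulrn ?(ltW a0)// powR_inv1// ltW.
rewrite eW powRM ?powR_ge0// -!powRrM.
rewrite /C expRD.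
have EE x y : expR (- x) * (expR x * expR y) = expR y.
  by rewrite mulrA -expRD addNr expR0 mul1r.
transitivity ((pi `^ (n%:R / 2) * Gamma b) *
  (e `^ (- b) * e `^ (n%:R * - 2^-1)) * (\det W `^ (b - 1) * \det W `^ (-1 * - 2^-1)) *
  (expR (- \tr (drsubmx A *m W)) * (expR (\tr (drsubmx A *m W)) * expR (- \tr (schur_ul A *m W))))).
  by ring.
rewrite EE -!powRD; last 2 first.
- by rewrite (gt_eqF D0) implybT.
- by rewrite (gt_eqF a0) implybT.
rewrite -mulrA; congr (_ * _ `^ _ * (_ `^ _ * _)).
- by rewrite /b; field.
- by rewrite /b; field.
by rewrite /etr raddfN.
Qed.

(** Each peeling step contributes one gamma factor and one pivot of [A]; the
pivots multiply to the determinant. *)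
Lemma integral_wishart n (a : R) (A : 'M[R]_n) : n%:R - 1 < 2 * a -> posdefmx A ->
  (\int[lebesgue_tuple R (n + N n)]_w (wishart_kernel a A (covmx w))%:E =
   (multigamma n a * \det A `^ (- a))%:E)%E.
Proof.
elim: n A => [|n IH] A na pA.
  transitivity (\int[lebesgue_tuple R (0 + N 0)]_w 1%:E)%E.
    apply: eq_integral => w _; congr EFin.
    rewrite /wishart_kernel asboolT; last by split=> [|v]; [apply/matrixP => -[]|rewrite (thinmx0 v) eqxx].
    by rewrite det_mx00 powR1 mul1r /etr /mxtrace big_ord0 expR0.
  rewrite integral_cst_tuple0//; last by rewrite card_upper_pair0.
  by rewrite det_mx00 powR1 mulr1 /multigamma big_ord0 mulr1 !mul0r powRr0.
have pS := (posdefmx_schur_ul1 (pA : posdefmx (A : 'M[R]_(1 + n)))).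
have na' : n%:R < 2 * a by move: na; rewrite -natr1 addrK.
rewrite (@ge0_integral_covmx _ _ (fun W => (wishart_kernel a A W)%:E)); last 2 first.
- apply/measurable_EFinP/measurable_wishart_kernel; first exact: covmx_sym.
  exact: measurable_covmx.
- by move=> W; rewrite lee_fin wishart_kernel_ge0.
under eq_integral do rewrite integral_wishart_peel//.
pose c : R := pi `^ (n%:R / 2) * Gamma (a - n%:R / 2) * ulsubmx (A : 'M[R]_(1 + n)) 0 0 `^ (- a).
have c0 : 0 <= c by rewrite !mulr_ge0 ?powR_ge0// ltW// Gamma_gt0//; lra.
under eq_integral do rewrite -/c EFinM.
rewrite ge0_integralZl_cst//; last 2 first.
- apply/measurable_EFinP/measurable_wishart_kernel; first exact: covmx_sym.
  exact: measurable_covmx.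
- by move=> W; rewrite lee_fin wishart_kernel_ge0.
rewrite IH//; [|by lra|by case: pS].
rewrite -EFinM; congr EFin; rewrite multigammaS.
rewrite (@det_schur_ul1 _ _ (A : 'M[R]_(1 + n)))// powRM; [|by case: pS => /ltW|by case: pS => _ /posdefmx_det_gt0/ltW].
by rewrite /c; ring.
Qed.

End matrix_gamma.

(** * From covariance to correlation matrices *)
Section corr_link.
Context {R : realType}.
Local Notation N n := #|{: upper_pair n}|.

Lemma measurable_det_covmx_eq0 n :
  measurable_fun [set: (n + N n).-tuple R] (fun w => (\det (covmx w) == 0)).
Proof.
apply: measurable_fun_eqr; last exact: measurable_cst.
by apply: measurable_det; exact: measurable_covmx.
Qed.

(** For a non-singular lower right block and a given first row, the determinant
is affine in the corner entry with non-zero slope, hence vanishes at a single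
point. *)
Lemma negligible_singular_covmx n :
  {ae lebesgue_tuple R (n + N n), forall w, \det (covmx w) != 0}.
Proof.
elim: n => [|n IH]; first by apply: aeW => w; rewrite det_mx00 oner_eq0.
pose F (W : 'M[R]_(1 + n)) : \bar R := (if \det W == 0 then 1 else 0)%:E.
have F0 W : (0 <= F W)%E by rewrite /F lee_fin; case: ifP.
have mF : measurable_fun [set: (n.+1 + N n.+1).-tuple R] (fun w => F (covmx w)).
  apply/measurable_EFinP; apply: measurable_fun_ifT => //.
  exact: measurable_det_covmx_eq0.
have [h bh hE] := @covmx_glue R n.
suff I0 : (\int[lebesgue_tuple R (n.+1 + N n.+1)]_w F (covmx w) = 0)%E.
  have : ae_eq (lebesgue_tuple R (n.+1 + N n.+1)) setT (fun w => F (covmx w)) (cst 0%E).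
    apply/ae_eq_integral_abs => //.
    by rewrite -[RHS]I0; apply: eq_integral => w _; rewrite gee0_abs.
  apply: filterS => w /(_ I); rewrite /F; case: eqP => // _ /eqP.
  by rewrite eqe oner_eq0.
rewrite (@ge0_integral_glue _ _ _ _ h)//.
transitivity (\int[lebesgue_tuple R (n + N n)]_w cst 0%E w)%E; last by rewrite integral_cst// mul0e.
apply: ae_eq_integral => //.
  apply: (@measurable_fun_fubini_tonelli_F _ _ _ _ _ _ (fun u => F (covmx (glue h u)))) => //.
  exact: (measurable_covmx_glue h mF).
apply: filterS IH => w dw _ /=.
rewrite (@ge0_integral_cons _ _ (fun v => F (covmx (glue h (w, v))))); last 2 first.
- exact: (measurableT_comp (measurable_covmx_glue h mF) (measurable_pair1 w)).
- by move=> v; exact: F0.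
apply: integral0_eq => s _.
have uW : covmx w \in unitmx by rewrite unitmxE unitfE.
pose z := (tuple_row s *m invmx (covmx w) *m (tuple_row s)^T) 0 0.
transitivity (\int[lebesgue_measure]_x (\1_[set z] x)%:E)%E.
  apply: eq_integral => x _; rewrite hE /F det_block1 ?covmx_sym// -/z.
  rewrite mulf_eq0 (negbTE dw) orbF subr_eq0 indicE.
  by case: eqP => xz; [rewrite mem_set|rewrite memNset].
rewrite integral_indic//= setIT; exact: lebesgue_measure_set1.
Qed.

(** The positive diagonal is what allows division by the square roots of the
variances; semi-definiteness is what [correlation_matrix] asks for. Compared
with the positive definite cone only singular matrices are added. *)
Definition cov_domain n (W : 'M[R]_n) := possemidefmx W /\ forall i, 0 < W i i.

Definition psd_wishart_kernel n (a : R) (A W : 'M[R]_n) : R :=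
  if `[< cov_domain W >]
  then \det W `^ (a - (n%:R + 1) / 2) * etr (- (A *m W)) else 0.

Lemma posdefmx_diag_gt0 n (W : 'M[R]_n) i : posdefmx W -> 0 < W i i.
Proof.
move=> [_ /(_ (delta_mx 0 i))].
rewrite -rowE trmx_delta -colE !mxE; apply.
by apply/eqP => /matrixP/(_ 0 i)/eqP; rewrite !mxE !eqxx oner_eq0.
Qed.

Lemma psd_wishart_kernelE n a (A W : 'M[R]_n) : \det W != 0 ->
  psd_wishart_kernel a A W = wishart_kernel a A W.
Proof.
move=> dW; rewrite /psd_wishart_kernel /wishart_kernel.
suff -> : `[< cov_domain W >] = `[< posdefmx W >] by [].
apply: asbool_equiv_eq; split=> [[pW _]|pW]; first exact: possemidefmx_posdefmx.
by split=> [|i]; [exact: posdefmxW|exact: posdefmx_diag_gt0].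
Qed.

Lemma psd_wishart_kernel_ge0 n a (A W : 'M[R]_n) : 0 <= psd_wishart_kernel a A W.
Proof.
by rewrite /psd_wishart_kernel; case: ifP => // _; rewrite mulr_ge0 ?powR_ge0 ?expR_ge0.
Qed.

Lemma measurable_psd_wishart_kernel n a (A : 'M[R]_n) :
  measurable_fun [set: (n + N n).-tuple R] (fun w => psd_wishart_kernel a A (covmx w)).
Proof.
have mM := @measurable_covmx R n.
apply: measurable_fun_ifT => //.
- apply: (measurable_fun_bool true); rewrite setTI.
  have -> : (fun w => `[< cov_domain (covmx w) >]) @^-1` [set true] =
      (setT `&` [set w | possemidefmx (covmx w)]) `&`
      \bigcap_(i in [set: 'I_n]) ((fun w => covmx w i i) @^-1` `]0, +oo[%classic).
    apply/seteqP; split => w /=.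
      move=> /asboolP[pw dw]; split => // i _ /=; by rewrite in_itv/= dw.
    move=> [[_ pw] dw]; apply/asboolP; split => // i.
    by have := dw i I; rewrite /= in_itv/= andbT.
  apply: measurableI; first by apply: measurable_possemidefmx => //; exact: covmx_sym.
  apply: (@fin_bigcap_measurable _ _ _ setT) => [|i _]; first exact: finite_finset.
  by rewrite -[X in measurable X]setTI; exact: mM.
- apply: measurable_funM.
    apply: (measurableT_comp (@measurable_powR R (a - (n%:R + 1) / 2))).
    exact: measurable_det.
  apply: measurableT_comp => //; apply: measurable_mxtrace.
  by apply: measurable_oppmx; apply: measurable_mulmx => //; exact: measurable_mx_cst.
Qed.

Lemma integral_psd_wishart_kernel n (a : R) (A : 'M[R]_n) : n%:R - 1 < 2 * a -> posdefmx A ->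
  (\int[lebesgue_tuple R (n + N n)]_w (psd_wishart_kernel a A (covmx w))%:E =
   (multigamma n a * \det A `^ (- a))%:E)%E.
Proof.
move=> na pA; rewrite -integral_wishart//.
apply: ae_eq_integral => //.
- by apply/measurable_EFinP; exact: measurable_psd_wishart_kernel.
- apply/measurable_EFinP/measurable_wishart_kernel; first exact: covmx_sym.
  exact: measurable_covmx.
by apply: filterS (@negligible_singular_covmx n) => w dw _ /=; rewrite psd_wishart_kernelE.
Qed.

(** Each index belongs to [n - 1] pairs. *)
Lemma prod_upper_pair n (y : 'I_n -> R) :
  \prod_(u : upper_pair n) (y (val u).1 * y (val u).2) = \prod_i y i ^+ n.-1.
Proof.
transitivity (\prod_(p : 'I_n * 'I_n | (p.1 < p.2)%N) (y p.1 * y p.2)).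
  rewrite [RHS](@reindex_omap _ _ _ _ _ (val : upper_pair n -> _) insub)/=.
    by apply: eq_bigl => u; rewrite (valP u) valK eqxx.
  by move=> p lp; rewrite insubT.
rewrite big_split/=.
have -> : \prod_(p : 'I_n * 'I_n | (p.1 < p.2)%N) y p.2 =
          \prod_(p : 'I_n * 'I_n | (p.2 < p.1)%N) y p.1.
  rewrite [LHS](reindex (fun p : 'I_n * 'I_n => (p.2, p.1))) //.
  by exists (fun p : 'I_n * 'I_n => (p.2, p.1)) => -[].
transitivity (\prod_(p : 'I_n * 'I_n | p.1 != p.2) y p.1).
  rewrite [RHS](bigID (fun p : 'I_n * 'I_n => (p.1 < p.2)%N))/=; congr (_ * _); apply: eq_bigl => -[i j]/=.
    by rewrite -(inj_eq val_inj)/= neq_ltn; case: ltngtP.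
  by rewrite -(inj_eq val_inj)/= neq_ltn; case: ltngtP.
rewrite -(pair_big_dep xpredT (fun i j => i != j) (fun i _ => y i))/=.
apply: eq_bigr => i _; rewrite prodr_const; congr (_ ^+ _).
have := cardC1 i; rewrite card_ord => <-.
by apply: eq_card => j; rewrite !inE eq_sym.
Qed.

Definition corr_scale n (s : n.-tuple R) (k : 'I_(N n)) : R :=
  let u := val (enum_val k) in Num.sqrt (tnth s u.1) * Num.sqrt (tnth s u.2).

Definition sqrt_diag n (s : n.-tuple R) : 'M[R]_n :=
  diag_mx (map_mx Num.sqrt (tuple_row s)).

Lemma sqrt_diagE n (s : n.-tuple R) (C : 'M[R]_n) i j :
  (sqrt_diag s *m C *m sqrt_diag s) i j =
  Num.sqrt (tnth s i) * Num.sqrt (tnth s j) * C i j.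
Proof. by rewrite mul_diag_mx mul_mx_diag !mxE; ring. Qed.

Lemma covmx_glue_split n (s : n.-tuple R) (c : (N n).-tuple R) i j :
  covmx (glue (@fintype.split n (N n)) (s, c)) i j =
  if i == j then tnth s i else corrmx c i j.
Proof.
rewrite mxE; case: eqP => _.
  by rewrite tnth_mktuple (unsplitK (inl _)).
congr (corrmx _ i j); apply: eq_from_tnth => k.
by rewrite tnth_mktuple tnth_mktuple (unsplitK (inr _)).
Qed.

Lemma covmx_scale n (s : n.-tuple R) (c : (N n).-tuple R) :
  (forall i, 0 < tnth s i) ->
  covmx (glue (@fintype.split n (N n)) (s, [tuple corr_scale s k * tnth c k | k < N n])) =
  sqrt_diag s *m corrmx c *m sqrt_diag s.
Proof.
move=> s0.
set c' := [tuple _ | _ < _].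
have lt (i j : 'I_n) : (i < j)%N -> corrmx c' i j = Num.sqrt (tnth s i) * Num.sqrt (tnth s j) * corrmx c i j.
  move=> ij; pose u : upper_pair n := exist (fun ij : 'I_n * 'I_n => (ij.1 < ij.2)%N) (i, j) ij.
  have -> := corrmx_upper c' u; have -> := corrmx_upper c u.
  by rewrite tnth_mktuple /corr_scale enum_rankK.
apply/matrixP => i j; rewrite covmx_glue_split sqrt_diagE.
case: eqP => [->|/eqP ij]; first by rewrite corrmx_diag mulr1 -expr2 sqr_sqrtr ?ltW.
move: ij; rewrite -(inj_eq val_inj)/= neq_ltn => /orP[/lt//|/lt ji].
by rewrite -corrmx_sym mxE ji -[corrmx c i j]/(corrmx c i j) -[in RHS]corrmx_sym [in RHS]mxE; ring.
Qed.

Lemma possemidefmx_det_ge0 n (A : 'M[R]_n) : possemidefmx A -> 0 <= \det A.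
Proof.
move=> pA; have [->//|dA] := eqVneq (\det A) 0.
exact/ltW/posdefmx_det_gt0/possemidefmx_posdefmx.
Qed.

(** The Jacobian of the substitution [w_ij = sqrt (s_i s_j) c_ij]. *)
Lemma prod_corr_scale n (s : n.-tuple R) : (0 < n)%N -> (forall i, 0 < tnth s i) ->
  \prod_k corr_scale s k = (\prod_i tnth s i) `^ ((n%:R - 1) / 2).
Proof.
move=> n0 s0.
have -> : \prod_k corr_scale s k = \prod_(u : upper_pair n)
    (Num.sqrt (tnth s (val u).1) * Num.sqrt (tnth s (val u).2)).
  rewrite (reindex (@enum_val _ {: upper_pair n}))//.
  by exists enum_rank => u _; rewrite ?enum_valK ?enum_rankK.
rewrite (prod_upper_pair (fun i => Num.sqrt (tnth s i))).
have sq : \prod_i Num.sqrt (tnth s i) = (\prod_i tnth s i) `^ 2^-1.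
  have P0 : 0 <= \prod_i Num.sqrt (tnth s i) by apply: prodr_ge0 => i _; exact: sqrtr_ge0.
  have P1 : 0 <= \prod_i tnth s i by apply: prodr_ge0 => i _; exact: ltW.
  rewrite powR12_sqrt// -[LHS]ger0_norm// -sqrtr_sqr -prodrXl; congr Num.sqrt.
  by apply: eq_bigr => i _; rewrite sqr_sqrtr// ltW.
rewrite prodrXl sq -powR_mulrn ?powR_ge0// -powRrM; congr (_ `^ _).
by rewrite -[in RHS](prednK n0) -natr1; field.
Qed.

Lemma cov_domain_scale n (s : n.-tuple R) (c : (N n).-tuple R) :
  (forall i, 0 < tnth s i) ->
  cov_domain (sqrt_diag s *m corrmx c *m sqrt_diag s) <-> correlation_matrix (corrmx c).
Proof.
move=> s0; have tq : (sqrt_diag s)^T = sqrt_diag s by rewrite tr_diag_mx.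
have uq : sqrt_diag s \in unitmx.
  rewrite unitmxE det_diag unitfE gt_eqF// prodr_gt0// => i _.
  by rewrite !mxE sqrtr_gt0.
split=> [[p _]|[p _]]; last first.
  split; first by rewrite -{2}tq; exact: possemidefmx_congr.
  by move=> i; rewrite sqrt_diagE corrmx_diag mulr1 mulr_gt0 ?sqrtr_gt0.
split; last by move=> i; exact: corrmx_diag.
have tq' : (invmx (sqrt_diag s))^T = invmx (sqrt_diag s) by rewrite trmx_inv tq.
have := possemidefmx_congr (invmx (sqrt_diag s)) p.
by rewrite tq' -!mulmxA mulmxV// mulmx1 mulmxA mulVmx// mul1mx.
Qed.

(** The Jacobian [|X|^((n - 1) / 2)] accounts for the change of the exponent of
[|X|] from [a - (n + 1) / 2] to [a - 1]. *)
Lemma integral_corr n (a : R) (A : 'M[R]_n) (s : n.-tuple R) :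
  (0 < n)%N -> (forall i, 0 < tnth s i) ->
  (\int[lebesgue_tuple R (N n)]_(c in [set c | correlation_matrix (corrmx c)])
     (\det (diag_mx (tuple_row s)) `^ (a - 1) *
      \det (corrmx c) `^ (a - (n%:R + 1) / 2) *
      etr (- (A *m (sqrt_diag s *m corrmx c *m sqrt_diag s))))%:E =
   \int[lebesgue_tuple R (N n)]_c
     (psd_wishart_kernel a A (covmx (glue (@fintype.split n (N n)) (s, c))))%:E)%E.
Proof.
move=> n0 s0.
have k0 i : 0 < corr_scale s i by rewrite mulr_gt0 ?sqrtr_gt0.
have mk : measurable_fun setT (fun u => (psd_wishart_kernel a A (covmx (glue (@fintype.split n (N n)) u)))%:E).
  apply/measurable_EFinP.
  apply: (@measurableT_comp _ _ _ _ _ _ (fun w => psd_wishart_kernel a A (covmx w))).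
    exact: measurable_psd_wishart_kernel.
  exact: measurable_glue.
have mks : measurable_fun setT (fun c => (psd_wishart_kernel a A (covmx (glue (@fintype.split n (N n)) (s, c))))%:E).
  exact: (measurableT_comp mk (measurable_pair1 s)).
rewrite (@ge0_integral_tuple_scale _ _ (corr_scale s) (fun c => (psd_wishart_kernel a A (covmx (glue (@fintype.split n (N n)) (s, c))))%:E))//; last first.
  by move=> c; rewrite lee_fin psd_wishart_kernel_ge0.
rewrite -ge0_integralZl_cst; first last.
- by move=> c; rewrite lee_fin psd_wishart_kernel_ge0.
- apply: (measurableT_comp mks).
  apply/measurable_fun_tnthP => i /=.
  rewrite (_ : _ \o _ = fun c : (N n).-tuple R => corr_scale s i * tnth c i); last first.
    by apply/funext => c; rewrite /= tnth_mktuple.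
  by apply: measurable_funM => //; exact: measurable_tnth.
- by apply: prodr_ge0 => i _; exact: ltW.
rewrite [LHS]integral_mkcond; apply: eq_integral => c _.
rewrite patchE covmx_scale// -EFinM /psd_wishart_kernel.
have [cc|nc] := pselect (correlation_matrix (corrmx c)); last first.
  by rewrite memNset// asboolF ?mulr0//; move/(cov_domain_scale c s0).
rewrite mem_set//= asboolT; last exact/cov_domain_scale.
congr EFin; rewrite prod_corr_scale// mulrA; congr (_ * _).
rewrite !det_mulmx /sqrt_diag !det_diag.
have -> : \prod_i map_mx Num.sqrt (tuple_row s) 0 i * \det (corrmx c) *
    \prod_i map_mx Num.sqrt (tuple_row s) 0 i = \prod_i tnth s i * \det (corrmx c).
  rewrite mulrAC -big_split/=; congr (_ * _); apply: eq_bigr => i _.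
  by rewrite !mxE -expr2 sqr_sqrtr// ltW.
have P0 : 0 < \prod_i tnth s i by apply: prodr_gt0.
rewrite powRM ?(ltW P0)//; last by apply: possemidefmx_det_ge0; case: cc.
rewrite mulrA -powRD; last by rewrite (gt_eqF P0) implybT.
congr (_ `^ _ * _); last by field.
by apply: eq_bigr => i _; rewrite mxE.
Qed.

Lemma integral_orthant_corr n (a : R) (A : 'M[R]_n) :
  (0 < n)%N -> n%:R - 1 < 2 * a -> posdefmx A ->
  (\int[lebesgue_tuple R n]_(s in @tuple_row R n @^-1` @orthant R n)
     \int[lebesgue_tuple R (N n)]_(c in [set c | correlation_matrix (corrmx c)])
     (\det (diag_mx (tuple_row s)) `^ (a - 1) *
      \det (corrmx c) `^ (a - (n%:R + 1) / 2) *
      etr (- (A *m (sqrt_diag s *m corrmx c *m sqrt_diag s))))%:E =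
   (multigamma n a * \det A `^ (- a))%:E)%E.
Proof.
move=> n0 na pA; rewrite -integral_psd_wishart_kernel//.
rewrite (@ge0_integral_glue _ _ _ _ (@fintype.split n (N n))); first last.
- by move=> w; rewrite lee_fin psd_wishart_kernel_ge0.
- by apply/measurable_EFinP; exact: measurable_psd_wishart_kernel.
- by exists unsplit; [exact: splitK|exact: unsplitK].
rewrite [LHS]integral_mkcond; apply: eq_integral => s _.
rewrite patchE; have [s0|ns0] := pselect ((tuple_row s) \in @orthant R n).
  rewrite mem_set//=; last by move: s0; rewrite inE.
  apply: integral_corr => // i.
  by move: s0; rewrite inE => /(_ i); rewrite mxE.
rewrite memNset//=; last by move=> h; apply: ns0; rewrite inE.
apply/esym; apply: integral0_eq => c _.
rewrite /psd_wishart_kernel asboolF// => -[_ h]; apply: ns0; rewrite inE => i.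
by have := h i; rewrite covmx_glue_split eqxx mxE.
Qed.

End corr_link.

(** * Uniqueness of the Laplace transform *)
Section step_approx.
Context {R : realType}.

(** With [u = 2^(- y / b)] this is [(1 - u^m)^N] for [N = m 2^m], and
[N u^m = m (2 u)^m]. This tends to 0 if [2 u < 1], that is if [b < y], and to
infinity otherwise; the factor [m] in [N] settles the boundary case
[2 u = 1]. For [b <= 0] the indicator of [b < y] is 1 on the positive
half-line. *)
Definition step_approx (m : nat) (b y : R) : R :=
  if 0 < b then (1 - expR (- (m%:R * (ln 2 / b) * y))) ^+ (m * 2 ^ m) else 1.

Lemma step_approx_itv m (b y : R) : 0 <= y -> 0 <= step_approx m b y <= 1.
Proof.
move=> y0; rewrite /step_approx; case: ifP => b0; last by rewrite ler01 lexx.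
have c0 : 0 <= m%:R * (ln 2 / b) * y.
  by apply: mulr_ge0 => //; apply: mulr_ge0 => //; rewrite divr_ge0 ?ln_ge0 ?ler1n// ltW.
have e1 : expR (- (m%:R * (ln 2 / b) * y)) <= 1 by rewrite -[leRHS]expR0 ler_expR oppr_le0.
rewrite exprn_ge0 ?subr_ge0//= exprn_ile1 ?subr_ge0//.
Qed.

(** The lower bound is Bernoulli's inequality; the upper one combines
[(1 - u)(1 + u) <= 1] with Bernoulli's inequality for [1 + u]. *)
Lemma one_sub_exp_bounds (u : R) N : 0 <= u <= 1 ->
  1 - N%:R * u <= (1 - u) ^+ N /\ (1 - u) ^+ N <= (1 + N%:R * u)^-1.
Proof.
move=> /andP[u0 u1]; split.
  elim: N => [|N IH]; first by rewrite mul0r subr0 expr0.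
  rewrite exprS -natr1.
  have : (1 - u) * (1 - N%:R * u) <= (1 - u) * (1 - u) ^+ N by rewrite ler_wpM2l ?subr_ge0.
  apply: le_trans; have : 0 <= N%:R * u * u by rewrite !mulr_ge0.
  by lra.
have H : 1 + N%:R * u <= (1 + u) ^+ N.
  elim: N => [|N IH]; first by rewrite mul0r addr0 expr0.
  rewrite exprS -natr1.
  have : (1 + u) * (1 + N%:R * u) <= (1 + u) * (1 + u) ^+ N by rewrite ler_wpM2l// addr_ge0.
  apply: le_trans; have : 0 <= N%:R * u * u by rewrite !mulr_ge0.
  by lra.
have p0 : 0 < 1 + N%:R * u by rewrite ltr_pwDl// mulr_ge0.
rewrite -[leRHS]mul1r ler_pdivlMr//.
apply: (@le_trans _ _ ((1 - u) ^+ N * (1 + u) ^+ N)).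
  by rewrite ler_wpM2l// exprn_ge0// subr_ge0.
rewrite -exprMn exprn_ile1//; last by rewrite -subr_sqr expr1n gerBl sqr_ge0.
by rewrite mulr_ge0 ?subr_ge0// addr_ge0.
Qed.

(** With [s] the square root of [r], Bernoulli's inequality for [s^-1] bounds
[m s^m], leaving another factor [s^m]. *)
Lemma cvg_mul_exp0 (r : R) : 0 <= r < 1 -> m%:R * r ^+ m @[m --> \oo] --> (0 : R).
Proof.
move=> /andP[r0 r1]; have [->|rn0] := eqVneq r 0.
  apply: (@cvg_near_cst) => //; exists 1%N => // -[|m]//= _.
  by rewrite expr0n mulr0.
have rp : 0 < r by rewrite lt_neqAle eq_sym rn0.
pose s := Num.sqrt r.
have s0 : 0 < s by rewrite sqrtr_gt0.
have s1 : s < 1 by rewrite -sqrtr1 ltr_sqrt.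
pose d := s^-1 - 1.
have d0 : 0 < d by rewrite subr_gt0 invf_gt1.
apply: (@squeeze_cvgr _ _ _ _ (cst 0) (fun m => d^-1 * s ^+ m)).
- apply: nearW => m; rewrite /= mulr_ge0 ?exprn_ge0//=.
  have -> : r = s * s by rewrite -expr2 sqr_sqrtr.
  rewrite exprMn mulrA ler_wpM2r ?exprn_ge0 ?(ltW s0)//.
  have : 1 + m%:R * d <= (1 + d) ^+ m.
    elim: m => [|m IH]; first by rewrite mul0r addr0 expr0.
    rewrite exprS -natr1.
    have : (1 + d) * (1 + m%:R * d) <= (1 + d) * (1 + d) ^+ m.
      by rewrite ler_wpM2l// addr_ge0// ltW.
    apply: le_trans; have : 0 <= m%:R * d * d by rewrite !mulr_ge0// ltW.
    by lra.
  have -> : 1 + d = s^-1 by rewrite /d; ring.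
  rewrite exprVn => H.
  rewrite -[leRHS]mul1r ler_pdivlMr// mulrAC -ler_pdivlMr ?exprn_gt0// mul1r.
  by apply: le_trans H; rewrite lerDr.
- exact: cvg_cst.
- rewrite -[X in _ --> X](mulr0 d^-1); apply: cvgM; first exact: cvg_cst.
  by apply: cvg_expr; rewrite ger0_norm ?ltW.
Qed.

Lemma cvg_step_approx (b y : R) : 0 < y ->
  step_approx m b y @[m --> \oo] --> (if b < y then 1 else 0 : R).
Proof.
move=> y0; rewrite /step_approx; have [b0|b0] := ltP 0 b; last first.
  by rewrite (le_lt_trans b0 y0); exact: cvg_cst.
pose u := expR (- (ln 2 / b * y)).
have uE m : expR (- (m%:R * (ln 2 / b) * y)) = u ^+ m.
  by rewrite -expRM_natl; congr expR; ring.
under eq_fun do rewrite uE.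
have u0 : 0 <= u by exact: expR_ge0.
have l2 : 0 < ln 2 :> R by rewrite ln_gt0// ltr1n.
have u1 : u <= 1 by rewrite -[leRHS]expR0 ler_expR oppr_le0 !mulr_ge0 ?invr_ge0 ?(ltW y0) ?(ltW b0) ?(ltW l2).
have um m : 0 <= u ^+ m <= 1 by rewrite exprn_ge0//= exprn_ile1.
have NE m : (m * 2 ^ m)%:R * u ^+ m = m%:R * (2 * u) ^+ m.
  by rewrite natrM natrX exprMn mulrA.
have u2 : (b < y) = (2 * u < 1).
  have -> : 2 * u = expR (ln 2 * (1 - y / b)).
    rewrite -[X in X * u](@lnK R 2) ?posrE// -expRD; congr expR.
    by field; rewrite gt_eqF.
  by rewrite -[X in _ = (_ < X)]expR0 ltr_expR pmulr_rlt0// subr_lt0 ltr_pdivlMr// mul1r.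
case: ifPn => by_.
  apply: (@squeeze_cvgr _ _ _ _ (fun m => 1 - m%:R * (2 * u) ^+ m) (cst 1)).
  - apply: nearW => m; have [+ _] := one_sub_exp_bounds (m * 2 ^ m) (um m).
    rewrite NE => -> /=; rewrite exprn_ile1 ?subr_ge0//; first by case/andP: (um m).
    by rewrite gerBl; case/andP: (um m).
  - rewrite -[X in _ --> X]subr0; apply: cvgB; first exact: cvg_cst.
    by apply: cvg_mul_exp0; rewrite -u2 by_ andbT mulr_ge0.
  - exact: cvg_cst.
apply: (@squeeze_cvgr _ _ _ _ (cst 0) (@harmonic R)).
- apply: nearW => m; have [_] := one_sub_exp_bounds (m * 2 ^ m) (um m).
  rewrite NE => H; rewrite exprn_ge0/=; last by rewrite subr_ge0; case/andP: (um m).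
  apply: (le_trans H); rewrite /harmonic lef_pV2 ?posrE//; last first.
    by rewrite ltr_pwDl// mulr_ge0// exprn_ge0// mulr_ge0.
  rewrite -natr1 addrC lerD2l ler_peMr// exprn_ege1//.
  by rewrite leNgt -u2.
- exact: cvg_cst.
- exact: cvg_harmonic.
Qed.

End step_approx.

Section laplace.
Context {R : realType}.

Definition torthant n : set (n.-tuple R) := @tuple_row R n @^-1` @orthant R n.
Arguments torthant : clear implicits.

Lemma torthantE n : torthant n = tuple_box (fun=> `]0, +oo[%classic).
Proof.
apply/seteqP; split=> s /= H i; have := H i; rewrite ?mxE /= in_itv/= ?andbT//.
Qed.

Lemma measurable_torthant n : measurable (torthant n).
Proof. by rewrite torthantE; apply: measurable_tuple_box => i; exact: measurable_itv. Qed.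

Definition laplace_exp n (t y : 'rV[R]_n) : R := expR (- \sum_j t 0 j * y 0 j).

Lemma laplace_exp_itv n (t y : 'rV[R]_n) : (forall i, 0 <= t 0 i) -> orthant y ->
  0 <= laplace_exp t y <= 1.
Proof.
move=> t0 y0; rewrite expR_ge0/= -[leRHS]expR0 ler_expR oppr_le0.
by apply: sumr_ge0 => j _; rewrite mulr_ge0// ltW.
Qed.

Lemma measurable_laplace_exp n (t : 'rV[R]_n) :
  measurable_fun [set: n.-tuple R] (fun s => laplace_exp t (tuple_row s)).
Proof.
apply: measurableT_comp => //; apply: measurableT_comp => //.
apply: measurable_sum => j; apply: measurable_funM => //.
exact: measurable_tuple_row.
Qed.

Section fixed.
Context n (f L : 'rV[R]_n -> R).
Hypothesis hf : has_laplace_transform f L.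

Local Notation lam := (lebesgue_tuple R n).
Local Notation O := (torthant n).

Lemma measurable_laplace_fun : measurable_fun O (fun s => f (tuple_row s)).
Proof. by have [/measurable_int/measurable_EFinP] := hf. Qed.

Lemma integrable_bounded_mul (g : n.-tuple R -> R) : measurable_fun O g ->
  (forall s, O s -> `|g s| <= 1) ->
  lam.-integrable O (fun s => (g s * f (tuple_row s))%:E).
Proof.
move=> mg g1; have [If _] := hf.
apply: (le_integrable _ _ _ If); first exact: measurable_torthant.
  apply/measurable_EFinP/measurable_funM => //; exact: measurable_laplace_fun.
move=> s Os; rewrite /= lee_fin normrM ler_piMl//; exact: g1.
Qed.

Lemma integral_exp_sum (I : finType) (c : I -> R) (t : I -> 'rV[R]_n) :
  (forall i j, 0 <= t i 0 j) ->
  (\int[lam]_(s in O) ((\sum_i c i * laplace_exp (t i) (tuple_row s)) * f (tuple_row s))%:E =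
   (\sum_i c i * L (t i))%:E)%E.
Proof.
move=> t0.
have Ie i : lam.-integrable O (fun s => (laplace_exp (t i) (tuple_row s) * f (tuple_row s))%:E).
  apply: integrable_bounded_mul.
    by apply: measurable_funTS; exact: measurable_laplace_exp.
  by move=> s Os; have /andP[e0 e1] := laplace_exp_itv (t0 i) Os; rewrite ger0_norm.
transitivity (\int[lam]_(s in O) (\sum_i ((c i)%:E * (laplace_exp (t i) (tuple_row s) * f (tuple_row s))%:E)))%E.
  apply: eq_integral => s _; rewrite mulr_suml sumEFin.
  by congr EFin; apply: eq_bigr => i _; rewrite mulrA.
rewrite (integral_sum (@measurable_torthant n)) => [|i]; last first.
  by apply: integrableZl => //; exact: measurable_torthant.
rewrite -sumEFin; apply: eq_bigr => i _.
rewrite integralZl//; last exact: measurable_torthant.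
by rewrite EFinM; congr (_ * _)%E; have [_ /(_ (t i) (t0 i))] := hf.
Qed.

Lemma cvg_bigprod (J : Type) (r : seq J) (G : nat -> J -> R) (H : J -> R) :
  (forall j, G m j @[m --> \oo] --> H j) ->
  (\prod_(j <- r) G m j) @[m --> \oo] --> \prod_(j <- r) H j.
Proof.
move=> GH; elim: r => [|j r IH].
  by rewrite big_nil; under eq_fun do rewrite big_nil; exact: cvg_cst.
by rewrite big_cons; under eq_fun do rewrite big_cons; exact: cvgM.
Qed.

(** Dominated convergence, with the absolute value of [f] as the bound. *)
Lemma cvg_integral_prod (G : nat -> 'I_n -> R -> R) (H : 'I_n -> R -> R) :
  (forall m j, measurable_fun [set: R] (G m j)) ->
  (forall m j y, 0 < y -> `|G m j y| <= 1) ->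
  (forall j y, 0 < y -> G m j y @[m --> \oo] --> H j y) ->
  (\int[lam]_(s in O) ((\prod_j G m j (tnth s j)) * f (tuple_row s))%:E)%E @[m --> \oo] -->
  (\int[lam]_(s in O) ((\prod_j H j (tnth s j)) * f (tuple_row s))%:E)%E.
Proof.
move=> mG G1 GH; have [If _] := hf.
have Opos (s : n.-tuple R) j : O s -> 0 < tnth s j by move=> /(_ j); rewrite mxE.
apply: (@dominated_cvg _ _ _ lam O (@measurable_torthant n) _ _ (fun s => `|(f (tuple_row s))%:E|%E)).
- move=> m; apply/measurable_EFinP/measurable_funM; last exact: measurable_laplace_fun.
  apply: measurable_funTS; apply: measurable_prod => j _.
  exact: (measurableT_comp (mG m j) (measurable_tnth j)).
- move=> s Os; apply: cvg_EFin; first by apply: nearW.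
  apply: cvgM; last exact: cvg_cst.
  by apply: cvg_bigprod => j; apply: GH; exact: Opos.
- by [].
- exact: integrable_abse.
- move=> m s Os; rewrite /= lee_fin normrM ler_piMl// normr_prod.
  by apply: prodr_ile1 => j _; rewrite normr_ge0 G1//; exact: Opos.
Qed.

End fixed.

Section expoly.
Context d (T : measurableType d) (n : nat).

(** Linear combinations of the exponentials whose integrals against [f] are
values of its transform. The parameter [s] makes the exponents measurable
functions, as needed for families of densities. *)
Definition expoly (phi : T -> 'rV[R]_n -> R) : Prop :=
  exists (I : finType) (c : I -> R) (t : I -> T -> 'rV[R]_n),
    [/\ forall i s j, 0 <= t i s 0 j, forall i, measurable_mx setT (t i) &
        forall s y, phi s y = \sum_i c i * laplace_exp (t i s) y].

Lemma laplace_expD (t u y : 'rV[R]_n) :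
  laplace_exp (t + u) y = laplace_exp t y * laplace_exp u y.
Proof.
rewrite /laplace_exp -expRD -opprD -big_split; congr (expR (- _)).
by apply: eq_bigr => j _; rewrite mxE mulrDl.
Qed.

Lemma expoly_cst (k : R) : expoly (fun _ _ => k).
Proof.
exists unit, (fun=> k), (fun _ _ => 0); split.
- by move=> i s j; rewrite mxE.
- by move=> i; exact: measurable_mx_cst.
move=> s y; rewrite big_const card_unit/= addr0 /laplace_exp big1 ?oppr0 ?expR0 ?mulr1//.
by move=> j _; rewrite mxE mul0r.
Qed.

Lemma expoly_exp (t : T -> 'rV[R]_n) : (forall s j, 0 <= t s 0 j) ->
  measurable_mx setT t -> expoly (fun s => laplace_exp (t s)).
Proof.
move=> t0 mt; exists unit, (fun=> 1), (fun=> t); split => // s y.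
by rewrite big_const card_unit/= addr0 mul1r.
Qed.

Lemma expolyD phi psi : expoly phi -> expoly psi -> expoly (fun s y => phi s y + psi s y).
Proof.
move=> [I [c [t [t0 mt E]]]] [J [e [u [u0 mu E']]]].
exists (I + J)%type, (fun k => match k with inl i => c i | inr j => e j end),
  (fun k => match k with inl i => t i | inr j => u j end); split.
- by case.
- by case.
- by move=> s y; rewrite E E' big_sumType.
Qed.

Lemma expolyM phi psi : expoly phi -> expoly psi -> expoly (fun s y => phi s y * psi s y).
Proof.
move=> [I [c [t [t0 mt E]]]] [J [e [u [u0 mu E']]]].
exists (I * J)%type, (fun k => c k.1 * e k.2), (fun k s => t k.1 s + u k.2 s); split.
- by move=> k s j; rewrite mxE addr_ge0.
- by move=> k; exact: measurable_addmx.
- move=> s y; rewrite E E' big_distrlr/= pair_bigA; apply: eq_bigr => k _.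
  by rewrite laplace_expD; ring.
Qed.

Lemma expolyN phi : expoly phi -> expoly (fun s y => - phi s y).
Proof.
move=> h; rewrite (_ : (fun _ _ => _) = fun s y => -1 * phi s y); last first.
  by apply/funext => s; apply/funext => y; rewrite mulN1r.
by apply: expolyM => //; exact: expoly_cst.
Qed.

Lemma expolyX phi k : expoly phi -> expoly (fun s y => phi s y ^+ k).
Proof.
move=> h; elim: k => [|k IH].
  rewrite (_ : (fun _ _ => _) = fun s y => 1); last by apply/funext => s; apply/funext => y; rewrite expr0.
  exact: expoly_cst.
rewrite (_ : (fun _ _ => _) = fun s y => phi s y * phi s y ^+ k).
  exact: expolyM.
by apply/funext => s; apply/funext => y; rewrite exprS.
Qed.

Lemma expoly_bigprod (J : Type) (r : seq J) (phi : J -> T -> 'rV[R]_n -> R) :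
  (forall j, expoly (phi j)) -> expoly (fun s y => \prod_(j <- r) phi j s y).
Proof.
move=> h; elim: r => [|j r IH].
  rewrite (_ : (fun _ _ => _) = fun s y => 1); last by apply/funext => s; apply/funext => y; rewrite big_nil.
  exact: expoly_cst.
rewrite (_ : (fun _ _ => _) = fun s y => phi j s y * \prod_(j <- r) phi j s y).
  exact: expolyM.
by apply/funext => s; apply/funext => y; rewrite big_cons.
Qed.

(** Expanding the power of [1 - exp (- c y)]. *)
Lemma expoly_step m (b : T -> R) (j : 'I_n) :
  (forall s, 0 < b s) -> measurable_fun setT b ->
  expoly (fun s y => step_approx m (b s) (y 0 j)).
Proof.
move=> b0 mb.
pose t s : 'rV[R]_n := (m%:R * (ln 2 / b s)) *: delta_mx 0 j.
have tE s k : t s 0 k = m%:R * (ln 2 / b s) * (k == j)%:R by rewrite !mxE eqxx.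
rewrite (_ : (fun _ _ => _) = fun s y => (1 + - laplace_exp (t s) y) ^+ (m * 2 ^ m)).
  apply/expolyX/expolyD; first exact: expoly_cst.
  apply/expolyN/expoly_exp.
    move=> s k; rewrite tE; apply: mulr_ge0 => //; apply: mulr_ge0 => //.
    by rewrite divr_ge0 ?ln_ge0 ?ler1n// ltW.
  move=> i k; rewrite ord1 (_ : (fun _ => _) = fun s => m%:R * (ln 2 / b s) * (k == j)%:R); last first.
    by apply/funext => s; rewrite tE.
  by apply: measurable_funM => //; apply: measurable_funM => //; apply: measurable_funM => //; exact: measurable_funV.
apply/funext => s; apply/funext => y; rewrite /step_approx b0; congr ((1 - expR (- _)) ^+ _).
rewrite (bigD1 j)//= big1 ?addr0; first by rewrite tE eqxx mulr1.
by move=> k kj; rewrite tE (negbTE kj) mulr0 mul0r.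
Qed.

End expoly.

Lemma measurable_step_approx m b : measurable_fun [set: R] (step_approx m b).
Proof.
rewrite /step_approx; case: (0 < b); last exact: measurable_cst.
apply: measurable_funX; apply: measurable_funB => //.
by apply: measurableT_comp => //; apply: measurableT_comp.
Qed.

End laplace.
Arguments torthant {R} n _.

Section uniqueness.
Context {R : realType}.

(** A ray in one coordinate is the union over [k] of the boxes that have the ray
above [- k] in every other coordinate. *)
Lemma measurable_ray_boxes n (B : set (n.-tuple R)) : measurable B ->
  <<s [set A | exists b : 'I_n -> R, A = tuple_box (fun j => `]b j, +oo[%classic)] >> B.
Proof.
set G := [set A | _].
have GG A : G A -> <<s G >> A by exact: sub_sigma_algebra.
have [G0 GC GU] := smallest_sigma_algebra setT G.
apply: smallest_sub => // C; rewrite -bigcup_seq/= => -[i _ [D mD <-]].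
rewrite setTI.
have sP : sigma_algebra setT [set D : set R | <<s G >> ((fun x : n.-tuple R => tnth x i) @^-1` D)].
  split => /=.
  - by rewrite preimage_set0; exact: G0.
  - by move=> A sA; rewrite setTD preimage_setC -setTD; exact: GC.
  - by move=> F sF; rewrite preimage_bigcup; exact: GU.
move: mD; rewrite [measurable D](_ : _ = (RGenOInfty.G (R:=R)).-sigma.-measurable D); last first.
  by rewrite -RGenOInfty.measurableE.
move: D; apply: smallest_sub => // _ [x ->] /=.
have -> : (fun s : n.-tuple R => tnth s i) @^-1` `]x, +oo[%classic =
    \bigcup_k tuple_box (fun j => `](if j == i then x else - k%:R), +oo[%classic).
  apply/seteqP; split=> s /=.
    rewrite in_itv/= andbT => xs.
    pose M := \max_j (Num.truncn `|tnth s j|).+1.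
    exists M => // j /=; rewrite in_itv/= andbT; case: eqP => [->//|_].
    rewrite ltrNl (le_lt_trans (ler_norm _))// normrN.
    apply: lt_le_trans (truncnS_gt _) _.
    by rewrite ler_nat; exact: (leq_bigmax j).
  by move=> [k _ /(_ i)]; rewrite eqxx.
apply: GU => k; apply: GG.
by exists (fun j => if j == i then x else - k%:R).
Qed.

(** The sets over which [h] has integral zero form a lambda-system. *)
Lemma dynkin_integral0 d (T : measurableType d) (mu : {measure set T -> \bar R})
    (O : set T) (h : T -> \bar R) (G : set (set T)) :
  measurable O -> (forall x, h x \is a fin_num) -> mu.-integrable O h -> setI_closed G -> <<s G >> = measurable ->
  (\int[mu]_(x in O) h x = 0)%E ->
  (forall A, G A -> \int[mu]_(x in O `&` A) h x = 0)%E ->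
  ae_eq mu O h (cst 0%E).
Proof.
move=> mO hfin ih GI Gm h0 hG.
have mh := measurable_int _ ih.
pose H : set (set T) := [set A | measurable A /\ (\int[mu]_(x in O `&` A) h x = 0)%E].
suff HT A : measurable A -> H A.
  apply: integral_ae_eq => // E EO mE.
  have [_] := HT _ mE; rewrite setIC (setIidl EO) => ->.
  by rewrite integral0.
rewrite -Gm; move: A; apply: (@lambda_system_subset T G GI setT H) => //; last first.
  move=> A GA; split; last exact: hG.
  by rewrite -Gm; exact: sub_sigma_algebra.
split => //.
- by split => //; rewrite setIT.
- move=> A B BA [mA hA] [mB hB]; split; first exact: measurableD.
  have mOB : measurable (O `&` B) by exact: measurableI.
  have mOAB : measurable (O `&` (A `\` B)) by apply: measurableI => //; exact: measurableD.
  have E : O `&` A = (O `&` B) `|` (O `&` (A `\` B)) by rewrite -setIUr setDUK.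
  move: hA; rewrite E integral_setU//.
  + by rewrite hB add0e.
  + by apply: measurable_funS mh => // x [] [].
  + by apply/disj_setPS => x [[_ Bx] [_ [_ nBx]]].
- move=> F ndF HF; split; first by apply: bigcupT_measurable => k; have [] := HF k.
  rewrite integral_mkcondr.
  have mhF A : measurable A -> measurable_fun O (h \_ A).
    by move=> mA; apply/measurable_restrict => //; apply: measurable_funS mh => // x [].
  have C : (\int[mu]_(x in O) (h \_ (F k)) x)%E @[k --> \oo] -->
      (\int[mu]_(x in O) (h \_ (\bigcup_k F k)) x)%E.
    apply: (@dominated_cvg _ _ _ mu O mO _ _ (abse \o h)).
    + by move=> k; apply: mhF; have [] := HF k.
    + move=> x Ox; apply: cvg_near_cst.
      have [[k _ Fkx]|nF] := pselect ((\bigcup_k F k) x).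
        exists k => // m /= km; rewrite !patchE !mem_set//; first by exists k.
        by move/subsetPset : (ndF _ _ km); apply.
      apply: nearW => k; rewrite !patchE !memNset// => Fkx; apply: nF.
      by exists k.
    + by move=> x _; rewrite /= abse_fin_num.
    + exact: integrable_abse.
    + move=> k x Ox; rewrite /= patchE; case: ifP => // _.
      by rewrite abse0 abse_ge0.
  rewrite -(cvg_lim (@ereal_hausdorff R) C).
  have -> : (fun k => (\int[mu]_(x in O) (h \_ (F k)) x)%E) = cst 0%E.
    by apply/funext => k; rewrite -integral_mkcondr; have [] := HF k.
  by rewrite lim_cst.
Qed.

(** On the orthant, integrals over products of rays are limits of integrals of
[expoly] functions, hence determined by [L]; the difference [f - g] therefore
integrates to zero over a generating family that is stable under
intersection. *)
Lemma laplace_unique n (f g L : 'rV[R]_n -> R) :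
  has_laplace_transform f L -> has_laplace_transform g L ->
  {ae lebesgue_tuple R n, forall s, torthant n s -> f (tuple_row s) = g (tuple_row s)}.
Proof.
move=> hf hg.
have [If Lf] := hf; have [Ig Lg] := hg.
have mO := @measurable_torthant R n.
pose h s := (f (tuple_row s) - g (tuple_row s))%:E : \bar R.
have Ih : (lebesgue_tuple R n).-integrable (torthant n) h.
  by have := integrableB mO If Ig; exact: eq_integrable.
have quad (b : 'I_n -> R) (e e' : 'rV[R]_n -> R) : has_laplace_transform e L ->
    has_laplace_transform e' L ->
    (\int[lebesgue_tuple R n]_(s in torthant n)
      ((\prod_j (if b j < tnth s j then 1 else 0)) * e (tuple_row s))%:E =
     \int[lebesgue_tuple R n]_(s in torthant n)
      ((\prod_j (if b j < tnth s j then 1 else 0)) * e' (tuple_row s))%:E)%E.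
  have C k : has_laplace_transform k L ->
      (\int[lebesgue_tuple R n]_(s in torthant n)
         ((\prod_j step_approx m (b j) (tnth s j)) * k (tuple_row s))%:E)%E @[m --> \oo] -->
      (\int[lebesgue_tuple R n]_(s in torthant n)
         ((\prod_j (if b j < tnth s j then 1 else 0)) * k (tuple_row s))%:E)%E.
    move=> hk; apply: (cvg_integral_prod hk (G := fun m j => step_approx m (b j))
      (H := fun j y => if b j < y then 1 else 0)).
    - by move=> m j; exact: measurable_step_approx.
    - move=> m j y y0; have /andP[s0 s1] := step_approx_itv m (b j) (ltW y0).
      by rewrite ger0_norm.
    - by move=> j y y0; exact: cvg_step_approx.
  move=> he he'.
  rewrite -(cvg_lim (@ereal_hausdorff R) (C _ he)) -(cvg_lim (@ereal_hausdorff R) (C _ he')).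
  congr (limn _); apply/funext => m.
  have [I [c [t [t0 _ E]]]] : expoly (fun (_ : unit) (y : 'rV[R]_n) => \prod_j step_approx m (b j) (y 0 j)).
    apply: expoly_bigprod => j; have [b0|b0] := ltP 0 (b j).
      by apply: expoly_step => // s; exact: measurable_cst.
    rewrite (_ : (fun _ _ => _) = fun _ _ => 1); first exact: expoly_cst.
    by apply/funext => u; apply/funext => y; rewrite /step_approx ltNge b0.
  have EE (s : n.-tuple R) : \prod_j step_approx m (b j) (tnth s j) =
      \sum_i c i * laplace_exp (t i tt) (tuple_row s).
    by rewrite -E; apply: eq_bigr => j _; rewrite mxE.
  transitivity (\sum_i c i * L (t i tt))%:E.
    by rewrite -(integral_exp_sum he c (fun i => t0 i tt)); apply: eq_integral => s _; rewrite EE.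
  by rewrite -(integral_exp_sum he' c (fun i => t0 i tt)); apply: eq_integral => s _; rewrite EE.
pose G := [set A | exists b : 'I_n -> R, A = tuple_box (fun j => `]b j, +oo[%classic)].
have GM : <<s G >> = measurable.
  apply/seteqP; split; last exact: measurable_ray_boxes.
  apply: smallest_sub; first exact: sigma_algebra_measurable.
  by move=> _ [b ->]; apply: measurable_tuple_box => j; exact: measurable_itv.
have hE (A : set (n.-tuple R)) : measurable A ->
    (\int[lebesgue_tuple R n]_(s in torthant n `&` A) h s =
     \int[lebesgue_tuple R n]_(s in torthant n `&` A) (f (tuple_row s))%:E -
     \int[lebesgue_tuple R n]_(s in torthant n `&` A) (g (tuple_row s))%:E)%E.
  move=> mA; have mOA : measurable (torthant n `&` A) by exact: measurableI.
  have IA e : (lebesgue_tuple R n).-integrable (torthant n) e ->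
      (lebesgue_tuple R n).-integrable (torthant n `&` A) e.
    by move=> Ie; apply: (integrableS mO mOA _ Ie); exact: subIsetl.
  by rewrite -(integralB_EFin mOA (IA _ If) (IA _ Ig)).
have finfg (e : 'rV[R]_n -> R) A : measurable A -> has_laplace_transform e L ->
    (\int[lebesgue_tuple R n]_(s in torthant n `&` A) (e (tuple_row s))%:E)%E \is a fin_num.
  move=> mA [Ie _]; have mOA : measurable (torthant n `&` A) by exact: measurableI.
  apply: integrable_fin_num => //; apply: (integrableS mO mOA _ Ie); exact: subIsetl.
have := @dynkin_integral0 _ _ (lebesgue_tuple R n) (torthant n) h G mO.
have L0 (e : 'rV[R]_n -> R) : has_laplace_transform e L ->
    (\int[lebesgue_tuple R n]_(s in torthant n) (e (tuple_row s))%:E = (L 0)%:E)%E.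
  move=> [_ /(_ 0) <-]; last by move=> i; rewrite mxE.
  apply: eq_integral => s _; rewrite big1 ?oppr0 ?expR0 ?mul1r//.
  by move=> j _; rewrite mxE mul0r.
move=> D; have {}D : ae_eq (lebesgue_tuple R n) (torthant n) h (cst 0%E).
  apply: D => //.
  - move=> _ _ [b ->] [b' ->]; exists (fun j => Num.max (b j) (b' j)).
    apply/seteqP; split=> s /=.
      by move=> [H H'] j; have := H j; have := H' j; rewrite /= !in_itv/= !andbT gt_max => -> ->.
    by move=> H; split=> j; have := H j; rewrite /= !in_itv/= !andbT gt_max => /andP[].
  - have := hE setT measurableT; rewrite setIT => ->.
    by rewrite (L0 _ hf) (L0 _ hg) subee.
  - move=> A [b Ab].
    have mA : measurable A by rewrite Ab; apply: measurable_tuple_box => j; exact: measurable_itv.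
    rewrite hE//; suff -> : (\int[lebesgue_tuple R n]_(s in torthant n `&` A) (f (tuple_row s))%:E =
        \int[lebesgue_tuple R n]_(s in torthant n `&` A) (g (tuple_row s))%:E)%E.
      by rewrite subee// finfg.
    have bE (e : 'rV[R]_n -> R) : (\int[lebesgue_tuple R n]_(s in torthant n `&` A) (e (tuple_row s))%:E =
       \int[lebesgue_tuple R n]_(s in torthant n)
      ((\prod_j (if b j < tnth s j then 1 else 0)) * e (tuple_row s))%:E)%E.
      rewrite integral_mkcondr; apply: eq_integral => s _; rewrite patchE Ab.
      have [sA|sA] := pselect (tuple_box (fun j => `]b j, +oo[%classic) s).
        rewrite mem_set// big1 ?mul1r// => j _.
        by have := sA j; rewrite /= in_itv/= andbT => ->.
      rewrite memNset//.
      have [j /negP nj] : exists j, ~ b j < tnth s j.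
        by apply/existsNP => H; apply: sA => j; rewrite /= in_itv/= andbT.
      by rewrite (bigD1 j)//= (negbTE nj) !mul0r.
    by rewrite !bE (quad b f g).
apply: filterS D => s Ds Os; have := Ds Os; rewrite /h/= => -[].
by move=> /eqP; rewrite subr_eq0 => /eqP.
Qed.

End uniqueness.

(** * Joint measurability of the non-central density *)
Section noncentral_measurable.
Context {R : realType}.

Lemma measurable_noncentral_gamma_laplace d (T : measurableType d) n (alpha : R)
    (S0 : 'M[R]_n) (M : T -> 'M[R]_n) (t : T -> 'rV[R]_n) :
  posdefmx S0 -> (forall s i, 0 <= t s 0 i) ->
  measurable_mx setT M -> measurable_mx setT t ->
  measurable_fun setT (fun s => noncentral_gamma_laplace alpha S0 (M s) (t s)).
Proof.
move=> pS0 t0 mM mt.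
have mQ : measurable_mx setT (fun s => 1%:M + S0 *m diag_mx (t s)).
  apply: measurable_addmx; first exact: measurable_mx_cst.
  by apply: measurable_mulmx; [exact: measurable_mx_cst|exact: measurable_diag_mx].
apply: measurable_funM.
  by apply: (measurableT_comp (@measurable_powR R (- alpha))); exact: measurable_det.
apply: measurableT_comp => //; apply: measurable_mxtrace; apply: measurable_oppmx.
apply: measurable_mulmx => //; apply: measurable_mulmx; first exact: measurable_diag_mx.
by apply: measurable_invmx => // s; exact: unit_1_addmx.
Qed.

(** The product of differences of step functions is the indicator of the box
with corner [x] and side [1 / (k + 1)], written in the form that
[cvg_integral_prod] approximates. The box lies in the open orthant, where [f]
is continuous. *)
Lemma cvg_box_average n (f L : 'rV[R]_n -> R) (x : 'rV[R]_n) :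
  has_laplace_transform f L -> {within @orthant R n, continuous f} -> orthant x ->
  k.+1%:R ^+ n * fine (\int[lebesgue_tuple R n]_(s in torthant n)
    ((\prod_j ((if x 0 j < tnth s j then 1 else 0) -
               (if x 0 j + k.+1%:R^-1 < tnth s j then 1 else 0))) * f (tuple_row s))%:E)
  @[k --> \oo] --> f x.
Proof.
move=> hf cf x0; have [If _] := hf.
apply/cvgrPdist_le => e e0.
have : within (@orthant R n) (nbhs x) (fun y => `|f x - f y| <= e).
  by rewrite (nbhs_subspace_in x0); have /cvgrPdist_le/(_ e e0) := cf x.
move=> /nbhs_ballP[r/= r0 rP].
have [N Nr] := ltr_add_invr r0.
exists N => // k /= Nk.
pose B : set (n.-tuple R) := tuple_box (fun j => `]x 0 j, x 0 j + k.+1%:R^-1]%classic).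
have k0 : 0 < k.+1%:R^-1 :> R by rewrite invr_gt0.
have mB : measurable B by apply: measurable_tuple_box => j; exact: measurable_itv.
have BO : B `<=` torthant n.
  move=> s Bs j; have := Bs j; rewrite /= in_itv/= => /andP[xs _].
  by rewrite mxE (lt_trans _ xs)//; exact: x0.
have muB : lebesgue_tuple R n B = ((k.+1%:R^-1) ^+ n)%:E.
  have lB j : lebesgue_measure `]x 0 j, (x 0 j + k.+1%:R^-1)%R]%classic = (k.+1%:R^-1)%:E.
    by rewrite lebesgue_measure_itv/= lte_fin ltrDl k0 -EFinB addrAC subrr add0r.
  rewrite lebesgue_tuple_box//.
  - by under eq_bigr do rewrite lB/=; rewrite prodr_const card_ord.
  - by move=> j; rewrite lB ltry.
have Bclose s : B s -> `|f x - f (tuple_row s)| <= e.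
  move=> Bs; apply: rP; last exact: (BO _ Bs).
  split => // i j; rewrite ord1 mxE /ball/=; have := Bs j; rewrite /= in_itv/= => /andP[h1 h2].
  rewrite ltr_distlC; apply/andP; split; first by rewrite (lt_trans _ h1)// ltrBlDr ltrDl.
  rewrite (le_lt_trans h2)// ltrD2l (le_lt_trans _ Nr)// add0r lef_pV2 ?posrE//.
  by rewrite ler_nat ltnS.
have -> : (\int[lebesgue_tuple R n]_(s in torthant n)
    ((\prod_j ((if x 0 j < tnth s j then 1 else 0) -
               (if x 0 j + k.+1%:R^-1 < tnth s j then 1 else 0))) * f (tuple_row s))%:E =
    \int[lebesgue_tuple R n]_(s in B) (f (tuple_row s))%:E)%E.
  rewrite -{1}(setIidr BO) integral_mkcondr; apply: eq_integral => s _.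
  rewrite patchE; have [Bs|nB] := pselect (B s).
    rewrite mem_set// big1 ?mul1r// => j _.
    by have := Bs j; rewrite /= in_itv/= => /andP[-> h]; rewrite ltNge h subr0.
  rewrite memNset//.
  have [j nj] : exists j, ~ (x 0 j < tnth s j <= x 0 j + k.+1%:R^-1).
    by apply/existsNP => H; apply: nB => j; rewrite /= in_itv/=; exact: H.
  rewrite (bigD1 j)//= (_ : _ - _ = 0) ?mul0r//.
  case: ltP nj => [h1|h1]; case: ltP => [h2|h2] nj; rewrite ?subrr ?subr0//.
  by have := lt_le_trans h2 h1; rewrite gtrDl ltNge (ltW k0).
have IB : (lebesgue_tuple R n).-integrable B (EFin \o (fun s => f (tuple_row s))).
  exact: (integrableS (@measurable_torthant R n) mB BO If).
have Ic (c : R) : (lebesgue_tuple R n).-integrable B (EFin \o cst c).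
  apply/integrableP; split; first by apply/measurable_EFinP; exact: measurable_cst.
  rewrite /= integral_cst//.
  by rewrite [X in (_ * X < _)%E](_ : _ = (k.+1%:R^-1 ^+ n)%:E) ?ltry//; exact: muB.
rewrite -[fine _]/(\int[lebesgue_tuple R n]_(s in B) f (tuple_row s))%R.
have d0 : 0 < k.+1%:R ^+ n :> R by rewrite exprn_gt0.
have cstE (c : R) : \int[lebesgue_tuple R n]_(s in B) cst c s = c / k.+1%:R ^+ n.
  rewrite /= Rintegral_cst//.
  congr (_ * _); rewrite -exprVn; exact: (congr1 fine muB).
have upper : \int[lebesgue_tuple R n]_(s in B) f (tuple_row s) <= (f x + e) / k.+1%:R ^+ n.
  rewrite -cstE; apply: le_Rintegral => // s /Bclose.
  by rewrite ler_distlC => /andP[_].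
have lower : (f x - e) / k.+1%:R ^+ n <= \int[lebesgue_tuple R n]_(s in B) f (tuple_row s).
  rewrite -cstE; apply: le_Rintegral => // s /Bclose.
  by rewrite ler_distlC => /andP[].
rewrite ler_distlC mulrC; apply/andP; split.
  by rewrite -ler_pdivrMr.
by rewrite -ler_pdivlMr.
Qed.

(** Two limits: [J k] is the integral over the box at [x s] of side
[1 / (k + 1)], the limit in [m] of the [A m]. Each [A m] is a finite combination
of values of the non-central transform, measurable since it is an explicit
function of [M s] and the exponents. Averages over the boxes then converge to
the density by continuity. *)
Lemma measurable_noncentral d (T : measurableType d) n (alpha : R)
    (S0 : 'M[R]_n) (gnc : 'M[R]_n -> 'rV[R]_n -> R)
    (M : T -> 'M[R]_n) (x : T -> 'rV[R]_n) :
  posdefmx S0 ->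
  (forall Delta, possemidefmx Delta ->
     noncentral_gamma_density alpha S0 Delta (gnc Delta)) ->
  (forall s, possemidefmx (M s)) -> (forall s, orthant (x s)) ->
  measurable_mx setT M -> measurable_mx setT x ->
  measurable_fun setT (fun s => gnc (M s) (x s)).
Proof.
move=> pS0 gncP pM x0 mM mx.
pose b k s j := x s 0 j + k.+1%:R^-1.
pose J k s := (\int[lebesgue_tuple R n]_(y in torthant n)
    ((\prod_j ((if (x s 0 j < tnth y j)%R then 1 else 0) -
               (if (b k s j < tnth y j)%R then 1 else 0))) * gnc (M s) (tuple_row y))%:E)%E.
have b0 k s j : 0 < b k s j by rewrite addr_gt0 ?invr_gt0// x0.
have mJ k : measurable_fun setT (J k).
  pose A m s := (\int[lebesgue_tuple R n]_(y in torthant n)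
    ((\prod_j (step_approx m (x s 0 j) (tnth y j) -
               step_approx m (b k s j) (tnth y j))) * gnc (M s) (tuple_row y))%:E)%E.
  apply: (emeasurable_fun_cvg A) => [m|s _].
    have [I [c [t [t0 mt E]]]] : expoly (fun s (y : 'rV[R]_n) => \prod_j
        (step_approx m (x s 0 j) (y 0 j) + - step_approx m (b k s j) (y 0 j))).
      apply: expoly_bigprod => j; apply: expolyD.
        by apply: expoly_step; [move=> s; exact: x0|exact: mx].
      apply/expolyN/expoly_step => //.
      by apply: measurable_funD => //; exact: mx.
    have -> : A m = fun s => (\sum_i c i * noncentral_gamma_laplace alpha S0 (M s) (t i s))%:E.
      apply/funext => s; have [_ _ hL] := gncP _ (pM s).
      rewrite -(integral_exp_sum hL c (fun i => t0 i s)); apply: eq_integral => y _.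
      rewrite -E; congr (_ * _)%:E; apply: eq_bigr => j _.
      by rewrite mxE.
    apply/measurable_EFinP; apply: measurable_sum => i; apply: measurable_funM => //.
    apply: measurable_noncentral_gamma_laplace => //; exact: t0.
  have [_ _ hL] := gncP _ (pM s).
  apply: (cvg_integral_prod hL (G := fun m j y => step_approx m (x s 0 j) y - step_approx m (b k s j) y)
     (H := fun j y => (if x s 0 j < y then 1 else 0) - (if b k s j < y then 1 else 0))).
  - by move=> m j; apply: measurable_funB; exact: measurable_step_approx.
  - move=> m j y y0; have /andP[u0 u1] := step_approx_itv m (x s 0 j) (ltW y0).
    have /andP[v0 v1] := step_approx_itv m (b k s j) (ltW y0).
    by rewrite ler_norml; apply/andP; split; lra.
  - by move=> j y y0; apply: cvgB; exact: cvg_step_approx.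
apply: (measurable_fun_cvg (h := fun k s => k.+1%:R ^+ n * fine (J k s))) => [k|s _].
  by apply: measurable_funM => //; exact: measurableT_comp (mJ k).
have [_ cg hL] := gncP _ (pM s).
exact: (cvg_box_average hL cg (x0 s)).
Qed.

End noncentral_measurable.

(** * The Laplace transform of the mixture *)
Section mixture.
Context {R : realType}.
Local Notation N n := #|{: upper_pair n}|.

Definition mixing_dom n (v : n.-tuple R * (N n).-tuple R) : bool :=
  `[< torthant n v.1 /\ correlation_matrix (corrmx v.2) >].

Lemma measurable_mixing_dom n : measurable_fun setT (@mixing_dom n).
Proof.
apply: (measurable_fun_bool true); rewrite setTI.
have -> : @mixing_dom n @^-1` [set true] =
    torthant n `*` (setT `&` [set c | possemidefmx (corrmx c)]).
  apply/seteqP; split=> -[s c] /=; first by move=> /asboolP[? []].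
  move=> [sO [_ pc]]; apply/asboolP; split => //; split => // i.
  exact: corrmx_diag.
apply: measurableX; first exact: measurable_torthant.
by apply: measurable_possemidefmx => //; [exact: corrmx_sym|exact: measurable_corrmx].
Qed.

Definition mixing_cov n (v : n.-tuple R * (N n).-tuple R) : 'M[R]_n :=
  sqrt_diag v.1 *m corrmx v.2 *m sqrt_diag v.1.

Lemma measurable_mixing_cov n : measurable_mx setT (@mixing_cov n).
Proof.
have ms : measurable_mx setT (fun v : n.-tuple R * (N n).-tuple R => sqrt_diag v.1).
  apply: measurable_diag_mx => i j.
  have -> : (fun v : n.-tuple R * (N n).-tuple R => map_mx Num.sqrt (tuple_row v.1) i j) =
      fun v => Num.sqrt (tnth v.1 j).
    by apply/funext => v; rewrite !mxE.
  apply: measurableT_comp; first exact: continuous_measurable_fun (@sqrt_continuous R).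
  exact: (measurableT_comp (measurable_tnth j) measurable_fst).
apply: measurable_mulmx => //; apply: measurable_mulmx => // i j.
exact: (measurableT_comp (measurable_corrmx i j) measurable_snd).
Qed.

(** The weight of the mixture for [A = S22^-1], extended by 0; with [A] the mixing
rate it is also what remains of the transform after the first [p1] variables
have been integrated out. *)
Definition mixing_kernel n (a : R) (A : 'M[R]_n) (v : n.-tuple R * (N n).-tuple R) : R :=
  if mixing_dom v then
    \det (diag_mx (tuple_row v.1)) `^ (a - 1) *
    \det (corrmx v.2) `^ (a - (n%:R + 1) / 2) * etr (- (A *m mixing_cov v))
  else 0.

Lemma mixing_kernel_ge0 n a (A : 'M[R]_n) v : 0 <= mixing_kernel a A v.
Proof.
by rewrite /mixing_kernel; case: ifP => // _; rewrite !mulr_ge0 ?powR_ge0 ?expR_ge0.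
Qed.

Lemma measurable_mixing_kernel n a (A : 'M[R]_n) : measurable_fun setT (mixing_kernel a A).
Proof.
apply: measurable_fun_ifT; [exact: measurable_mixing_dom| |exact: measurable_cst].
apply: measurable_funM; first apply: measurable_funM.
- apply: (measurableT_comp (@measurable_powR R (a - 1))); apply: measurable_det.
  apply: measurable_diag_mx => i j.
  exact: (measurableT_comp (@measurable_tuple_row R n i j) measurable_fst).
- apply: (measurableT_comp (@measurable_powR R (a - (n%:R + 1) / 2))); apply: measurable_det.
  move=> i j; exact: (measurableT_comp (@measurable_corrmx R n i j) measurable_snd).
apply: measurableT_comp => //; apply: measurable_mxtrace; apply: measurable_oppmx.
by apply: measurable_mulmx; [exact: measurable_mx_cst|exact: measurable_mixing_cov].
Qed.

Lemma integral_mixing_kernel n (a : R) (A : 'M[R]_n) :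
  (0 < n)%N -> n%:R - 1 < 2 * a -> posdefmx A ->
  (\int[lebesgue_tuple R n]_s \int[lebesgue_tuple R (N n)]_c (mixing_kernel a A (s, c))%:E =
   (multigamma n a * \det A `^ (- a))%:E)%E.
Proof.
move=> n0 na pA; rewrite -integral_orthant_corr// [RHS]integral_mkcond.
apply: eq_integral => s _; rewrite patchE.
have [sO|sO] := pselect (torthant n s); last first.
  rewrite memNset//; apply: integral0_eq => c _.
  by rewrite /mixing_kernel /mixing_dom asboolF// => -[].
rewrite mem_set// [RHS]integral_mkcond; apply: eq_integral => c _; rewrite patchE.
have [cC|cC] := pselect (correlation_matrix (corrmx c)).
  by rewrite mem_set// /mixing_kernel /mixing_dom asboolT.
by rewrite memNset// /mixing_kernel /mixing_dom asboolF// => -[].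
Qed.

Lemma laplace_exp_row p q (t : 'rV[R]_(p + q)) (x : 'rV[R]_p) (y : 'rV[R]_q) :
  laplace_exp t (row_mx x y) = laplace_exp (lsubmx t) x * laplace_exp (rsubmx t) y.
Proof.
have e : - (\sum_j t 0 j * row_mx x y 0 j) =
    - (\sum_j lsubmx t 0 j * x 0 j) + - (\sum_j rsubmx t 0 j * y 0 j).
  rewrite -opprD big_split_ord/=; congr (- (_ + _)).
    by apply: eq_bigr => j _; rewrite row_mxEl mxE.
  by apply: eq_bigr => j _; rewrite row_mxEr mxE.
by rewrite /laplace_exp e; exact: expRD.
Qed.

Definition ltuple p q (s : (p + q).-tuple R) : p.-tuple R := [tuple tnth s (lshift q i) | i < p].
Definition rtuple p q (s : (p + q).-tuple R) : q.-tuple R := [tuple tnth s (rshift p i) | i < q].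

Lemma measurable_ltuple p q : measurable_fun setT (@ltuple p q).
Proof.
apply/measurable_fun_tnthP => i.
rewrite (_ : _ \o _ = fun s : (p + q).-tuple R => tnth s (lshift q i)); last first.
  by apply/funext => s; rewrite /= tnth_mktuple.
exact: measurable_tnth.
Qed.

Lemma measurable_rtuple p q : measurable_fun setT (@rtuple p q).
Proof.
apply/measurable_fun_tnthP => i.
rewrite (_ : _ \o _ = fun s : (p + q).-tuple R => tnth s (rshift p i)); last first.
  by apply/funext => s; rewrite /= tnth_mktuple.
exact: measurable_tnth.
Qed.

Lemma ltuple_glue p q (x : p.-tuple R) (y : q.-tuple R) :
  ltuple (glue (@fintype.split p q) (x, y)) = x.
Proof. by apply: eq_from_tnth => i; rewrite !tnth_mktuple (unsplitK (inl _)). Qed.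

Lemma rtuple_glue p q (x : p.-tuple R) (y : q.-tuple R) :
  rtuple (glue (@fintype.split p q) (x, y)) = y.
Proof. by apply: eq_from_tnth => i; rewrite !tnth_mktuple (unsplitK (inr _)). Qed.

Lemma tuple_row_split p q (s : (p + q).-tuple R) :
  tuple_row s = row_mx (tuple_row (ltuple s)) (tuple_row (rtuple s)).
Proof.
apply/rowP => i; case: (fintype.split_ordP i) => j ->.
  by rewrite row_mxEl !mxE tnth_mktuple.
by rewrite row_mxEr !mxE tnth_mktuple.
Qed.

Lemma torthant_split p q (s : (p + q).-tuple R) :
  torthant (p + q) s <-> torthant p (ltuple s) /\ torthant q (rtuple s).
Proof.
split=> [sO|[lO rO] i].
  by split=> j; rewrite mxE tnth_mktuple; [have := sO (lshift q j)|have := sO (rshift p j)]; rewrite mxE.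
case: (fintype.split_ordP i) => j ->; rewrite mxE.
  by have := lO j; rewrite mxE tnth_mktuple.
by have := rO j; rewrite mxE tnth_mktuple.
Qed.

(** The diagonal of [X^(1/2) C X^(1/2)] is that of [X], as [C] has unit
diagonal. *)
Lemma laplace_exp_mixing n (t : 'rV[R]_n) (v : n.-tuple R * (N n).-tuple R) : mixing_dom v ->
  laplace_exp t (tuple_row v.1) = etr (- (diag_mx t *m mixing_cov v)).
Proof.
move=> /asboolP[vO _]; rewrite /etr raddfN/= /laplace_exp /mxtrace; congr (expR (- _)).
apply: eq_bigr => j _; rewrite mul_diag_mx [RHS]mxE /mixing_cov sqrt_diagE corrmx_diag mulr1.
by have := vO j; rewrite !mxE => v0; rewrite -expr2 sqr_sqrtr ?(ltW v0).
Qed.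

Section main.
Context (p1 p2 : nat) (p2_gt0 : (0 < p2)%N) (Sigma : 'M[R]_(p1 + p2)).
Hypothesis pSigma : posdefmx Sigma.
Variable alpha : R.
Hypothesis alpha_gt : p2%:R - 1 < 2 * alpha.
Variable gnc : 'M[R]_p1 -> 'rV[R]_p1 -> R.
Hypothesis gncP : forall Delta : 'M[R]_p1, possemidefmx Delta ->
  noncentral_gamma_density alpha (schur_complement Sigma) Delta (gnc Delta).

Local Notation S12 := (ursubmx Sigma).
Local Notation S21 := (dlsubmx Sigma).
Local Notation S22 := (drsubmx Sigma).
Local Notation S0 := (schur_complement Sigma).

Definition noncentrality (v : p2.-tuple R * (N p2).-tuple R) : 'M[R]_p1 :=
  S12 *m invmx S22 *m mixing_cov v *m invmx S22 *m S21.

Lemma possemidefmx_noncentrality v : mixing_dom v -> possemidefmx (noncentrality v).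
Proof.
move=> /asboolP[_ [pC _]]; have [pS22 _] := posdefmx_schur_complement pSigma.
have -> : noncentrality v = (S12 *m invmx S22 *m sqrt_diag v.1) *m corrmx v.2 *m
    (S12 *m invmx S22 *m sqrt_diag v.1)^T.
  rewrite /noncentrality /mixing_cov !trmx_mul trmx_inv (posdefmx_sym pS22) tr_diag_mx.
  by rewrite (trmx_S21 pSigma) !mulmxA.
exact: possemidefmx_congr.
Qed.

(** Extended by 0 where the non-central density carries no information, since
[gnc] is constrained only on the orthant and for positive semi-definite
matrices. *)
Definition conditional_density (u : p1.-tuple R * (p2.-tuple R * (N p2).-tuple R)) : R :=
  if `[< torthant p1 u.1 >] && mixing_dom u.2
  then gnc (noncentrality u.2) (tuple_row u.1) else 0.

Lemma conditional_density_ge0 u : 0 <= conditional_density u.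
Proof.
rewrite /conditional_density; case: ifP => // /andP[/asboolP uO du].
by have [g0 _ _] := gncP (possemidefmx_noncentrality du); exact: g0.
Qed.

(** Outside the domain the arguments of [gnc] are replaced by [0] and the all-ones
vector, so that [measurable_noncentral] applies to total functions. *)
Lemma measurable_conditional_density : measurable_fun setT conditional_density.
Proof.
pose b (u : p1.-tuple R * (p2.-tuple R * (N p2).-tuple R)) := `[< torthant p1 u.1 >] && mixing_dom u.2.
have mb : measurable_fun setT b.
  apply: measurable_and; last exact: (measurableT_comp (@measurable_mixing_dom p2) measurable_snd).
  apply: (measurable_fun_bool true); rewrite setTI.
  have -> : (fun u : p1.-tuple R * (p2.-tuple R * (N p2).-tuple R) => `[< torthant p1 u.1 >]) @^-1` [set true] = torthant p1 `*` setT.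
    by apply/seteqP; split=> u /=; [move=> /asboolP|move=> [? _]; apply/asboolP].
  by apply: measurableX => //; exact: measurable_torthant.
pose M u : 'M[R]_p1 := if b u then noncentrality u.2 else 0.
pose x u : 'rV[R]_p1 := if b u then tuple_row u.1 else const_mx 1.
have -> : conditional_density = fun u => if b u then gnc (M u) (x u) else 0.
  by apply/funext => u; rewrite /conditional_density /M /x -/(b u); case: ifP.
apply: measurable_fun_ifT => //.
apply: (measurable_noncentral (alpha := alpha) (S0 := S0)) => //.
- by have [] := posdefmx_schur_complement pSigma.
- move=> u; rewrite /M; case: ifP => [/andP[_ du]|_]; first exact: possemidefmx_noncentrality.
  by split=> [|v]; rewrite ?trmx0// mulmx0 mul0mx mxE.
- move=> u i; rewrite /x; case: ifP => [/andP[/asboolP uO _]|_]; first exact: uO.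
  by rewrite mxE.
- move=> i j; have -> : (fun u => M u i j) = fun u => if b u then noncentrality u.2 i j else 0.
    by apply/funext => u; rewrite /M; case: ifP => // _; rewrite mxE.
  apply: measurable_fun_ifT => //.
  have mn : measurable_mx setT noncentrality.
    have mc m n (A : 'M[R]_(m, n)) := @measurable_mx_cst R _ (p2.-tuple R * (N p2).-tuple R)%type setT m n A.
    apply: measurable_mulmx => //; apply: measurable_mulmx => //.
    by apply: measurable_mulmx => //; exact: measurable_mixing_cov.
  exact: (measurableT_comp (mn i j) measurable_snd).
- move=> i j; have -> : (fun u => x u i j) = fun u => if b u then tuple_row u.1 i j else 1.
    by apply/funext => u; rewrite /x; case: ifP => // _; rewrite mxE.
  apply: measurable_fun_ifT => //.
  exact: (measurableT_comp (@measurable_tuple_row R p1 i j) measurable_fst).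
Qed.

Lemma integral_conditional_density v (t : 'rV[R]_p1) :
  mixing_dom v -> (forall i, 0 <= t 0 i) ->
  (\int[lebesgue_tuple R p1]_s (laplace_exp t (tuple_row s) * conditional_density (s, v))%:E =
   (noncentral_gamma_laplace alpha S0 (noncentrality v) t)%:E)%E.
Proof.
move=> dv t0; have [_ _ [_ <-//]] := gncP (possemidefmx_noncentrality dv).
rewrite [RHS]integral_mkcond; apply: eq_integral => s _; rewrite patchE.
have [sO|sO] := pselect (torthant p1 s).
  by rewrite mem_set// /conditional_density asboolT//= dv.
by rewrite memNset// /conditional_density asboolF//= mulr0.
Qed.

End main.
End mixture.

Section joint.
Context {R : realType}.
Local Notation N n := #|{: upper_pair n}|.
Context (p1 p2 : nat) (p2_gt0 : (0 < p2)%N) (Sigma : 'M[R]_(p1 + p2)).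
Hypothesis pSigma : posdefmx Sigma.
Variable alpha : R.
Hypothesis alpha_gt : p2%:R - 1 < 2 * alpha.
Variable gnc : 'M[R]_p1 -> 'rV[R]_p1 -> R.
Hypothesis gncP : forall Delta : 'M[R]_p1, possemidefmx Delta ->
  noncentral_gamma_density alpha (schur_complement Sigma) Delta (gnc Delta).

Local Notation S12 := (ursubmx Sigma).
Local Notation S21 := (dlsubmx Sigma).
Local Notation S22 := (drsubmx Sigma).
Local Notation S0 := (schur_complement Sigma).

Definition joint_density (u : p1.-tuple R * (p2.-tuple R * (N p2).-tuple R)) : R :=
  conditional_density Sigma gnc u * mixing_kernel alpha (invmx S22) u.2.

Lemma joint_density_ge0 u : 0 <= joint_density u.
Proof. by rewrite mulr_ge0 ?mixing_kernel_ge0//; exact: (conditional_density_ge0 pSigma gncP). Qed.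

Lemma measurable_joint_density : measurable_fun setT joint_density.
Proof.
apply: measurable_funM; first exact: (measurable_conditional_density pSigma gncP).
by apply: measurableT_comp; [exact: measurable_mixing_kernel|exact: measurable_snd].
Qed.

(** Integrating out the first [p1] variables trades the rate [S22^-1] of the
kernel for the mixing rate. *)
Lemma laplace_transform_conditional (t : 'rV[R]_(p1 + p2)) v : (forall i, 0 <= t 0 i) ->
  (\int[lebesgue_tuple R p1]_x
     ((laplace_exp (lsubmx t) (tuple_row x) * laplace_exp (rsubmx t) (tuple_row v.1)) *
      joint_density (x, v))%:E =
   (\det (1%:M + S0 *m diag_mx (lsubmx t)) `^ (- alpha))%:E *
     (mixing_kernel alpha (mixing_rate Sigma t) v)%:E)%E.
Proof.
move=> t0.
have lt0 i : 0 <= lsubmx t 0 i by rewrite mxE.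
pose k := laplace_exp (rsubmx t) (tuple_row v.1) * mixing_kernel alpha (invmx S22) v.
have k0 : 0 <= k by rewrite mulr_ge0 ?expR_ge0 ?mixing_kernel_ge0.
transitivity (k%:E * \int[lebesgue_tuple R p1]_x
    (laplace_exp (lsubmx t) (tuple_row x) * conditional_density Sigma gnc (x, v))%:E)%E.
  rewrite -ge0_integralZl_cst//.
  - by apply: eq_integral => x _; rewrite -EFinM /k /joint_density/=; congr EFin; ring.
  - apply/measurable_EFinP/measurable_funM; first exact: measurable_laplace_exp.
    by apply: measurableT_comp => //; exact: (measurable_conditional_density pSigma gncP).
  - move=> x; rewrite lee_fin mulr_ge0 ?expR_ge0//.
    exact: (conditional_density_ge0 pSigma gncP).
have [dv|/negPf dv] := boolP (mixing_dom v); last first.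
  by rewrite /k /mixing_kernel dv mulr0 mul0e mule0.
rewrite (integral_conditional_density pSigma gncP)//.
rewrite -!EFinM /k (laplace_exp_mixing _ dv) /mixing_kernel dv /noncentral_gamma_laplace.
congr EFin.
set T1 := diag_mx (lsubmx t); set T2 := diag_mx (rsubmx t).
set W := mixing_cov v.
have e : - \tr (mixing_rate Sigma t *m W) = - \tr (T2 *m W) - \tr (invmx S22 *m W)
    - \tr (T1 *m invmx (1%:M + S0 *m T1) *m noncentrality Sigma v).
  rewrite /noncentrality (trace_noncentral Sigma t W).
  move: (mixing_rate Sigma t) (invmx S22) => M V.
  rewrite mulmxBl mulmxDl.
  rewrite raddfB/= raddfD/=. ring.
have -> : etr (- (mixing_rate Sigma t *m W)) =
    etr (- (T2 *m W)) * etr (- (invmx S22 *m W)) *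
    etr (- (T1 *m invmx (1%:M + S0 *m T1) *m noncentrality Sigma v)).
  by rewrite /etr !raddfN/= e !expRD.
ring.
Qed.

Definition mixing_const := multigamma p2 alpha * \det S22 `^ alpha.

Lemma mixing_const_gt0 : 0 < mixing_const.
Proof.
have [pS22 _] := posdefmx_schur_complement pSigma.
by rewrite mulr_gt0 ?multigamma_gt0// powR_gt0// posdefmx_det_gt0.
Qed.

(** The same density in the order of the variables of the theorem, with the
correlations last. *)
Definition joint_of (w : (p1 + p2).-tuple R * (N p2).-tuple R) : R :=
  joint_density (ltuple w.1, (rtuple w.1, w.2)).

Lemma measurable_joint_of : measurable_fun setT joint_of.
Proof.
apply: (measurableT_comp measurable_joint_density).
apply: measurable_fun_pair; first exact: (measurableT_comp (@measurable_ltuple R p1 p2)).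
by apply: measurable_fun_pair => //; exact: (measurableT_comp (@measurable_rtuple R p1 p2)).
Qed.

Definition mixture (s : (p1 + p2).-tuple R) : \bar R :=
  (mixing_const^-1%:E * \int[lebesgue_tuple R (N p2)]_c (joint_of (s, c))%:E)%E.

Lemma mixture_ge0 s : (0 <= mixture s)%E.
Proof.
apply: mule_ge0; first by rewrite lee_fin invr_ge0 (ltW mixing_const_gt0).
by apply: integral_ge0 => c _; rewrite lee_fin joint_density_ge0.
Qed.

Lemma measurable_mixture : measurable_fun setT mixture.
Proof.
apply: emeasurable_funM; first exact: measurable_cst.
apply: (@measurable_fun_fubini_tonelli_F _ _ _ _ _ _ (fun w => (joint_of w)%:E)).
- by apply/measurable_EFinP; exact: measurable_joint_of.
- by move=> w; rewrite lee_fin joint_density_ge0.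
Qed.

Lemma mixture_out s : ~ torthant (p1 + p2) s -> mixture s = 0%E.
Proof.
move=> sO; rewrite /mixture integral0_eq ?mule0// => c _.
congr EFin; rewrite /joint_of /joint_density /conditional_density /mixing_kernel/=.
case: asboolP => [lO|]; last by rewrite mul0r.
rewrite andTb.
case: ifPn => [/asboolP[rO _]|]; last by rewrite mul0r.
by exfalso; apply/sO/torthant_split.
Qed.

Lemma mixtureE s : torthant (p1 + p2) s ->
  mixture_density alpha Sigma gnc (tuple_row s) = mixture s.
Proof.
move=> /torthant_split[lO rO].
rewrite /mixture_density /mixture /corr_integral; congr (_ * _)%E.
rewrite integral_mkcond; apply: eq_integral => c _; rewrite patchE.
rewrite [in LHS]tuple_row_split row_mxKl row_mxKr.
rewrite /joint_of /joint_density /conditional_density /mixing_kernel /mixing_dom/=.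
have [cC|cC] := pselect (correlation_matrix (corrmx c)).
  by rewrite mem_set// !asboolT//= !mulrA.
rewrite memNset// [X in _ && X]asboolF; last by case.
by rewrite andbF mul0r.
Qed.

(** By Tonelli's theorem the integral over the first [p1] variables is taken
first; [integral_mixing_kernel] and [det_mixing_rate] evaluate the rest. *)
Lemma laplace_transform_mixture (t : 'rV[R]_(p1 + p2)) : (forall i, 0 <= t 0 i) ->
  (\int[lebesgue_tuple R (p1 + p2)]_s ((laplace_exp t (tuple_row s))%:E * mixture s) =
   (gamma_laplace alpha Sigma t)%:E)%E.
Proof.
move=> t0.
have [pS22 pS0] := posdefmx_schur_complement pSigma.
pose G (w : (p1 + p2).-tuple R * (N p2).-tuple R) : R :=
  laplace_exp t (tuple_row w.1) * joint_of w.
have G0 w : 0 <= G w by rewrite mulr_ge0 ?expR_ge0 ?joint_density_ge0.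
have mG : measurable_fun setT (EFin \o G).
  apply/measurable_EFinP/measurable_funM; last exact: measurable_joint_of.
  exact: (measurableT_comp (measurable_laplace_exp t) measurable_fst).
pose I s := (\int[lebesgue_tuple R (N p2)]_c (G (s, c))%:E)%E.
have mI : measurable_fun setT I.
  by apply: (@measurable_fun_fubini_tonelli_F _ _ _ _ _ _ (EFin \o G)) => // w; rewrite lee_fin.
have I0 s : (0 <= I s)%E by apply: integral_ge0 => c _; rewrite lee_fin.
transitivity (mixing_const^-1%:E * \int[lebesgue_tuple R (p1 + p2)]_s I s)%E.
  rewrite -ge0_integralZl_cst//; last by rewrite invr_ge0 (ltW mixing_const_gt0).
  apply: eq_integral => s _; rewrite /mixture muleCA; congr (_ * _)%E.
  rewrite -ge0_integralZl_cst ?expR_ge0//.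
  - by apply/measurable_EFinP/(measurableT_comp measurable_joint_of); exact: measurable_pair1.
  - by move=> c; rewrite lee_fin joint_density_ge0.
rewrite (@ge0_integral_glue _ _ _ _ (@fintype.split p1 p2) _ I)//; last first.
  by exists (@fintype.unsplit p1 p2); [exact: splitK|exact: unsplitK].
pose F (u : p1.-tuple R * (p2.-tuple R * (N p2).-tuple R)) : R :=
  (laplace_exp (lsubmx t) (tuple_row u.1) * laplace_exp (rsubmx t) (tuple_row u.2.1)) *
  joint_density u.
have F0 u : 0 <= F u.
  by apply: mulr_ge0; [apply: mulr_ge0; exact: expR_ge0|exact: joint_density_ge0].
have mF : measurable_fun setT (EFin \o F).
  apply/measurable_EFinP/measurable_funM; last exact: measurable_joint_density.
  apply: measurable_funM.
    exact: (measurableT_comp (measurable_laplace_exp _) measurable_fst).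
  apply: (measurableT_comp (measurable_laplace_exp _)).
  exact: (measurableT_comp measurable_fst measurable_snd).
have -> : (\int[lebesgue_tuple R p1]_x \int[lebesgue_tuple R p2]_y
      I (glue (@fintype.split p1 p2) (x, y)) =
    \int[lebesgue_tuple R p1]_x \int[lebesgue_tuple R p2]_y
      \int[lebesgue_tuple R (N p2)]_c (EFin \o F) (x, (y, c)))%E.
  apply: eq_integral => x _; apply: eq_integral => y _; apply: eq_integral => c _.
  rewrite /G /F /joint_of/= ltuple_glue rtuple_glue; congr (_ * _)%:E.
  by rewrite [in LHS]tuple_row_split ltuple_glue rtuple_glue laplace_exp_row.
rewrite fubini_tonelli_rotate//.
pose d := \det (1%:M + S0 *m diag_mx (lsubmx t)) `^ (- alpha).
have -> : (\int[lebesgue_tuple R p2]_y \int[lebesgue_tuple R (N p2)]_c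
      \int[lebesgue_tuple R p1]_x (EFin \o F) (x, (y, c)) =
    d%:E * \int[lebesgue_tuple R p2]_y \int[lebesgue_tuple R (N p2)]_c
      (mixing_kernel alpha (mixing_rate Sigma t) (y, c))%:E)%E.
  rewrite -ge0_integralZl_cst ?powR_ge0//; first last.
  - by move=> y; apply: integral_ge0 => c _; rewrite lee_fin mixing_kernel_ge0.
  - apply: (@measurable_fun_fubini_tonelli_F _ _ _ _ _ _
      (EFin \o mixing_kernel alpha (mixing_rate Sigma t))).
      by apply/measurable_EFinP; exact: measurable_mixing_kernel.
    by move=> v; rewrite lee_fin mixing_kernel_ge0.
  apply: eq_integral => y _; rewrite -ge0_integralZl_cst ?powR_ge0//; first last.
  - by move=> c; rewrite lee_fin mixing_kernel_ge0.
  - apply/measurable_EFinP/(measurableT_comp (measurable_mixing_kernel _ _)).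
    exact: measurable_pair1.
  by apply: eq_integral => c _; rewrite -laplace_transform_conditional.
have pr := posdefmx_mixing_rate pSigma t0.
rewrite integral_mixing_kernel// -!EFinM; congr EFin.
rewrite /gamma_laplace (det_mixing_rate pSigma t0) /mixing_const /d.
have d22 := posdefmx_det_gt0 pS22; have dr := posdefmx_det_gt0 pr.
have d1 : 0 < \det (1%:M + S0 *m diag_mx (lsubmx t)).
  by apply: det_1_addmx_gt0 => // i; rewrite mxE.
rewrite !powRM ?mulr_ge0 ?(ltW d22) ?(ltW dr) ?(ltW d1)//.
rewrite (powRN (\det S22)).
have := multigamma_gt0 alpha_gt; have : 0 < \det S22 `^ alpha by rewrite powR_gt0.
by move=> /lt0r_neq0 h1 /lt0r_neq0 h2; field; rewrite h1 h2.
Qed.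

End joint.

Theorem theorem1 (R : realType) (p1 p2 : nat)
    (p1_gt0 : (1 <= p1)%N) (p2_gt0 : (1 <= p2)%N)
    (Sigma : 'M[R]_(p1 + p2)) (Sigma_posdef : posdefmx Sigma)
    (alpha : R) (alpha_gt : Num.max (p1%:R - 1) (p2%:R - 1) < 2 * alpha)
    (gnc : 'M[R]_p1 -> 'rV[R]_p1 -> R)
    (gncP : forall Delta : 'M[R]_p1, possemidefmx Delta ->
       noncentral_gamma_density alpha (schur_complement Sigma) Delta
         (gnc Delta)) :
  has_laplace_transform
    (fun x : 'rV[R]_(p1 + p2) => fine (mixture_density alpha Sigma gnc x))
    (gamma_laplace alpha Sigma) /\
  (forall g : 'rV[R]_(p1 + p2) -> R,
     has_laplace_transform g (gamma_laplace alpha Sigma) ->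
     {ae lebesgue_tuple R (p1 + p2), forall s : (p1 + p2).-tuple R,
        orthant (tuple_row s) ->
        (g (tuple_row s))%:E = mixture_density alpha Sigma gnc (tuple_row s)}).
Proof.
have a2 : p2%:R - 1 < 2 * alpha by move: alpha_gt; rewrite gt_max => /andP[].
pose lam := lebesgue_tuple R (p1 + p2); pose O := @torthant R (p1 + p2).
pose m := mixture Sigma alpha gnc.
have m0 s : (0 <= m s)%E := mixture_ge0 Sigma_posdef a2 gncP s.
have mm : measurable_fun setT m := measurable_mixture Sigma_posdef gncP.
have mO : measurable O := @measurable_torthant R (p1 + p2).
have Lm (t : 'rV[R]_(p1 + p2)) : (forall i, 0 <= t 0 i) ->
    (\int[lam]_s ((laplace_exp t (tuple_row s))%:E * m s) = (gamma_laplace alpha Sigma t)%:E)%E.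
  exact: (laplace_transform_mixture p2_gt0 Sigma_posdef a2 gncP).
have Im : lam.-integrable setT m.
  apply/integrableP; split => //.
  suff -> : (\int[lam]_s `|m s| = (gamma_laplace alpha Sigma 0)%:E)%E by rewrite ltry.
  rewrite -Lm; last by move=> i; rewrite mxE.
  apply: eq_integral => s _; rewrite gee0_abs// /laplace_exp big1 => [|j _].
    by rewrite oppr0 expR0 mul1e.
  by rewrite mxE mul0r.
have fin_m : {ae lam, forall s, m s \is a fin_num}.
  by have := integrable_ae measurableT Im; apply: filterS => s; apply.
have mf : measurable_fun setT (fine \o m) by apply: measurableT_comp.
have If : lam.-integrable setT (EFin \o (fine \o m)).
  apply: (le_integrable _ _ _ Im) => //; first exact/measurable_EFinP.
  by move=> s _ /=; have := m0 s; case: (m s) => [r| |]//= _; rewrite normr0 leey.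
have mE s : O s -> mixture_density alpha Sigma gnc (tuple_row s) = m s.
  exact: mixtureE.
have H : has_laplace_transform
    (fun x : 'rV[R]_(p1 + p2) => fine (mixture_density alpha Sigma gnc x))
    (gamma_laplace alpha Sigma).
  split.
    apply: (@eq_integrable _ _ _ lam O mO (EFin \o (fine \o m))).
      by move=> s /set_mem sO /=; rewrite mE.
    exact: (integrableS measurableT).
  move=> t t0; rewrite -Lm//.
  have ml := measurable_laplace_exp t.
  transitivity (\int[lam]_(s in O) ((laplace_exp t (tuple_row s))%:E * m s))%E.
    apply: ae_eq_integral => //.
    - apply: (eq_measurable_fun (fun s => (laplace_exp t (tuple_row s) * fine (m s))%:E)).
        by move=> s /set_mem sO; rewrite mE.
      apply: measurable_funTS; apply/measurable_EFinP; exact: measurable_funM.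
    - apply: measurable_funTS; apply: emeasurable_funM => //.
      exact/measurable_EFinP.
    - by apply: filterS fin_m => s fs sO; rewrite mE// EFinM fineK.
  rewrite integral_mkcond; apply: eq_integral => s _; rewrite patchE.
  have [sO|sO] := pselect (O s); first by rewrite mem_set.
  by rewrite memNset// /m mixture_out// mule0.
split=> // g hg.
have := laplace_unique hg H; have := fin_m.
apply: filterS2 => s fs gs sO.
by rewrite gs// mE// fineK.
Qed.
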